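(* Let $F\in\mathrm{Ker}(\mathbf{L}+2\,\mathbf{Id})$ be an element of the second Wiener chaos with $\mathbb{E}(F^2)=1$. Then for every integer $p\ge 1$, $$\kappa_4(F)<\frac{24}{2^p\,(p+1)!}\quad\Longrightarrow\quad \frac{1}{\Gamma[F,F]}\in\bigcap_{0<q<\frac p2}L^q(\Omega,\mathcal{F},\mathbb{P}).$$
   Context: Let $(X_i)_{i\ge1}$ be an i.i.d. sequence of standard Gaussian random variables on a probability space $(\Omega,\mathcal F,\mathbb P)$ with $\mathcal F=\sigma(X_i; i\ge 1)$. The Ornstein–Uhlenbeck operator $\mathbf L$ is (the closure in $L^2$ of) the operator acting on smooth functions of finitely many $X_i$ by $$\mathbf L[f(X_1,\dots,X_d)]=\Delta f(X_1,\dots,X_d)-\sum_{i=1}^d X_i\,\partial_i f(X_1,\dots,X_d),$$ and the square field operator $\Gamma$ (the squared norm of the Malliavin derivative) is the (closed extension of the) quadratic operator $$\Gamma[f(X_1,\dots,X_d),f(X_1,\dots,X_d)]=\sum_{i=1}^d \big(\partial_i f(X_1,\dots,X_d)\big)^2 .$$ For an integer $k\ge1$, the $k$-th Wiener chaos is $\mathrm{Ker}(\mathbf L+k\,\mathbf{Id})\subset L^2(\Omega,\mathcal F,\mathbb P)$, equivalently the closed linear span in $L^2$ of the products $\prod_i H_{k_i}(X_i)$ with $\sum_i k_i=k$, where $H_m$ is the $m$-th Hermite polynomial. For $F$ in a Wiener chaos, $\Gamma[F,F]=\sum_{i\ge1}(D_iF)^2$, where $D_i$ is the closure of the partial derivative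 with respect to $X_i$. For $F$ in such a chaos with $\mathbb E(F^2)=1$, the fourth cumulant is $\kappa_4(F)=\mathbb E(F^4)-3$. For $q>0$, $Z\in L^q(\Omega,\mathcal F,\mathbb P)$ means $\mathbb E(|Z|^q)<\infty$. *)

(* Defs.v *)
From HB Require Import structures.
From mathcomp Require Export all_boot all_order all_algebra.
From mathcomp Require Export finmap.
From mathcomp Require Export all_classical all_reals all_analysis.
From mathcomp Require Export measurable_realfun.
Export Order.TTheory GRing.Theory Num.Theory.
Export numFieldNormedType.Exports.

Set Implicit Arguments.
Unset Strict Implicit.
Unset Printing Implicit Defensive.

Local Open Scope classical_set_scope.
Local Open Scope ring_scope.

Definition partial (R : realType) (n : nat) (i : 'I_n) (f : 'rV[R]_n -> R)
    : 'rV[R]_n -> R :=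
  fun x => 'D_(delta_mx 0 i) f x.

Definition iter_partial (R : realType) (n : nat) (s : seq 'I_n)
    (f : 'rV[R]_n -> R) : 'rV[R]_n -> R :=
  foldr (@partial R n) f s.

(* The space C_p^oo(R^n), i.e. the smooth functions all of whose partial
   derivatives have polynomial growth. The growth condition guarantees that
   f(X_1, ..., X_n) and all its derivatives are square integrable for
   Gaussian X_i. *)
Definition smooth_pg (R : realType) (n : nat) (f : 'rV[R]_n -> R) : Prop :=
  forall s : seq 'I_n,
    (forall x, differentiable (iter_partial s f) x) /\
    (exists (C : R) (m : nat),
      forall x, `|iter_partial s f x| <= C * (1 + `|x|) ^+ m).

Definition ou_op (R : realType) (n : nat) (f : 'rV[R]_n -> R)
    : 'rV[R]_n -> R :=
  fun x => \sum_(i < n) partial i (partial i f) x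
           - \sum_(i < n) x 0 i * partial i f x.

(* The derivative with respect to the i-th variable of a function of the
   variables 0, ..., n-1; it vanishes if n <= i. *)
Definition nat_partial (R : realType) (n : nat) (i : nat) (f : 'rV[R]_n -> R)
    : 'rV[R]_n -> R :=
  if insub i is Some j then partial (j : 'I_n) f else fun=> 0.

Section gaussian_space.
Context {d : measure_display} {Omega : measurableType d} {R : realType}.
Variable P : probability Omega R.

Definition mutually_independent (X : nat -> {RV P >-> R}) : Prop :=
  forall (I : {fset nat}) (B : nat -> set R),
    (forall i, measurable (B i)) ->
    P (\bigcap_(i in [set` I]) X i @^-1` B i) =
    (\prod_(i <- I) P (X i @^-1` B i))%E.

Definition standard_gaussian (Y : {RV P >-> R}) : Prop :=
  forall B : set R, measurable B -> distribution P Y B = normal_prob 0 1 B.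

Definition iid_standard_gaussian (X : nat -> {RV P >-> R}) : Prop :=
  mutually_independent X /\ forall i, standard_gaussian (X i).

(* The sigma-algebra of Omega is the one generated by the X_i (without
   completion). *)
Definition generates_measurable (X : nat -> {RV P >-> R}) : Prop :=
  @measurable d Omega =
  <<s [set A | exists (i : nat) (B : set R),
         measurable B /\ A = X i @^-1` B] >>.

Definition cvg_L2 (u : nat -> Omega -> R) (F : Omega -> R) : Prop :=
  (fun n => 'N[P]_2%:E[EFin \o (u n \- F)%R]%E) @ \oo --> 0%E.

(* An unbounded operator of L^2 is represented by its graph. *)
Definition L2_closure (A : (Omega -> R) -> (Omega -> R) -> Prop)
    (F G : Omega -> R) : Prop :=
  [/\ F \in Lfun P 2%:E, G \in Lfun P 2%:E &
      exists u v : nat -> Omega -> R,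
        [/\ forall n, A (u n) (v n), cvg_L2 u F & cvg_L2 v G]].

Variable X : nat -> {RV P >-> R}.

Definition cylinder (n : nat) (f : 'rV[R]_n -> R) : Omega -> R :=
  fun w => f (\row_(i < n) X i w).

Definition ou_core (U V : Omega -> R) : Prop :=
  exists (n : nat) (f : 'rV[R]_n -> R),
    [/\ smooth_pg f, U = cylinder f & V = cylinder (ou_op f)].

(* ornstein_uhlenbeck F G : F is in the domain of L, and L F = G *)
Definition ornstein_uhlenbeck : (Omega -> R) -> (Omega -> R) -> Prop :=
  L2_closure ou_core.

(* Ker (L + k Id) *)
Definition wiener_chaos (k : nat) : set (Omega -> R) :=
  [set F | ornstein_uhlenbeck F (fun w => - (k%:R * F w))].

Definition partial_core (i : nat) (U V : Omega -> R) : Prop :=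
  exists (n : nat) (f : 'rV[R]_n -> R),
    [/\ smooth_pg f, U = cylinder f & V = cylinder (nat_partial i f)].

(* A version of D_i F if F is in the domain of the closure D_i of the partial
   derivative (which determines D_i F almost surely), and 0 otherwise. *)
Definition malliavin_partial (i : nat) (F : Omega -> R) : Omega -> R :=
  xget (fun=> 0) [set G | L2_closure (partial_core i) F G].

(* Gamma[F, F] *)
Definition square_field (F : Omega -> R) : Omega -> \bar R :=
  fun w => (\sum_(0 <= i <oo) ((malliavin_partial i F w) ^+ 2)%:E)%E.

Definition kappa4 (F : Omega -> R) : \bar R :=
  ('E_P[fun w => (F w ^+ 4)%R] - 3%:E)%E.

(* Z is extended real-valued so as to apply to inverses: as 0^-1 = +oo in
   \bar R, the condition on 1 / Gamma[F, F] entails Gamma[F, F] > 0 almost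
   surely. *)
Definition in_Lq (q : R) (Z : Omega -> \bar R) : Prop :=
  measurable_fun setT Z /\ (\int[P]_w (`|Z w| `^ q) < +oo)%E.

End gaussian_space.

(* Main.v *)
(* Write F = sum a_ij (X_i X_j - delta_ij) with an infinite symmetric matrix (a_ij);
   let A_n be its truncation to order n, and F_n the corresponding variable.
   Gaussian integration by parts gives E F_n^2 = 2 tr A_n^2 and
   E F_n^4 = 12 (tr A_n^2)^2 + 48 tr A_n^4, and F_n is orthogonal to F - F_n even
   after multiplication by polynomials in X_0, ..., X_(n-1), so E F_n^4 <= E F^4.
   If all the A_n had rank < p, then (tr A_n^2)^2 <= (p - 1) tr A_n^4 would force
   (p - 1) kappa_4(F) >= 12. So some A_n has an invertible minor of order p, with
   rows I and columns J. As D_i F = 2 sum_j a_ij X_j, given the X_j with j not in J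
   the vector (D_i F), i in I, is an affine invertible image of the standard
   Gaussian vector (X_j), j in J; hence P(Gamma[F, F] <= e^2) <= (K e)^p, and this
   gives the negative moments of order q < p / 2.

   The expansion of F is obtained without Hermite polynomials: the definition of
   the chaos and integration by parts give a recursion for E[F m] over the
   monomials m, which F_n satisfies too, and the monomials are total in L^2. *)

From HB Require Import structures.
Require Import Defs.
From mathcomp Require Import ring lra.

Set Implicit Arguments.
Unset Strict Implicit.
Unset Printing Implicit Defensive.

Local Open Scope classical_set_scope.
Local Open Scope ring_scope.

(** * Moments and mean square convergence *)

Section moments.
Context {d : measure_display} {T : measurableType d} {R : realType}.
Variable P : probability T R.
Implicit Types (f g h : T -> R).

(** The truncations stand in for the spectral decomposition of the Hilbert-Schmidt operator attached
    to F: an invertible minor replaces p nonzero eigenvalues. It is chosen once and involves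
    finitely many entries, so the constant of the small-ball bound does not depend on the order of
    truncation and survives the limit. [Omega] is abstract, so the coordinates cannot be integrated
    one at a time. Instead, the law of the sequence is shown to be unchanged when one coordinate is
    replaced by an independent Gaussian; integration by parts and the conditioning on the other
    coordinates both rest on this. The recursion for the moments against monomials of degree m
    carries the factor m - 2. It determines every moment except those of degree 2, which are the
    free data a_ij. Monomials are unbounded, which complicates their totality. Exponential moments
    show that multiplication by the sine or cosine of a multiple of X_i preserves the orthogonal
    complement; iterating an odd cubic turns these functions into signs, and signs give the
    indicators of half-lines, which generate the sigma-algebra. *)

Definition intg f := P.-integrable setT (EFin \o f).

Lemma intg_mfun f : intg f -> measurable_fun setT f.
Proof. by move=> /measurable_int /measurable_EFinP. Qed.

Lemma intg_le f g : measurable_fun setT f -> intg g ->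
  (forall w, `|f w| <= g w) -> intg f.
Proof.
move=> mf ig fg; apply: (le_integrable measurableT _ _ ig); first exact/measurable_EFinP.
by move=> w _ /=; rewrite lee_fin (le_trans (fg w))// ler_norm.
Qed.

Lemma intg_cst r : intg (fun=> r).
Proof. exact: finite_measure_integrable_cst. Qed.

Lemma intgD f g : intg f -> intg g -> intg (fun w => f w + g w).
Proof. by move=> i1 i2; have := integrableD measurableT i1 i2. Qed.

Lemma intgB f g : intg f -> intg g -> intg (fun w => f w - g w).
Proof. by move=> i1 i2; have := integrableB measurableT i1 i2. Qed.

Lemma intgZ r f : intg f -> intg (fun w => r * f w).
Proof. by move=> i1; have := integrableZl measurableT r i1. Qed.

Lemma intg_norm f : intg f -> intg (fun w => `|f w|).
Proof. by move=> i; exact: (integrable_norm i). Qed.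

Lemma intg_sum (I : Type) (s : seq I) (Q : pred I) (F : I -> T -> R) :
  (forall i, intg (F i)) -> intg (fun w => \sum_(i <- s | Q i) F i w).
Proof.
move=> h; elim: s => [|a s ih].
  by under eq_fun do rewrite big_nil; exact: intg_cst.
under eq_fun do rewrite big_cons.
by case: (Q a) => //; exact: intgD.
Qed.

Definition Ex f : R := \int[P]_w f w.

Lemma eq_Ex f g : f =1 g -> Ex f = Ex g.
Proof. by move=> fg; apply: eq_Rintegral => x _. Qed.

Lemma ExD f g : intg f -> intg g -> Ex (fun w => f w + g w) = Ex f + Ex g.
Proof. by move=> i1 i2; rewrite /Ex RintegralD. Qed.

Lemma ExB f g : intg f -> intg g -> Ex (fun w => f w - g w) = Ex f - Ex g.
Proof. by move=> i1 i2; rewrite /Ex RintegralB. Qed.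

Lemma ExZ r f : intg f -> Ex (fun w => r * f w) = r * Ex f.
Proof. by move=> i1; rewrite /Ex RintegralZl. Qed.

Lemma Ex_cst r : Ex (fun=> r) = r.
Proof. by rewrite /Ex Rintegral_cst// [X in fine X](probability_setT P) mulr1. Qed.

Lemma Ex_sum (I : Type) (s : seq I) (Q : pred I) (F : I -> T -> R) :
  (forall i, intg (F i)) ->
  Ex (fun w => \sum_(i <- s | Q i) F i w) = \sum_(i <- s | Q i) Ex (F i).
Proof.
move=> h; elim: s => [|a s ih].
  by rewrite big_nil -[RHS](Ex_cst 0); apply: eq_Ex => w; rewrite big_nil.
rewrite big_cons -ih.
case: ifPn => Qa; last by apply: eq_Ex => w; rewrite big_cons (negbTE Qa).
rewrite -ExD//; last exact: intg_sum.
by apply: eq_Ex => w; rewrite big_cons Qa.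
Qed.

Lemma le_Ex f g : intg f -> intg g -> (forall w, f w <= g w) -> Ex f <= Ex g.
Proof. by move=> i1 i2 fg; apply: le_Rintegral. Qed.

Lemma Ex_ge0 f : (forall w, 0 <= f w) -> 0 <= Ex f.
Proof. by move=> h; apply: Rintegral_ge0. Qed.

Lemma ExE f : intg f -> (\int[P]_w (f w)%:E)%E = (Ex f)%:E.
Proof. by move=> i; rewrite /Ex /Rintegral fineK//; exact: integrable_fin_num. Qed.

Definition sqint f :=
  measurable_fun setT f /\ intg (fun w => f w ^+ 2).

(** Unlike square integrability, this is stable under products, so exponents need not be tracked
    when polynomials in Gaussian variables are multiplied. *)
Definition allmom f :=
  measurable_fun setT f /\ forall k, intg (fun w => `|f w| ^+ k).

Lemma allmom_sqint f : allmom f -> sqint f.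
Proof.
move=> [mf h]; split => //; apply: (intg_le _ (h 2%N)).
  exact: measurable_funX.
by move=> w; rewrite normrX.
Qed.

Lemma sqint_mul f g : sqint f -> sqint g -> intg (fun w => f w * g w).
Proof.
move=> [mf f2] [mg g2]; apply: (intg_le _ (intgD f2 g2)).
  exact: measurable_funM.
move=> w; rewrite normrM.
have := sqr_ge0 (`|f w| - `|g w|); rewrite -(real_normK (num_real (f w))).
rewrite -(real_normK (num_real (g w))).
have := normr_ge0 (f w); have := normr_ge0 (g w); nra.
Qed.

Lemma sqint_cst r : sqint (fun=> r).
Proof. by split; [exact: measurable_cst|exact: intg_cst]. Qed.

Lemma sqint_intg f : sqint f -> intg f.
Proof.
move=> hf; have := sqint_mul hf (sqint_cst 1).
by under eq_fun do rewrite mulr1.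
Qed.

Lemma sqintD f g : sqint f -> sqint g -> sqint (fun w => f w + g w).
Proof.
move=> hf hg; split; first by apply: measurable_funD; [exact: hf.1|exact: hg.1].
under eq_fun do rewrite sqrrD.
apply: intgD; last exact: hg.2.
apply: intgD; first exact: hf.2.
under eq_fun do rewrite -mulr_natl.
by apply: intgZ; exact: sqint_mul.
Qed.

Lemma sqintZ r f : sqint f -> sqint (fun w => r * f w).
Proof.
move=> hf; split; first by apply: measurable_funM => //; exact: hf.1.
under eq_fun do rewrite exprMn; apply: intgZ; exact: hf.2.
Qed.

Lemma sqintN f : sqint f -> sqint (fun w => - f w).
Proof. by move=> /(sqintZ (-1)); under eq_fun do rewrite mulN1r. Qed.

Lemma sqintB f g : sqint f -> sqint g -> sqint (fun w => f w - g w).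
Proof. by move=> hf /sqintN hg; exact: sqintD. Qed.

Lemma sqint_le f g : measurable_fun setT f -> sqint g ->
  (forall w, `|f w| <= `|g w|) -> sqint f.
Proof.
move=> mf [mg g2] fg; split => //; apply: (intg_le _ g2).
  exact: measurable_funX.
move=> w; rewrite -(real_normK (num_real (g w))) normrX.
by rewrite lerXn2r// nnegrE.
Qed.

Lemma allmom_cst r : allmom (fun=> r).
Proof. by split; [exact: measurable_cst|move=> k; exact: intg_cst]. Qed.

Lemma allmom_le f g : measurable_fun setT f -> allmom g ->
  (forall w, `|f w| <= `|g w|) -> allmom f.
Proof.
move=> mf [mg g2] fg; split => // k; apply: (intg_le _ (g2 k)).
  by apply: measurable_funX; exact: measurableT_comp.
by move=> w; rewrite normrX normr_id lerXn2r// nnegrE.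
Qed.

Lemma allmomM f g : allmom f -> allmom g -> allmom (fun w => f w * g w).
Proof.
move=> [mf hf] [mg hg]; split=> [|k]; first exact: measurable_funM.
apply: (intg_le _ (intgD (hf (k * 2)%N) (hg (k * 2)%N))).
  by apply: measurable_funX; apply: measurableT_comp => //; exact: measurable_funM.
move=> w; rewrite normrX normr_id normrM exprMn !exprM.
have : 0 <= `|f w| ^+ k by rewrite exprn_ge0.
have : 0 <= `|g w| ^+ k by rewrite exprn_ge0.
move: (`|f w| ^+ k) (`|g w| ^+ k) => a b; nra.
Qed.

Lemma allmomD f g : allmom f -> allmom g -> allmom (fun w => f w + g w).
Proof.
move=> [mf hf] [mg hg]; split=> [|k]; first exact: measurable_funD.
apply: (intg_le _ (intgZ (2 ^+ k) (intgD (hf k) (hg k)))).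
  by apply: measurable_funX; apply: measurableT_comp => //; exact: measurable_funD.
move=> w; rewrite normrX normr_id.
have [ab|ba] := leP `|f w| `|g w|.
- apply: (@le_trans _ _ ((2 * `|g w|) ^+ k)).
    rewrite lerXn2r ?nnegrE ?mulr_ge0//.
    by rewrite (le_trans (ler_normD _ _))// mulr2n mulrDl mul1r lerD2r.
  by rewrite exprMn ler_pM2l ?exprn_gt0// lerDr exprn_ge0.
- apply: (@le_trans _ _ ((2 * `|f w|) ^+ k)).
    rewrite lerXn2r ?nnegrE ?mulr_ge0//.
    by rewrite (le_trans (ler_normD _ _))// mulr2n mulrDl mul1r lerD2l ltW.
  by rewrite exprMn ler_pM2l ?exprn_gt0// lerDl exprn_ge0.
Qed.

Lemma allmomZ r f : allmom f -> allmom (fun w => r * f w).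
Proof. by apply: allmomM; exact: allmom_cst. Qed.

Lemma allmomB f g : allmom f -> allmom g -> allmom (fun w => f w - g w).
Proof.
move=> hf /(allmomZ (-1)); under eq_fun do rewrite mulN1r; exact: allmomD.
Qed.

Lemma allmomX k f : allmom f -> allmom (fun w => f w ^+ k).
Proof.
move=> hf; elim: k => [|k ih]; first exact: allmom_cst.
by under eq_fun do rewrite exprS; exact: allmomM.
Qed.

Lemma allmom_sum (I : Type) (s : seq I) (Q : pred I) (F : I -> T -> R) :
  (forall i, allmom (F i)) -> allmom (fun w => \sum_(i <- s | Q i) F i w).
Proof.
move=> h; elim: s => [|a s ih].
  by under eq_fun do rewrite big_nil; exact: allmom_cst.
under eq_fun do rewrite big_cons.
by case: (Q a) => //; exact: allmomD.
Qed.

Lemma allmom_intg f : allmom f -> intg f.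
Proof. by move=> /allmom_sqint /sqint_intg. Qed.

Lemma cauchy_schwarz f g : sqint f -> sqint g ->
  Ex (fun w => f w * g w) ^+ 2 <=
  Ex (fun w => f w ^+ 2) * Ex (fun w => g w ^+ 2).
Proof.
move=> hf hg.
have hfg := sqint_mul hf hg.
have key t : 0 <= Ex (fun w => f w ^+ 2) + t * 2 * Ex (fun w => f w * g w)
    + t ^+ 2 * Ex (fun w => g w ^+ 2).
  have : 0 <= Ex (fun w => (f w + t * g w) ^+ 2).
    by apply: Ex_ge0 => w; rewrite sqr_ge0.
  rewrite (_ : Ex _ = Ex (fun w => (f w ^+ 2 + t * 2 * (f w * g w)) +
      t ^+ 2 * (g w ^+ 2))); last by apply: eq_Ex => w; ring.
  rewrite ExD; [|apply: intgD; [exact: hf.2|exact: intgZ]|exact: (intgZ _ hg.2)].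
  by rewrite ExD; [rewrite !ExZ//; exact: hg.2|exact: hf.2|exact: intgZ].
set a := Ex (fun w => g w ^+ 2) in key *.
set c := Ex (fun w => f w ^+ 2) in key *.
set b := Ex _ in key *.
have a0 : 0 <= a by apply: Ex_ge0 => w; rewrite sqr_ge0.
move: a0; rewrite le_eqVlt => /predU1P[a0|a0].
  rewrite -a0 mulr0 in key *.
  have [->|b0] := eqVneq b 0; first by rewrite expr0n.
  (* With E g^2 = 0 the polynomial in t is affine, and this t makes it equal to -1. *)
  have := key (- (c + 1) / (2 * b)).
  have -> : c + - (c + 1) / (2 * b) * 2 * b + (- (c + 1) / (2 * b)) ^+ 2 * 0 = -1.
    by field.
  by rewrite leNgt ltrN10.
have := key (- b / a).
have -> : c + - b / a * 2 * b + (- b / a) ^+ 2 * a = (c * a - b ^+ 2) / a.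
  by field; rewrite gt_eqF.
by rewrite pmulr_lge0 ?invr_gt0// subr_ge0.
Qed.

Definition cvgL2 (u : nat -> T -> R) f :=
  (fun n => Ex (fun w => (u n w - f w) ^+ 2)) @ \oo --> (0 : R).

Lemma sqint_Lfun f : f \in Lfun P 2%:E <-> sqint f.
Proof.
split=> [h|[mf f2]].
  split; last by have := Lfun2_integrable_sqr h.
  by move: h; rewrite inE => /andP[]; rewrite inE.
apply/andP; split; rewrite inE//= /finite_norm.
rewrite unlock/= poweR_lty//.
under eq_integral do rewrite powR_mulrn// real_normK ?num_real//.
by rewrite ExE// ltry.
Qed.

Lemma cvg_L2E (u : nat -> T -> R) f : (forall n, sqint (u n)) -> sqint f ->
  cvg_L2 P u f <-> cvgL2 u f.
Proof.
move=> hu hf.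
have E0 n : 0 <= Ex (fun w => (u n w - f w) ^+ 2).
  by apply: Ex_ge0 => w; rewrite sqr_ge0.
have E n : ('N[P]_2%:E[EFin \o (u n \- f)%R])%E =
    (Num.sqrt (Ex (fun w => (u n w - f w) ^+ 2)))%:E.
  rewrite unlock/= -powR12_sqrt//.
  under eq_integral do rewrite powR_mulrn// real_normK ?num_real//.
  by rewrite ExE//; have [] := sqintB (hu n) hf.
rewrite /cvg_L2 (funext E) /cvgL2; split.
- move=> /fine_cvgP[_] /= h.
  have h2 := cvgM h h; rewrite mulr0 in h2.
  rewrite (_ : (fun n => Ex _) = (fine \o (fun n =>
    (Num.sqrt (Ex (fun w => (u n w - f w) ^+ 2)))%:E)) \*
    (fine \o (fun n => (Num.sqrt (Ex (fun w => (u n w - f w) ^+ 2)))%:E))); last first.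
    by apply/funext => n; rewrite /= -expr2 sqr_sqrtr.
  exact: h2.
- move=> h; apply: cvg_EFin; first by near=> n.
  rewrite /comp/=.
  rewrite -[X in _ --> X]sqrtr0.
  by apply: (cvg_comp _ _ h); exact: sqrt_continuous.
Unshelve. all: by end_near. Qed.

Lemma cvg_sqr0 (a b : nat -> R) (c : R) : a @ \oo --> (0 : R) ->
  (forall n, (b n - c) ^+ 2 <= a n) -> b @ \oo --> c.
Proof.
move=> a0 ab; apply/cvgrPdist_lt => e e0.
have e2 : 0 < e ^+ 2 by rewrite exprn_gt0.
move/cvgrPdist_lt : a0 => /(_ _ e2); apply: filterS => n.
rewrite sub0r normrN => h.
rewrite distrC -(@ltr_pXn2r _ 2)// ?nnegrE ?(ltW e0)//.
rewrite real_normK ?num_real//.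
exact: le_lt_trans (ab n) (le_lt_trans (ler_norm _) h).
Qed.

Lemma cvgL2_mul u f g : (forall n, sqint (u n)) -> sqint f -> sqint g ->
  cvgL2 u f ->
  (fun n => Ex (fun w => u n w * g w)) @ \oo --> Ex (fun w => f w * g w).
Proof.
move=> hu hf hg uf.
apply: (@cvg_sqr0 (fun n => Ex (fun w => (u n w - f w) ^+ 2) *
  Ex (fun w => g w ^+ 2))).
  by rewrite -(mul0r (Ex (fun w => g w ^+ 2))); apply: cvgM => //; exact: cvg_cst.
move=> n; rewrite -ExB; try exact: sqint_mul.
rewrite (_ : Ex _ = Ex (fun w => (u n w - f w) * g w)).
  by apply: cauchy_schwarz => //; exact: sqintB.
by apply: eq_Ex => w; rewrite mulrBl.
Qed.

Lemma Ex_sqrB_le f g h : sqint f -> sqint g -> sqint h ->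
  Ex (fun w => (f w - h w) ^+ 2) <=
  2 * (Ex (fun w => (f w - g w) ^+ 2) + Ex (fun w => (g w - h w) ^+ 2)).
Proof.
move=> hf hg hh.
have i1 := (sqintB hf hg).2; have i2 := (sqintB hg hh).2.
rewrite -ExD// -ExZ; last exact: intgD.
apply: le_Ex; [exact: (sqintB hf hh).2|by apply: intgZ; exact: intgD|].
move=> w; have := sqr_ge0 (f w - g w - (g w - h w)); nra.
Qed.

Lemma ae_eq_Ex f g : measurable_fun setT f -> measurable_fun setT g ->
  {ae P, forall w, f w = g w} -> Ex f = Ex g.
Proof.
move=> mf mg fg; rewrite /Ex /Rintegral; congr fine.
apply: ae_eq_integral => //; [exact/measurable_EFinP..|].
by move: fg; apply: filterS => w /= h _; rewrite h.
Qed.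

Lemma cvgL2_ae_eq (u : nat -> T -> R) f g : (forall n, sqint (u n)) ->
  sqint f -> sqint g -> {ae P, forall w, f w = g w} -> cvgL2 u f -> cvgL2 u g.
Proof.
move=> hu hf hg fg; rewrite /cvgL2 (_ : (fun n => Ex (fun w => (u n w - g w) ^+ 2)) =
  (fun n => Ex (fun w => (u n w - f w) ^+ 2)))//.
apply/funext => n; apply: ae_eq_Ex.
- by apply: measurable_funX; have [] := sqintB (hu n) hg.
- by apply: measurable_funX; have [] := sqintB (hu n) hf.
by move: fg; apply: filterS => w ->.
Qed.

Lemma chebyshev_sqint f (e : R) : sqint f -> 0 < e ->
  (P [set w | (e <= `|f w|)%R] <= (Ex (fun w => f w ^+ 2) / e ^+ 2)%:E)%E.
Proof.
move=> [mf f2] e0.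
have e2 : 0 < e ^+ 2 by rewrite exprn_gt0.
rewrite EFinM lee_pdivlMr// muleC -ExE//.
have mA : measurable [set w | e <= `|f w|].
  have := measurable_fun_ler (measurable_cst e) (measurableT_comp (@normr_measurable R setT) mf).
  move=> /(_ measurableT [set true]) ; rewrite setTI preimage_true; exact.
rewrite -[X in (_ * P X)%E]setIT -integral_indic// -integralZl//; last first.
  exact: integrable_indic.
apply: ge0_le_integral => //.
- by move=> w _; rewrite mule_ge0// lee_fin ltW.
- by apply/measurable_EFinP; apply: measurable_funM.
- by apply/measurable_EFinP; exact: measurable_funX.
move=> w _; rewrite -EFinM lee_fin indicE.
have [|] := boolP (w \in _); last by rewrite mulr0 sqr_ge0.
rewrite inE/= mulr1 => h; rewrite -(real_normK (num_real (f w))).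
by rewrite lerXn2r ?nnegrE// ltW.
Qed.

(** Fatou's lemma for the squares of [v n - g]. The limit [f] is only known to be measurable, so
    integrability is part of the conclusion. *)
Lemma sqint_ae_lim (v : nat -> T -> R) f g (e : R) : (forall n, sqint (v n)) ->
  measurable_fun setT f -> sqint g ->
  {ae P, forall w, (fun n => v n w) @ \oo --> f w} ->
  (forall n, Ex (fun w => (v n w - g w) ^+ 2) <= e) ->
  sqint (fun w => f w - g w) /\ Ex (fun w => (f w - g w) ^+ 2) <= e.
Proof.
move=> hv mf hg vf ve.
have mfg : measurable_fun setT (fun w => f w - g w).
  by apply: measurable_funB => //; exact: hg.1.
have mV n : measurable_fun setT (fun w => ((v n w - g w) ^+ 2)%:E).
  apply/measurable_EFinP; apply: measurable_funX; apply: measurable_funB.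
    exact: (hv n).1.
  exact: hg.1.
have le : (\int[P]_w ((f w - g w) ^+ 2)%:E <= e%:E)%E.
  rewrite (ae_eq_integral (fun w => limn_einf (fun n => ((v n w - g w) ^+ 2)%:E)))//.
  - apply: (le_trans (fatou _ measurableT mV _)).
      by move=> n x _; rewrite lee_fin sqr_ge0.
    rewrite limn_einf_lim; apply: lime_le; first exact: is_cvg_einfs.
    apply: nearW => n.
    apply: (@le_trans _ _ (\int[P]_w ((v n w - g w) ^+ 2)%:E)%E).
      by apply: ereal_inf_lbound; exists n => /=.
    by rewrite ExE ?lee_fin//; have [] := sqintB (hv n) hg.
  - by apply/measurable_EFinP; exact: measurable_funX.
  - rewrite /limn_einf; apply: measurableT_comp => //.
    by apply: measurable_fun_limn_esup => n; exact: measurableT_comp.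
  move: vf; apply: filterS => w h _.
  apply/esym; apply: (cvg_limn_einf_sup _).1.
  apply: cvg_EFin; first by near=> n.
  apply: cvgM; apply: cvgB => //; exact: cvg_cst.
have sq : sqint (fun w => f w - g w).
  split => //; apply/integrableP; split.
    by apply/measurable_EFinP; exact: measurable_funX.
  apply: le_lt_trans (ltry e); apply: le_trans le.
  by under eq_integral do rewrite /comp abse_EFin (ger0_norm (sqr_ge0 _)).
split => //; rewrite -lee_fin -ExE//; exact: sq.2.
Unshelve. all: by end_near. Qed.

Lemma Ex_norm_le f : sqint f ->
  Ex (fun w => `|f w|) <= Num.sqrt (Ex (fun w => f w ^+ 2)).
Proof.
move=> hf.
have E0 : 0 <= Ex (fun w => f w ^+ 2) by apply: Ex_ge0 => w; rewrite sqr_ge0.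
have mf : sqint (fun w => `|f w|).
  by apply: (sqint_le _ hf) => [|w]; rewrite ?normr_id//; apply: measurableT_comp => //; exact: hf.1.
rewrite -(@ler_pXn2r _ 2)// ?nnegrE ?sqrtr_ge0 ?Ex_ge0// sqr_sqrtr//.
have := cauchy_schwarz mf (sqint_cst 1).
rewrite (_ : Ex _ = Ex (fun w => `|f w|)); last by apply: eq_Ex => w; rewrite mulr1.
rewrite expr1n Ex_cst mulr1.
by under [X in _ <= Ex X]eq_fun do rewrite real_normK ?num_real//.
Qed.

(** The increments have L1 norm at most 2^-n, so the sum of their absolute values is integrable,
    hence finite almost everywhere, and the telescoping series converges absolutely. *)
Lemma cvg_ae_of_summable (v : nat -> T -> R) : (forall n, sqint (v n)) ->
  (forall n, Ex (fun w => (v n.+1 w - v n w) ^+ 2) <= 4^-1 ^+ n) ->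
  {ae P, forall w, cvgn (fun n => v n w)}.
Proof.
move=> hv ve.
pose D n w := `|v n.+1 w - v n w|.
have hD n : sqint (fun w => v n.+1 w - v n w) by exact: sqintB.
have mD n : measurable_fun setT (fun w => (D n w)%:E).
  by apply/measurable_EFinP; apply: measurableT_comp => //; exact: (hD n).1.
have ED n : (\int[P]_w (D n w)%:E <= (2^-1 ^+ n)%:E)%E.
  rewrite ExE; last by apply: intg_norm; exact: sqint_intg.
  rewrite lee_fin (le_trans (Ex_norm_le (hD n)))//.
  rewrite -[leRHS]ger0_norm ?exprn_ge0// -sqrtr_sqr ler_wsqrtr//.
  rewrite (le_trans (ve n))// -exprM mulnC exprM expr2 -invfM.
  by rewrite -natrM.
pose S w := (\sum_(0 <= n <oo) (D n w)%:E)%E.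
have mS : measurable_fun setT S by apply: ge0_emeasurable_sum => // n x _ _; rewrite lee_fin normr_ge0.
have iS : P.-integrable setT S.
  apply/integrableP; split => //.
  have S0 w : (0 <= S w)%E by apply: nneseries_ge0 => n _ _; rewrite lee_fin normr_ge0.
  under eq_integral do rewrite gee0_abs//.
  rewrite integral_nneseries//; last by move=> n x _; rewrite lee_fin normr_ge0.
  apply: (@le_lt_trans _ _ (\sum_(0 <= n <oo) (2^-1 ^+ n)%:E)%E).
    by apply: lee_nneseries => // n _ _; apply: integral_ge0 => x _; rewrite lee_fin normr_ge0.
  have /cvg_lim h : (fun n => (\sum_(0 <= k < n) (2^-1 ^+ k)%:E)%E) @ \oo --> (2 : R)%:E.
    under eq_fun do rewrite sumEFin.
    apply: cvg_EFin; first by near=> n.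
    have h2 : `|2^-1| < 1 :> R by rewrite ger0_norm// invf_lt1// ltr1n.
    have := @cvg_geometric_series R 1 2^-1 h2.
    have -> : 1 / (1 - 2^-1) = 2 :> R by field.
    by rewrite /series/= /geometric/=; under eq_fun do under eq_bigr do rewrite mul1r.
  by rewrite h// ltry.
have := integrable_ae measurableT iS; apply: filterS => w /(_ I) Sfin.
have -> : (fun n => v n w) = (fun n => v 0%N w + series (telescope (fun n => v n w)) n).
  by apply/funext => n; rewrite -eq_sum_telescope.
apply: is_cvgD; first exact: is_cvg_cst.
apply: normed_cvg; apply: nondecreasing_is_cvgn.
  by apply: nondecreasing_series => i _ _; exact: normr_ge0.
exists (fine (S w)) => _ [n _ <-].
rewrite -lee_fin fineK// /series/= -sumEFin.
by apply: nneseries_lim_ge => k _ _; rewrite lee_fin normr_ge0.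
Unshelve. all: by end_near. Qed.

Lemma L2_complete (u : nat -> T -> R) : (forall n, sqint (u n)) ->
  (forall e : R, 0 < e -> exists N, forall m n, (N <= m)%N -> (N <= n)%N ->
     Ex (fun w => (u m w - u n w) ^+ 2) <= e) ->
  exists2 f, sqint f & cvgL2 u f.
Proof.
move=> hu cu.
have /choice[N hN] k : exists N, forall m n, (N <= m)%N -> (N <= n)%N ->
    Ex (fun w => (u m w - u n w) ^+ 2) <= 4^-1 ^+ k.
  by apply: cu; rewrite exprn_gt0.
(* The sum makes [phi] monotone and at least [N k]; the summand [k] makes it at least [k]. *)
pose phi k := (k + \sum_(i < k.+1) N i)%N.
have phiS k : (phi k <= phi k.+1)%N.
  by rewrite /phi [in leqRHS]big_ord_recr/= leq_add// leq_addr.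
have Nphi k : (N k <= phi k)%N.
  by rewrite /phi big_ord_recr/= addnA leq_addl.
have lephi k : (k <= phi k)%N by rewrite leq_addr.
pose v k := u (phi k).
have hv k : sqint (v k) by exact: hu.
have cv := @cvg_ae_of_summable v hv (fun k => hN k _ _
  (leq_trans (Nphi k) (phiS k)) (Nphi k)).
(* The upper limit is measurable without any convergence, and equals the limit wherever there is
   one. *)
pose f w := fine (limn_esup (fun k => (v k w)%:E)).
have mf : measurable_fun setT f.
  apply: measurableT_comp => //; apply: measurable_fun_limn_esup => k.
  by apply/measurable_EFinP; exact: (hv k).1.
have vf : {ae P, forall w, (fun n => v n w) @ \oo --> f w}.
  move: cv; apply: filterS => w cv.
  suff -> : f w = limn (fun n => v n w) by [].
  have h : (fun n => (v n w)%:E) @ \oo --> (limn (fun n => v n w))%:E.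
    by apply: cvg_EFin => //; near=> n.
  by rewrite /f (cvg_limn_einf_sup h).2.
have close e : 0 < e -> exists M, forall n, (M <= n)%N ->
    sqint (fun w => f w - u n w) /\ Ex (fun w => (f w - u n w) ^+ 2) <= e.
  move=> e0; have [M hM] := cu e e0; exists M => n Mn.
  apply: (@sqint_ae_lim (fun k => v (k + M)%N)) => //.
  - move: vf; apply: filterS => w h.
    by have := h; rewrite -(cvg_shiftn M (fun k => v k w)).
  - by move=> k; apply: hM => //; rewrite (leq_trans _ (lephi _))// leq_addl.
have sf : sqint f.
  have [M /(_ M (leqnn _))[h _]] := close 1 ltr01.
  by have := sqintD h (hu M); under eq_fun do rewrite subrK.
exists f => //; apply/cvgrPdist_le => e e0.
have [M hM] := close e e0; exists M => // n /= /hM[_ h].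
rewrite sub0r normrN ger0_norm; last by apply: Ex_ge0 => w; rewrite sqr_ge0.
by apply: le_trans h; rewrite le_eqVlt; apply/orP; left; apply/eqP; apply: eq_Ex => w; ring.
Unshelve. all: by end_near. Qed.

End moments.

(** * The standard Gaussian measure *)

Section gaussian_measure.
Context {R : realType}.
Local Notation mu := (@lebesgue_measure R).
Local Notation pdf := (@normal_pdf R 0 1).

Definition idR : measurableTypeR R -> R := id.

Lemma measurable_idR : measurable_fun setT idR.
Proof. exact: measurable_id. Qed.

HB.instance Definition _ := isMeasurableFun.Build _ _ _ _ idR measurable_idR.

(* The standard Gaussian measure, transported from the Borel space on which
   [normal_prob] is defined to [R] itself, which carries another display. *)
Definition gauss : probability R R := distribution (normal_prob (0 : R) 1) idR.

(** The Radon-Nikodym derivative of the normal law and the explicit density have the same integral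
    over every measurable set, so they agree almost everywhere. *)
Lemma ge0_integral_gauss (f : R -> \bar R) : measurable_fun setT f ->
  (forall x, (0 <= f x)%E) ->
  (\int[gauss]_x f x = \int[mu]_x (f x * (pdf x)%:E))%E.
Proof.
move=> mf f0.
rewrite /gauss ge0_integral_distribution//.
rewrite -(Radon_Nikodym_SigmaFinite.change_of_variables
  (normal_prob_dominates 0 1))//.
have i := Radon_Nikodym_SigmaFinite.f_integrable (normal_prob_dominates (0 : R) 1).
apply: ae_eq_integral => //.
- by apply: emeasurable_funM => //; exact: (measurable_int _ i).
- apply: emeasurable_funM => //; apply/measurable_EFinP.
  exact: measurable_normal_pdf.
apply: ae_eqe_mul2l; apply: integral_ae_eq => //.
  by apply/measurable_EFinP; exact: measurable_normal_pdf.
by move=> E _ mE; rewrite -Radon_Nikodym_SigmaFinite.f_integral//; exact: normal_prob_dominates.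
Qed.

Lemma intg_gaussE (f : R -> R) : measurable_fun setT f ->
  intg gauss f <-> mu.-integrable setT (fun x => (f x * pdf x)%:E).
Proof.
move=> mf.
have E : (\int[gauss]_x `|(f x)%:E| = \int[mu]_x `|(f x * pdf x)%:E|)%E.
  rewrite ge0_integral_gauss//; last by apply: measurableT_comp => //; exact/measurable_EFinP.
  by apply: eq_integral => x _; rewrite EFinM abseM [(`|(pdf x)%:E|)%E]gee0_abs// lee_fin normal_pdf_ge0.
split=> /integrableP[_ h]; apply/integrableP; split; rewrite ?E -?E//.
- by apply/measurable_EFinP; apply: measurable_funM => //; exact: measurable_normal_pdf.
- by apply/measurable_EFinP.
- by rewrite -E in h.
Qed.

Lemma integral_gauss (f : R -> R) : intg gauss f ->
  (\int[gauss]_x (f x)%:E = \int[mu]_x (f x * pdf x)%:E)%E.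
Proof.
move=> i; have mf := intg_mfun i.
have := (intg_gaussE mf).1 i => j.
rewrite integralE [RHS]integralE; congr (_ - _)%E;
  rewrite ge0_integral_gauss//.
- apply: eq_integral => x _; rewrite !funeposE EFinM.
  by rewrite maxe_pMl ?mul0e// lee_fin normal_pdf_ge0.
- by apply: measurable_funepos; apply/measurable_EFinP.
- apply: eq_integral => x _; rewrite !funenegE EFinM.
  by rewrite maxe_pMl ?mul0e ?mulNe// lee_fin normal_pdf_ge0.
- by apply: measurable_funeneg; apply/measurable_EFinP.
Qed.

Lemma normal_pdf01E (x : R) : pdf x = normal_peak 1 * expR (- x ^+ 2 / 2).
Proof.
by rewrite normal_pdfE// /normal_fun subr0 expr1n.
Qed.

Lemma intg_gauss_exp (t : R) : intg gauss (fun x => expR (t * `|x|)).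
Proof.
have m1 : measurable_fun setT (fun x : R => expR (t * `|x|)).
  by apply: measurableT_comp => //; apply: measurable_funM.
apply/intg_gaussE => //.
have n2 : (2 : R) != 0 by rewrite pnatr_eq0.
have p2 := normal_peak_gt0 n2.
(* From (t - |x|/2)^2 >= 0 follows t|x| - x^2/2 <= t^2 - x^2/4 <= t^2 - x^2/8, whence domination by
   the density of standard deviation 2. *)
apply: (@le_integrable _ _ _ mu _ measurableT _ (fun x =>
   ((normal_peak 1 * expR (t ^+ 2) / normal_peak 2)%:E * (normal_pdf 0 2 x)%:E)%E)).
- by apply/measurable_EFinP; apply: measurable_funM => //; exact: measurable_normal_pdf.
- move=> x _.
  rewrite !gee0_abs ?mule_ge0// ?lee_fin ?mulr_ge0 ?expR_ge0 ?normal_pdf_ge0 ?normal_peak_ge0 ?invr_ge0 ?normal_peak_ge0//.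
  rewrite normal_pdf01E normal_pdfE// mulrCA -!mulrA ler_wpM2l ?normal_peak_ge0//.
  rewrite mulKf ?gt_eqF// /normal_fun -!expRD ler_expR subr0.
  have := sqr_ge0 (t - `|x| / 2); rewrite -(real_normK (num_real x)).
  have -> : (2 : R) ^+ 2 *+ 2 = 8 by ring.
  move: `|x| => y.
  have := sqr_ge0 y; lra.
- by apply: integrableZl => //; exact: integrable_normal_pdf.
Qed.

Lemma allmom_gauss_exp (t : R) : allmom gauss (fun x => expR (t * `|x|)).
Proof.
split=> [|k].
  by apply: measurableT_comp => //; apply: measurable_funM.
have := intg_gauss_exp (k%:R * t); congr (intg gauss _); apply/funext => x.
by rewrite (ger0_norm (expR_ge0 _)) -expRM_natl mulrA.
Qed.

Lemma poly_growth_exp (C x : R) (m : nat) (y : R) : `|y| <= C * (1 + `|x|) ^+ m ->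
  `|y| <= `|C| * expR (m%:R * `|x|).
Proof.
move=> h; apply: (le_trans h).
apply: (@le_trans _ _ (`|C| * (1 + `|x|) ^+ m)).
  by rewrite ler_wpM2r ?ler_norm// exprn_ge0// addr_ge0.
rewrite ler_wpM2l// -mulrC expRM_natr lerXn2r ?nnegrE ?addr_ge0 ?expR_ge0//.
exact: expR_ge1Dx.
Qed.

Lemma allmom_gauss_growth (f : R -> R) C m : measurable_fun setT f ->
  (forall x, `|f x| <= C * (1 + `|x|) ^+ m) -> allmom gauss f.
Proof.
move=> mf fC; have h := allmomZ `|C| (allmom_gauss_exp m%:R).
apply: allmom_le h _ => // x.
by rewrite [leRHS]ger0_norm ?mulr_ge0 ?expR_ge0// poly_growth_exp.
Qed.

Lemma cvg_growth_pdf (f : R -> R) C m (s : R) : `|s| = 1 ->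
  (forall x, `|f x| <= C * (1 + `|x|) ^+ m) ->
  (fun n : nat => f (s * n%:R) * pdf (s * n%:R)) @ \oo --> (0 : R).
Proof.
(* The constant comes from m n - n^2/2 <= (m + 1)^2/2 - n, a completed square. *)
move=> s1 fC; pose K := `|C| * normal_peak 1 * expR ((m.+1)%:R ^+ 2 / 2).
have h0 : (fun n : nat => K * expR (- n%:R)) @ \oo --> (0 : R).
  rewrite -[X in _ --> X](mulr0 K); apply: cvgM; first exact: cvg_cst.
  exact: cvgn_expR.
apply/cvgrPdist_lt => e e0.
move/cvgrPdist_lt : h0 => /(_ _ e0); apply: filterS => n /= h.
apply: le_lt_trans h; rewrite !sub0r !normrN.
rewrite normrM (ger0_norm (normal_pdf_ge0 _ _ _)) normal_pdf01E.
rewrite [leRHS]ger0_norm ?mulr_ge0 ?expR_ge0 ?normal_peak_ge0//.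
apply: le_trans (ler_wpM2r _ (poly_growth_exp (fC _))) _.
  by rewrite mulr_ge0 ?expR_ge0 ?normal_peak_ge0.
rewrite normrM s1 mul1r ger0_norm// exprMn.
have -> : s ^+ 2 = 1 by rewrite -(real_normK (num_real s)) s1 expr1n.
rewrite mul1r mulrACA /K -!mulrA ler_wpM2l// ler_wpM2l ?normal_peak_ge0//.
rewrite -!expRD ler_expR -[m.+1%:R]natr1.
have := sqr_ge0 (n%:R - (m%:R + 1) : R); move: (n%:R : R) (m%:R : R) => a b; lra.
Qed.

Lemma is_derive_normal_pdf (x : R) : is_derive x 1 pdf (- x * pdf x).
Proof.
rewrite (_ : pdf = fun x => normal_peak 1 * expR (- x ^+ 2 / 2)); last first.
  by apply/funext => y; rewrite normal_pdf01E.
have dq : is_derive x 1 (fun x : R => - x ^+ 2 / 2) (- x).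
  rewrite (_ : (fun x : R => - x ^+ 2 / 2) = - 2^-1 *: (@id R ^+ 2)); last first.
    apply/funext => y; rewrite /= !fctE.
    by rewrite (_ : _ *: _ = - 2^-1 * y ^+ 2)//; field.
  by apply: is_derive_eq; rewrite /GRing.scale/= !mulr1 expr1; field.
have de := @is_derive1_comp R expR (fun x : R => - x ^+ 2 / 2) x _ _
  (is_derive_expR (- x ^+ 2 / 2)) dq.
apply: (is_derive_eq (is_deriveZ (normal_peak 1) de)).
by rewrite /GRing.scale/=; ring.
Qed.

(** The function (f' - x f) [pdf] is the derivative of f [pdf]. Its integral over [-n, n] is a
    boundary term that tends to 0 by polynomial growth, and dominated convergence gives the whole
    line. *)
Lemma gauss_ibp (f f' : R -> R) C m C' m' :
  (forall x : R, is_derive x 1 f (f' x)) -> continuous f' ->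
  (forall x, `|f x| <= C * (1 + `|x|) ^+ m) ->
  (forall x, `|f' x| <= C' * (1 + `|x|) ^+ m') ->
  Ex gauss f' = Ex gauss (fun x => x * f x).
Proof.
move=> df cf' fC fC'.
have cf : continuous f.
  by move=> x; apply: differentiable_continuous; apply/derivable1_diffP; exact: ex_derive.
have mf : measurable_fun setT f by exact: continuous_measurable_fun.
have mf' : measurable_fun setT f' by exact: continuous_measurable_fun.
have aid : allmom gauss (@id R).
  apply: (@allmom_gauss_growth _ 1 1) => // x.
  by rewrite mul1r expr1 lerDr.
have af := allmom_gauss_growth mf fC.
have af' := allmom_gauss_growth mf' fC'.
have axf := allmomM aid af.
have ah := allmomB af' axf.
apply/eqP; rewrite -subr_eq0 -ExB; [|exact: allmom_intg..].
apply/eqP; pose h x := f' x - x * f x.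
have ih := (intg_gaussE ah.1).1 (allmom_intg ah).
have ch : continuous (fun x => h x * pdf x).
  move=> x; apply: cvgM; last exact: continuous_normal_pdf.
  apply: cvgB; first exact: cf'.
  by apply: cvgM; [exact: cvg_id|exact: cf].
pose g x := f x * pdf x.
have dg (x : R) : is_derive x 1 g (h x * pdf x).
  apply: (is_derive_eq (is_deriveM (df x) (is_derive_normal_pdf x))).
  by rewrite /h /GRing.scale/=; ring.
pose I n : set R := `[- n%:R, n%:R]%classic.
have FTC n : (\int[mu]_(x in I n.+1) (h x * pdf x)%:E = (g n.+1%:R)%:E - (g (- n.+1%:R))%:E)%E.
  apply: continuous_FTC2.
  - by rewrite gtrN// ltr0n.
  - by apply: continuous_subspaceT => x; exact: ch.
  - have cg : continuous g.
      by move=> x; apply: differentiable_continuous; apply/derivable1_diffP; exact: ex_derive.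
    split; first by move=> x _; exact: ex_derive.
    + by apply: cvg_at_right_filter; exact: cg.
    + by apply: cvg_at_left_filter; exact: cg.
  - by move=> x _; rewrite derive1E derive_val.
have lim0 : (fun n => \int[mu]_(x in I n.+1) (h x * pdf x)%:E)%E @ \oo --> (0%:E : \bar R).
  under eq_fun do rewrite FTC -EFinB.
  apply: cvg_EFin; first by near=> n.
  rewrite -[X in _ --> X](subr0 0); apply: cvgB.
  - have := @cvg_growth_pdf f C m 1 (normr1 _) fC.
    by rewrite -cvg_shiftS/=; under eq_fun do rewrite mul1r.
  - have := @cvg_growth_pdf f C m (-1) _ fC; rewrite normrN1 => /(_ erefl).
    by rewrite -cvg_shiftS/=; under eq_fun do rewrite mulN1r.
have limI : (fun n => \int[mu]_(x in I n.+1) (h x * pdf x)%:E)%E @ \oo -->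
    (\int[mu]_x (h x * pdf x)%:E)%E.
  under eq_fun do rewrite integral_mkcond.
  have [] := @dominated_convergence _ _ _ mu setT measurableT
    (fun n => (fun x => (h x * pdf x)%:E) \_ (I n.+1)) (fun x => (h x * pdf x)%:E)
    (fun x => `|(h x * pdf x)%:E|%E).
  - move=> n; apply/(measurable_restrictT _ _).1 => //; first exact: measurable_itv.
    by apply: measurable_funTS; exact: (measurable_int _ ih).
  - exact: (measurable_int _ ih).
  - apply: aeW => x _; apply: cvg_near_cst.
    near=> n; rewrite patchE mem_set// /I/= in_itv/= -ler_norml.
    rewrite (@le_trans _ _ n%:R)// ?ler_nat//; near: n.
    exact: nbhs_infty_ger.
  - exact: integrable_abse.
  - apply: aeW => x n _; rewrite patchE; case: ifPn => //.
    by rewrite abse0.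
  by [].
have E0 : (\int[mu]_x (h x * pdf x)%:E = 0)%E.
  by apply: cvg_unique limI lim0.
by rewrite /Ex /Rintegral (integral_gauss (allmom_intg ah)) E0.
Unshelve. all: by end_near. Qed.

(** The Gaussian density is at most 1, because 2 pi >= 1; hence a bound uniform in the centre of the
    interval. *)
Lemma gauss_itv_le (z e : R) : 0 <= e ->
  (gauss [set x | (`|x + z| <= e)%R] <= (2 * e)%:E)%E.
Proof.
move=> e0.
have -> : [set x | (`|x + z| <= e)%R] = `[- z - e, - z + e]%classic.
  apply/seteqP; split => x /=; rewrite in_itv/= ler_norml.
    by move=> /andP[]; lra.
  by move=> /andP[]; lra.
have -> : gauss `[- z - e, - z + e]%classic = normal_prob 0 1 `[- z - e, - z + e]%classic by [].
rewrite /normal_prob.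
apply: (@le_trans _ _ (\int[mu]_(x in `[(- z - e)%R, (- z + e)%R]) 1%:E)%E).
  apply: ge0_le_integral => //.
  - by move=> x _; rewrite lee_fin normal_pdf_ge0.
  - by apply/measurable_EFinP; apply: measurable_funTS; exact: measurable_normal_pdf.
  - move=> x _; rewrite lee_fin (le_trans (normal_pdf_ub _ _ _))//.
    rewrite /normal_peak invf_le1 ?sqrtr_gt0; last first.
      by rewrite expr1n mul1r pmulrn_rgt0// pi_gt0.
    rewrite -[leLHS]sqrtr1 ler_wsqrtr// expr1n mul1r mulr2n.
    by have := pi_ge2 R; lra.
rewrite integral_cst//= mul1e lebesgue_measure_itv/= lte_fin.
by case: ifPn => _; rewrite -?EFinB lee_fin ?mulr_ge0//; lra.
Qed.

End gaussian_measure.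

(** * Functions of the sequence of coordinates *)

Section configurations.
Context {R : realType}.

(** Finite-dimensional boxes generate the product sigma-algebra and are stable under intersection,
    so two laws of sequences agree as soon as they agree on boxes. *)
Definition cyl_sets : set (set (nat -> R)) :=
  [set A | exists (N : nat) (B : nat -> set R), (forall i, measurable (B i)) /\
    A = [set c | forall i, (i < N)%N -> B i (c i)]].

Definition config := g_sigma_algebraType cyl_sets.

Definition upd (x : R) (i : nat) (c : nat -> R) : nat -> R :=
  fun j => if j == i then x else c j.

Lemma upd_same x i c : upd x i c i = x.
Proof. by rewrite /upd eqxx. Qed.

Lemma measurable_coord (i : nat) : measurable_fun setT (fun c : config => c i).
Proof.
move=> _ B mB; rewrite setTI; apply: sub_sigma_algebra.
exists i.+1, (fun j => if j == i then B else setT); split.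
  by move=> j; case: ifP.
apply/seteqP; split => c /= h.
  by move=> j _; case: eqP => [->|].
by have := h i (ltnSn i); rewrite eqxx.
Qed.

Lemma measurable_fun_config d (T : measurableType d) (f : T -> config) :
  (forall i, measurable_fun setT (fun w => f w i)) -> measurable_fun setT f.
Proof.
move=> mf; apply: (@measurability _ _ T config setT f cyl_sets erefl) => _ [A [N [B [mB ->]]] <-].
rewrite setTI (_ : _ @^-1` _ =
  \bigcap_(i in [set i | (i < N)%N]) ((fun w => f w i) @^-1` B i)) //.
apply: bigcap_measurableType => i _.
by rewrite -[X in measurable X]setTI; exact: mf.
Qed.

Lemma cyl_sets_setT : cyl_sets setT.
Proof.
exists 0%N, (fun=> setT); split => //.
by apply/seteqP; split.
Qed.

(** Trivial constraints on further coordinates bring two boxes to a common length, and put a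
    prescribed coordinate among the listed ones. *)
Lemma cyl_sets_widen (A : set (nat -> R)) M : cyl_sets A -> exists N B,
  [/\ (M <= N)%N, forall i, measurable (B i : set R) &
  A = [set c | forall i, (i < N)%N -> B i (c i)]].
Proof.
move=> [N [B [mB ->]]]; exists (maxn M N), (fun i => if (i < N)%N then B i else setT).
split; first exact: leq_maxl.
  by move=> i; case: ifP.
apply/seteqP; split => c /= h i iN.
  by case: ifPn => // /h.
by have := h i; rewrite iN; apply; rewrite leq_max iN orbT.
Qed.

Lemma cyl_sets_setI : setI_closed cyl_sets.
Proof.
move=> A A' /(cyl_sets_widen 0) [N [B [_ mB ->]]] /(cyl_sets_widen N) [N' [B' [NN' mB' ->]]].
exists N', (fun i => if (i < N)%N then B i `&` B' i else B' i); split.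
  by move=> i; case: ifP => // _; exact: measurableI.
apply/seteqP; split => c /=.
  by move=> [h h'] i iN'; case: ifPn => [/h|_]; [split => //|]; exact: h'.
move=> h; split => i iN.
  by have := h i (leq_trans iN NN'); rewrite iN => -[].
by have := h i iN; case: ifP => // _ [].
Qed.

Definition growth N (c : nat -> R) : R := 1 + \sum_(i < N) `|c i|.

Lemma growth_ge1 N c : 1 <= growth N c.
Proof. by rewrite /growth lerDl sumr_ge0. Qed.

Lemma growth_ge0 N c : 0 <= growth N c.
Proof. exact: le_trans (growth_ge1 N c). Qed.

Lemma le_growth N M c : (N <= M)%N -> growth N c <= growth M c.
Proof.
move=> NM; rewrite /growth lerD2l -!(big_mkord xpredT (fun i => `|c i|)).
by rewrite [leRHS](@big_cat_nat _ _ _ N)//= lerDl sumr_ge0.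
Qed.

(** A product on the right, so that powers split into a constant and a power of 1 + |x|, the growth
    required in a single variable. *)
Lemma growth_upd N x i c : growth N (upd x i c) <= growth N c * (1 + `|x|).
Proof.
rewrite /growth.
apply: (@le_trans _ _ (1 + \sum_(j < N) `|c j| + `|x|)); last first.
  rewrite mulrDr mulr1 lerD2l ler_peMl// lerDl sumr_ge0//.
rewrite -addrA lerD2l.
have [iN|Ni] := ltnP i N; last first.
  rewrite ler_wpDr//; apply: ler_sum => j _; rewrite /upd.
  by rewrite ltn_eqF// (leq_trans (ltn_ord j)).
rewrite (bigD1 (Ordinal iN))//= upd_same addrC lerD2r.
rewrite [leRHS](bigD1 (Ordinal iN))//= ler_wpDl//.
by apply: ler_sum => j /negP ji; rewrite /upd; case: eqP => // /eqP /ji.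
Qed.

Definition pgrow (g : (nat -> R) -> R) := exists C m N,
  0 <= C /\ forall c, `|g c| <= C * growth N c ^+ m.

Lemma pgrow_cst r : pgrow (fun=> r).
Proof. by exists `|r|, 0%N, 0%N; split => // c; rewrite expr0 mulr1. Qed.

Lemma pgrow_coord i : pgrow (fun c => c i).
Proof.
exists 1, 1%N, i.+1; split => // c; rewrite mul1r expr1 /growth.
by rewrite big_ord_recr/= addrA lerDr addr_ge0// sumr_ge0.
Qed.

Lemma le_growthX N M m n c : (N <= M)%N -> (m <= n)%N ->
  growth N c ^+ m <= growth M c ^+ n.
Proof.
move=> NM mn; apply: (@le_trans _ _ (growth N c ^+ n)).
  by rewrite ler_weXn2l// growth_ge1.
by rewrite lerXn2r ?nnegrE ?growth_ge0// le_growth.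
Qed.

Lemma pgrowM f g : pgrow f -> pgrow g -> pgrow (fun c => f c * g c).
Proof.
move=> [C [m [N [C0 h]]]] [C' [m' [N' [C0' h']]]].
exists (C * C'), (m + m')%N, (maxn N N'); split=> [|c]; first exact: mulr_ge0.
rewrite normrM exprD mulrACA ler_pM//.
  by rewrite (le_trans (h c))// ler_wpM2l// le_growthX// leq_maxl.
by rewrite (le_trans (h' c))// ler_wpM2l// le_growthX// leq_maxr.
Qed.

Lemma pgrowD f g : pgrow f -> pgrow g -> pgrow (fun c => f c + g c).
Proof.
move=> [C [m [N [C0 h]]]] [C' [m' [N' [C0' h']]]].
exists (C + C'), (maxn m m'), (maxn N N'); split=> [|c]; first exact: addr_ge0.
rewrite (le_trans (ler_normD _ _))// mulrDl lerD//.
  by rewrite (le_trans (h c))// ler_wpM2l// le_growthX// leq_maxl.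
by rewrite (le_trans (h' c))// ler_wpM2l// le_growthX// leq_maxr.
Qed.

Lemma pgrow_sect g : pgrow g -> forall i c, exists C m, forall x,
  `|g (upd x i c)| <= C * (1 + `|x|) ^+ m.
Proof.
move=> [C [m [N [C0 h]]]] i c; exists (C * growth N c ^+ m), m => x.
rewrite (le_trans (h _))// -mulrA ler_wpM2l// -exprMn.
by rewrite lerXn2r ?nnegrE ?mulr_ge0 ?growth_ge0 ?addr_ge0// growth_upd.
Qed.

(** The integrands of the whole development: an algebra whose members have all moments by polynomial
    growth, and whose one-variable sections are continuous, as the fundamental theorem of calculus
    requires of a derivative. *)
Definition tame (g : (nat -> R) -> R) :=
  [/\ measurable_fun setT (g : config -> R), pgrow g &
   forall i c, continuous (fun x => g (upd x i c))].

Lemma tame_cst r : tame (fun=> r).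
Proof. by split; [exact: measurable_cst|exact: pgrow_cst|move=> i c x; exact: cvg_cst]. Qed.

Lemma tame_coord i : tame (fun c => c i).
Proof.
split; [exact: measurable_coord|exact: pgrow_coord|move=> j c x].
by rewrite /upd; case: eqP => _; [exact: cvg_id|exact: cvg_cst].
Qed.

Lemma tameM f g : tame f -> tame g -> tame (fun c => f c * g c).
Proof.
move=> [mf pf cf] [mg pg cg]; split; [exact: measurable_funM|exact: pgrowM|].
by move=> i c x; apply: cvgM; [exact: cf|exact: cg].
Qed.

Lemma tameD f g : tame f -> tame g -> tame (fun c => f c + g c).
Proof.
move=> [mf pf cf] [mg pg cg]; split; [exact: measurable_funD|exact: pgrowD|].
by move=> i c x; apply: cvgD; [exact: cf|exact: cg].
Qed.

Lemma tameZ r f : tame f -> tame (fun c => r * f c).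
Proof. by apply: tameM; exact: tame_cst. Qed.

Lemma tameB f g : tame f -> tame g -> tame (fun c => f c - g c).
Proof.
by move=> tf /(tameZ (-1)); under eq_fun do rewrite mulN1r; exact: tameD.
Qed.

Lemma tameX n f : tame f -> tame (fun c => f c ^+ n).
Proof.
move=> tf; elim: n => [|n ih]; first exact: tame_cst.
by under eq_fun do rewrite exprS; exact: tameM.
Qed.

Lemma tame_sum (I : Type) (s : seq I) (Q : pred I) (F : I -> (nat -> R) -> R) :
  (forall i, tame (F i)) -> tame (fun c => \sum_(i <- s | Q i) F i c).
Proof.
move=> h; elim: s => [|a s ih].
  by under eq_fun do rewrite big_nil; exact: tame_cst.
under eq_fun do rewrite big_cons.
by case: (Q a) => //; exact: tameD.
Qed.

(** A relation rather than an operator: derivatives of sums and products are then supplied as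
    explicit formulas, without separate differentiability conditions. *)
Definition der i (g g' : (nat -> R) -> R) := forall (c : nat -> R) (x : R),
  is_derive x 1 (fun y => g (upd y i c)) (g' (upd x i c)).

Lemma der_cst i r : der i (fun=> r) (fun=> 0).
Proof. by move=> c x; exact: is_derive_cst. Qed.

Lemma der_coord i j : der i (fun c => c j) (fun=> (j == i)%:R).
Proof.
by move=> c x; rewrite /upd; case: eqP => _;
  [exact: is_derive_id|exact: is_derive_cst].
Qed.

Lemma derD i f f' g g' : der i f f' -> der i g g' ->
  der i (fun c => f c + g c) (fun c => f' c + g' c).
Proof. by move=> hf hg c x; exact: is_deriveD. Qed.

Lemma derM i f f' g g' : der i f f' -> der i g g' ->
  der i (fun c => f c * g c) (fun c => f' c * g c + f c * g' c).
Proof.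
move=> hf hg c x; apply: (is_derive_eq (is_deriveM (hf c x) (hg c x))).
by rewrite addrC; congr (_ + _); rewrite mulrC.
Qed.

Lemma derZ i r f f' : der i f f' -> der i (fun c => r * f c) (fun c => r * f' c).
Proof. by move=> hf c x; exact: (is_deriveZ r (hf c x)). Qed.

Lemma derB i f f' g g' : der i f f' -> der i g g' ->
  der i (fun c => f c - g c) (fun c => f' c - g' c).
Proof. by move=> hf hg c x; exact: is_deriveB. Qed.

Lemma eq_der i f f' g g' : f =1 g -> f' =1 g' -> der i f f' -> der i g g'.
Proof. by move=> /funext <- /funext <-. Qed.

Lemma der_sum (I : Type) (s : seq I) (Q : pred I) i (F F' : I -> (nat -> R) -> R) :
  (forall j, der i (F j) (F' j)) ->
  der i (fun c => \sum_(j <- s | Q j) F j c) (fun c => \sum_(j <- s | Q j) F' j c).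
Proof.
move=> h; elim: s => [|a s ih].
  by apply: (eq_der _ _ (der_cst i 0)) => c; rewrite big_nil.
case Qa: (Q a).
  by apply: (eq_der _ _ (derD (h a) ih)) => c; rewrite big_cons Qa.
by apply: (eq_der _ _ ih) => c; rewrite big_cons Qa.
Qed.

Definition cylf n (f : 'rV[R]_n -> R) : (nat -> R) -> R :=
  fun c => f (\row_(j < n) c j).

(** The zero direction for n <= i covers the coordinates on which a cylinder function does not
    depend. *)
Definition dir n i : 'rV[R]_n :=
  if insub i is Some j then delta_mx 0 (j : 'I_n) else 0.

Lemma row_upd n i (c : nat -> R) x h :
  \row_(j < n) upd (h + x) i c j = h *: dir n i + \row_(j < n) upd x i c j.
Proof.
apply/rowP => j; rewrite !mxE /dir /upd.
case: insubP => [k _ ki|ni]; rewrite !mxE ?eqxx/=.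
  by rewrite -ki (inj_eq val_inj); case: eqP => _; rewrite ?mulr1 ?mulr0 ?add0r.
rewrite mulr0 add0r; case: eqP => // ji.
by move: ni; rewrite -ji ltn_ord.
Qed.

Lemma der_cyl n i (f : 'rV[R]_n -> R) : (forall x, differentiable f x) ->
  der i (cylf f) (cylf (nat_partial i f)).
Proof.
move=> df c x; set a := \row_(j < n) upd x i c j.
have E : (fun h : R => h^-1 *: (((fun y => cylf f (upd y i c)) \o shift x) (h *: 1) -
    cylf f (upd x i c))) = (fun h => h^-1 *: ((f \o shift a) (h *: dir n i) - f a)).
  apply/funext => h; rewrite /cylf /= /shift/= -row_upd.
  by rewrite (_ : h *: 1 = h)// /GRing.scale/= mulr1.
have dd : derivable f a (dir n i) by exact: diff_derivable.
apply: DeriveDef; first by rewrite /derivable E.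
rewrite /derive E /cylf /nat_partial -/(derive f a (dir n i)) -/a /dir.
case: insubP => [j _ _|_] //.
exact: derive0.
Qed.

(** [config] carries the product sigma-algebra, so continuity of [f] does not suffice by itself. The
    preimage of an open set is written as a countable union of boxes with rational centres. *)
Lemma measurable_cylf n (f : 'rV[R]_n -> R) : (forall x, differentiable f x) ->
  measurable_fun setT (cylf f : config -> R).
Proof.
move=> df.
have cf : continuous f by move=> x; exact: differentiable_continuous.
have key (V : set 'rV[R]_n) : open V ->
    measurable [set c : config | V (\row_(j < n) c j)].
  move=> oV; pose Q (z : 'rV[rat]_n * nat) :=
    map_mx ratr z.1 : 'rV[R]_n.
  pose ok z := ball (Q z) (z.2.+1%:R^-1 : R) `<=` V.
  rewrite (_ : [set c | _] = \bigcup_z [set c : config |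
      ok z /\ forall j : 'I_n, `|Q z 0 j - c j| < z.2.+1%:R^-1]); last first.
    apply/seteqP; split => [c Vc|c [z _ [okz h]]]; last first.
      apply: okz; split; first by rewrite invr_gt0.
      move=> i j; rewrite ord1.
      have hj : ball (Q z 0 j) z.2.+1%:R^-1 (c j) by exact: h.
      by rewrite [X in ball _ _ X]mxE.
    have [e /= e0 eV] := (nbhs_ballP _ _).1 (open_nbhs_nbhs (conj oV Vc)).
    (* A radius below e/2 lets a rational ball contain the point and still, by the triangle
       inequality, lie in the e-ball around it. *)
    have [k k2] : exists k, 0 + k.+1%:R^-1 < e / 2.
      by apply: ltr_add_invr; rewrite divr_gt0.
    rewrite add0r in k2.
    have /choice[q hq] (j : 'I_n) : exists q : rat, `|ratr q - c j| < k.+1%:R^-1 :> R.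
      have lt : c j - k.+1%:R^-1 < c j + k.+1%:R^-1 :> R.
        by rewrite ltrD2l gtrN// invr_gt0.
      have [q] := rat_in_itvoo lt.
      rewrite in_itv/= => /andP[h1 h2]; exists q.
      by rewrite ltr_distl h1 h2.
    have Qc : ball (Q (\row_j q j, k)) (k.+1%:R^-1) (\row_(j < n) c j).
      split; first by rewrite invr_gt0.
      by move=> i j; rewrite ord1 /Q/= !mxE; exact: hq.
    exists (\row_j q j, k) => //; split; last first.
      by move=> j; rewrite /Q/= !mxE.
    move=> y hy; apply: eV; rewrite (splitr e).
    apply: (@ball_triangle _ _ (Q (\row_j q j, k))).
      by apply: (le_ball (ltW k2)); exact: ball_sym.
    exact: (le_ball (ltW k2)).
  apply: countable_bigcupT_measurable; first exact: countableP.
  move=> z.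
  have [okz|nok] := pselect (ok z); last first.
    by rewrite (_ : [set c | _] = set0)// -subset0 => c [].
  rewrite (_ : [set c | _] = \bigcap_(j : 'I_n)
    ((fun c : config => c j) @^-1` [set x | `|Q z 0 j - x| < z.2.+1%:R^-1])); last first.
    by apply/seteqP; split => [c [_ h] j _|c h]; [exact: h|split => // j; exact: h].
  rewrite -[X in measurable X]setCK setC_bigcap; apply: measurableC.
  apply: countable_bigcupT_measurable => [|j]; first exact: countableP.
  apply: measurableC.
  rewrite -[X in measurable X]setTI; apply: measurable_coord => //.
  rewrite (_ : [set x | _] = ball (Q z 0 j) z.2.+1%:R^-1)//.
  exact: measurable_ball.
move=> mD; apply: (measurability _ (RGenOInfty.measurableE R)) => //.
move=> _ [_ [x ->] <-]; rewrite setTI.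
apply: (key (f @^-1` `]x, +oo[)).
by apply: open_comp => // z _; exact: cf.
Qed.

Lemma continuous_cylf n (f : 'rV[R]_n -> R) : (forall x, differentiable f x) ->
  forall i c, continuous (fun x => cylf f (upd x i c)).
Proof.
move=> df i c x; have d := der_cyl i df c x.
apply: differentiable_continuous; apply/derivable1_diffP; exact: ex_derive.
Qed.

Lemma pgrow_cylf n (f : 'rV[R]_n -> R) : (exists (C : R) (m : nat),
      forall x, `|f x| <= C * (1 + `|x|) ^+ m) -> pgrow (cylf f).
Proof.
move=> [C [m h]]; exists `|C|, m, n; split => // c.
rewrite (le_trans (h _))//.
apply: (@le_trans _ _ (`|C| * (1 + `|\row_(j < n) c j|) ^+ m)).
  by rewrite ler_wpM2r ?ler_norm// exprn_ge0// addr_ge0.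
rewrite ler_wpM2l// lerXn2r ?nnegrE ?growth_ge0 ?addr_ge0// /growth lerD2l.
have -> : `|\row_(j < n) c j| = mx_norm (\row_(j < n) c j) by [].
rewrite mx_normrE; apply: bigmax_le; first by rewrite sumr_ge0.
move=> [i j] _ /=; rewrite mxE (bigD1 j)//= lerDl sumr_ge0//.
Qed.

Lemma tame_cylf n (f : 'rV[R]_n -> R) : (forall x, differentiable f x) ->
  (exists (C : R) (m : nat), forall x, `|f x| <= C * (1 + `|x|) ^+ m) ->
  tame (cylf f).
Proof.
move=> df h; split; [exact: measurable_cylf|exact: pgrow_cylf|exact: continuous_cylf].
Qed.

End configurations.

(** * Gaussian integration by parts *)

Section gaussian_sequence.
Context {d : measure_display} {Omega : measurableType d} {R : realType}.
Variables (P : probability Omega R) (X : nat -> {RV P >-> R}).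
Hypothesis gX : iid_standard_gaussian X.

Definition seqX (w : Omega) : @config R := fun i => X i w.

Lemma measurable_seqX : measurable_fun setT seqX.
Proof. by apply: measurable_fun_config => i; exact: measurable_funPT. Qed.

Lemma prob_X i (B : set R) : measurable B -> P (X i @^-1` B) = gauss B.
Proof. by move=> mB; exact: (gX.2 i B mB). Qed.

Lemma integral_X i (f : R -> \bar R) : measurable_fun setT f ->
  (forall x, (0 <= f x)%E) -> (\int[P]_w f (X i w) = \int[gauss]_x f x)%E.
Proof.
move=> mf f0.
rewrite -[LHS](@ge0_integral_pushforward _ _ _ _ _ (X i) _ P setT f)//.
apply: eq_measure_integral => A mA _; rewrite /pushforward/=.
exact: prob_X.
Qed.

Lemma allmom_comp_X i (f : R -> R) : allmom gauss f -> allmom P (fun w => f (X i w)).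
Proof.
move=> [mf hf]; split=> [|k]; first exact: measurableT_comp.
have mk : measurable_fun setT (fun x => `|f x| ^+ k).
  by apply: measurable_funX; exact: measurableT_comp.
apply/integrableP; split.
  by apply/measurable_EFinP; exact: (measurableT_comp mk).
have /integrableP[_] := hf k; rewrite -(@integral_X i) //.
by apply: measurableT_comp => //; exact/measurable_EFinP.
Qed.

Lemma allmom_X i : allmom P (X i).
Proof.
apply: (@allmom_comp_X i id); apply: (@allmom_gauss_growth _ _ 1 1) => // x.
by rewrite mul1r expr1 lerDr.
Qed.

Lemma allmom_exp_X i t : allmom P (fun w => expR (t * `|X i w|)).
Proof. exact: (allmom_comp_X i (allmom_gauss_exp t)). Qed.

Lemma measurable_seqXT (g : (nat -> R) -> R) : measurable_fun setT (g : config -> R) ->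
  measurable_fun setT (fun w => g (seqX w)).
Proof. by move=> mg; exact: (measurableT_comp mg measurable_seqX). Qed.

Lemma allmom_seqX g : measurable_fun setT (g : config -> R) -> pgrow g ->
  allmom P (fun w => g (seqX w)).
Proof.
move=> mg [C [m [N [C0 h]]]].
have a : allmom P (fun w => C * growth N (seqX w) ^+ m).
  apply: allmomZ; apply: allmomX; apply: allmomD; first exact: allmom_cst.
  apply: allmom_sum => i; apply: (allmom_le _ (allmom_X i)) => [|w].
    by apply: measurableT_comp => //; exact: measurable_funPT.
  by rewrite normr_id.
apply: (allmom_le _ a) => [|w]; first exact: measurable_seqXT.
by rewrite [leRHS]ger0_norm ?mulr_ge0// exprn_ge0// growth_ge0.
Qed.

Lemma allmom_tame g : tame g -> allmom P (fun w => g (seqX w)).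
Proof. by move=> [mg pg _]; exact: allmom_seqX. Qed.

Definition resample i (z : R * Omega) : @config R := upd z.1 i (seqX z.2).

Lemma measurable_resample i : measurable_fun setT (resample i).
Proof.
apply: measurable_fun_config => j; rewrite /resample /upd; case: eqP => _.
  exact: measurable_fst.
have mX : measurable_fun setT (fun w => seqX w j) by exact: measurable_funPT.
exact: (measurableT_comp mX measurable_snd).
Qed.

Lemma prob_X_fset (I : {fset nat}) (B : nat -> set R) :
  (forall i, measurable (B i)) ->
  P [set w | forall i, i \in I -> B i (X i w)] = (\prod_(i <- I) gauss (B i))%E.
Proof.
move=> mB; rewrite (_ : [set w | _] = \bigcap_(i in [set` I]) X i @^-1` B i)//.
by rewrite gX.1//; apply: eq_bigr => i _; exact: prob_X.
Qed.

(* Resampling one coordinate independently preserves the law of the sequence: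
   this is Fubini's theorem for the infinite product in disguise. *)
Lemma law_resample i (A : set config) : measurable A ->
  P (seqX @^-1` A) = (gauss \x P)%E (resample i @^-1` A).
Proof.
move=> mA.
apply: (@measure_unique _ _ (@config R) (@cyl_sets R) (fun=> setT) erefl
  (@cyl_sets_setI R) (fun=> @cyl_sets_setT R) _ (pushforward P seqX)
  (pushforward (gauss \x P)%E (resample i))) => //.
- by apply/seteqP; split => // x _; exists 0%N.
- exact: measurable_seqX.
- exact: measurable_resample.
(* Widening the box beyond [i] lets the factor of index [i] be split off the product of
   probabilities. *)
- move=> h0 h1 {mA}A cA; have [N [B [iN mB ->]]] := cyl_sets_widen i.+1 cA.
  rewrite /pushforward.
  pose I : {fset nat} := [fset j in iota 0 N]%fset.
  have inI j : (j \in I) = (j < N)%N by rewrite !inE mem_iota.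
  transitivity (P [set w | forall j, j \in I -> B j (X j w)]).
    by congr (P _); apply/seteqP; split => w /= h j; [rewrite inI|rewrite -inI]; exact: h.
  rewrite prob_X_fset// (big_fsetD1 i) ?inI//=.
  rewrite -prob_X_fset// -(product_measure1E gauss P (mB i))//; last first.
    rewrite (_ : [set w | _] = \bigcap_(j in [set` (I `\ i)%fset]) X j @^-1` B j)//.
    apply: bigcap_measurableType => j _.
    by rewrite -[X in measurable X]setTI; exact: measurable_funPT.
  congr ((gauss \x P)%E _); apply/seteqP; split => -[x w] /=.
    move=> [Bx h] j jN; rewrite /resample /upd/=; case: eqP => [->//|/eqP ji].
    by apply: h; rewrite !inE ji mem_iota.
  rewrite /resample /upd/= => h; split.
    by have := h i iN; rewrite eqxx.
  move=> j; rewrite !inE mem_iota/= add0n => /andP[ji jN].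
  by have := h j jN; rewrite (negbTE ji).
- by move=> h0 k; rewrite [X in (X < _)%E](probability_setT P) ltry.
Qed.

Lemma ge0_integral_resample i (g : config -> \bar R) : measurable_fun setT g ->
  (forall c, (0 <= g c)%E) ->
  (\int[P]_w g (seqX w) = \int[P]_w \int[gauss]_x g (upd x i (seqX w)))%E.
Proof.
move=> mg g0.
rewrite -[LHS](@ge0_integral_pushforward _ _ _ _ _ seqX measurable_seqX P setT g)//.
rewrite (eq_measure_integral (pushforward (gauss \x P)%E (resample i))); first last.
- by move=> h1 h2 A mA _; exact: law_resample.
- exact: measurable_seqX.
2: exact: measurable_resample.
move=> mr; rewrite ge0_integral_pushforward//.
rewrite preimage_setT fubini_tonelli2//.
  exact: (measurableT_comp mg (measurable_resample i)).
by move=> z; exact: g0.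
Qed.

Lemma Ex_resample i (g : (nat -> R) -> R) : measurable_fun setT (g : config -> R) ->
  intg P (fun w => g (seqX w)) ->
  (forall c, Ex gauss (fun x => g (upd x i c)) = 0) ->
  (forall c, intg gauss (fun x => g (upd x i c))) ->
  Ex P (fun w => g (seqX w)) = 0.
Proof.
move=> mg ig g0 igi; rewrite /Ex /Rintegral.
have mE : measurable_fun setT (EFin \o g : config -> \bar R) by exact/measurable_EFinP.
rewrite -[X in fine X](@integral_pushforward _ _ _ _ _ seqX measurable_seqX P setT
  (EFin \o g : config -> \bar R))//.
rewrite (eq_measure_integral (pushforward (gauss \x P)%E (resample i))); first last.
- by move=> h1 h2 A mA _; exact: law_resample.
- exact: measurable_seqX.
2: exact: measurable_resample.
move=> mr; have mgr : measurable_fun setT ((EFin \o g) \o resample i).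
  exact: (measurableT_comp mE (measurable_resample i)).
have ir : (gauss \x P)%E.-integrable setT ((EFin \o g) \o resample i).
  apply/integrable21ltyP => //.
  rewrite -[X in (X < _)%E](ge0_integral_resample i (g := fun c => `|(g c)%:E|%E))//.
    by have /integrableP[] := ig.
  exact: measurableT_comp.
rewrite integral_pushforward//.
rewrite preimage_setT -integral21_prod_meas1// /fubini_G.
rewrite (eq_integral (fun=> 0%E)) ?integral0// => w _.
by rewrite /= (ExE (igi (seqX w))) g0.
Qed.

(** After resampling of coordinate [i], it suffices that g' - c_i g have zero Gaussian integral
    along each line in direction [i], which is the one-dimensional identity. *)
Lemma gaussian_ibp i (g g' : (nat -> R) -> R) : tame g -> tame g' -> der i g g' ->
  Ex P (fun w => g' (seqX w)) = Ex P (fun w => X i w * g (seqX w)).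
Proof.
move=> tg tg' dg.
have tc := tameM (tame_coord i) tg.
have th := tameB tg' tc.
have igh := allmom_intg (allmom_tame th).
apply/eqP; rewrite -subr_eq0 -ExB; [|exact: (allmom_intg (allmom_tame tg'))|exact: (allmom_intg (allmom_tame tc))].
apply/eqP; apply: (@Ex_resample i (fun c => g' c - c i * g c)) => //.
  by case: th.
  move=> c.
  have [_ pg cg] := tg; have [_ pg' cg'] := tg'.
  have [C [m h]] := pgrow_sect pg i c.
  have [C' [m' h']] := pgrow_sect pg' i c.
  have e := gauss_ibp (dg c) (cg' i c) h h'.
  rewrite (_ : Ex _ _ = Ex gauss (fun x => g' (upd x i c) - x * g (upd x i c))); last first.
    by apply: eq_Ex => x; rewrite upd_same.
  rewrite ExB; first by rewrite e subrr.
    apply: allmom_intg; apply: allmom_gauss_growth h'.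
    by apply: continuous_measurable_fun; exact: cg'.
  apply: allmom_intg; apply: allmomM.
    apply: (@allmom_gauss_growth _ _ 1 1) => // x.
    by rewrite mul1r expr1 lerDr.
  apply: allmom_gauss_growth h.
  by apply: continuous_measurable_fun; exact: cg.
move=> c; have [_ pgh cgh] := th.
have [C [m h]] := pgrow_sect pgh i c.
apply: allmom_intg; apply: allmom_gauss_growth h.
by apply: continuous_measurable_fun; exact: cgh.
Qed.

End gaussian_sequence.

(** * Totality of the monomials *)

Section monomials.
Context {R : realType}.

(** Indices are listed with repetition, so that multiplication by a coordinate is a [cons] and
    inductions run over lists. *)
Definition mono (s : seq nat) (c : nat -> R) : R := \prod_(i <- s) c i.

Lemma mono_cons i s c : mono (i :: s) c = c i * mono s c.
Proof. by rewrite /mono big_cons. Qed.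

Lemma mono_nseq_cat k i s c : mono (nseq k i ++ s) c = c i ^+ k * mono s c.
Proof.
elim: k => [|k ih] /=; first by rewrite mul1r.
by rewrite mono_cons ih exprS mulrA.
Qed.

Lemma tame_mono s : tame (mono s).
Proof.
elim: s => [|i s ih].
  rewrite (_ : mono [::] = fun=> 1); first exact: tame_cst.
  by apply/funext => c; rewrite /mono big_nil.
rewrite (_ : mono (i :: s) = fun c => c i * mono s c).
  by apply: tameM ih; exact: tame_coord.
by apply/funext => c; rewrite mono_cons.
Qed.

(** The Newton-Schulz iteration for the sign: an odd cubic with fixed points -1, 0 and 1 whose
    iterates converge to the sign on [-1, 1]. Being polynomial, it does not leave an algebra of
    functions. *)
Definition sgn_step (y : R) := (3 * y - y * y * y) / 2.

Lemma sgn_step_itv y : 0 < y -> y <= 1 -> y <= sgn_step y <= 1.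
Proof.
move=> y0 y1; rewrite /sgn_step.
(* Twice [sgn_step y - y] is this product, and twice [1 - sgn_step y] is the next one. *)
have h : 0 <= y * (1 - y) * (1 + y) by rewrite !mulr_ge0// ?subr_ge0// ?addr_ge0// ltW.
have h' : 0 <= (1 - y) ^+ 2 * (2 + y) by rewrite mulr_ge0 ?sqr_ge0// addr_ge0// ltW.
by apply/andP; split; lra.
Qed.

Lemma sgn_stepN y : sgn_step (- y) = - sgn_step y.
Proof. by rewrite /sgn_step; field. Qed.

Lemma sgn_step_fix (l : R) : 0 < l -> l = sgn_step l -> l = 1.
Proof.
move=> l0 e; have : l * ((1 - l) * (1 + l)) = 0.
  by move: e; rewrite /sgn_step => e; lra.
by move/eqP; rewrite !mulf_eq0 => /or3P[/eqP e0|/eqP|/eqP]; lra.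
Qed.

Lemma iter_sgn_step_pos y : 0 < y -> y <= 1 ->
  (forall n, y <= iter n sgn_step y <= 1) /\
  (fun n => iter n sgn_step y) @ \oo --> (1 : R).
Proof.
move=> y0 y1; pose u n := iter n sgn_step y.
have hu n : y <= u n <= 1.
  elim: n => [|n /andP[a b]]; first by rewrite lexx.
  have /andP[c e] := sgn_step_itv (lt_le_trans y0 a) b.
  by rewrite /u/= e (le_trans a c).
split => //.
have nd : nondecreasing_seq u.
  apply/nondecreasing_seqP => n; have /andP[a b] := hu n.
  by have /andP[] := sgn_step_itv (lt_le_trans y0 a) b.
have cu : cvgn u.
  by apply: nondecreasing_is_cvgn => //; exists 1 => _ [n _ <-]; have /andP[] := hu n.
set l := limn u in cu *.
have yl : y <= l by apply: limr_ge => //; apply: nearW => n; have /andP[] := hu n.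
have uS : (fun n => u n.+1) @ \oo --> l by rewrite (cvg_shiftS u).
have uS' : (fun n => u n.+1) @ \oo --> sgn_step l.
  rewrite /sgn_step; apply: cvgM; last exact: cvg_cst.
  apply: cvgB; first by apply: cvgM => //; exact: cvg_cst.
  by apply: cvgM => //; exact: cvgM.
have e : l = sgn_step l by exact: cvg_unique uS uS'.
by rewrite -(sgn_step_fix (lt_le_trans y0 yl) e).
Qed.

Lemma iter_sgn_step y : `|y| <= 1 ->
  (forall n, `|iter n sgn_step y| <= 1) /\
  (fun n => iter n sgn_step y) @ \oo --> Num.sg y.
Proof.
have pos z : 0 < z -> z <= 1 -> (forall n, `|iter n sgn_step z| <= 1) /\
    (fun n => iter n sgn_step z) @ \oo --> Num.sg z.
  move=> z0 z1; have [h c] := iter_sgn_step_pos z0 z1; split; last by rewrite gtr0_sg.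
  move=> n; have /andP[a b] := h n.
  by rewrite ger0_norm// (le_trans (ltW z0)).
have neg z n : iter n sgn_step (- z) = - iter n sgn_step z.
  by elim: n => //= n ->; rewrite sgn_stepN.
have [y0|y0|->] := ltgtP y 0.
- rewrite ler0_norm ?(ltW y0)// => y1; have [] := pos (- y) _ y1; first by rewrite oppr_gt0.
  move=> h c; split.
    by move=> n; rewrite -[y]opprK neg normrN.
  rewrite -[y]opprK sgrN; under eq_fun do rewrite neg.
  exact: cvgN.
- by rewrite ger0_norm ?(ltW y0)// => y1; exact: pos.
- move=> _; have it0 n : iter n sgn_step 0 = 0.
    by elim: n => //= n ->; rewrite /sgn_step !mulr0 subr0 mul0r.
  under eq_fun do rewrite it0; rewrite sgr0.
  by split; [move=> n; rewrite it0 normr0|exact: cvg_cst].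
Qed.

End monomials.

(** * Bounded multipliers of the orthogonal complement of the monomials *)

Section density.
Context {d : measure_display} {Omega : measurableType d} {R : realType}.
Variables (P : probability Omega R) (X : nat -> {RV P >-> R}).
Hypothesis gX : iid_standard_gaussian X.

Lemma Ex_dominated (f : nat -> Omega -> R) (h g : Omega -> R) :
  (forall n, measurable_fun setT (f n)) -> intg P g ->
  (forall n w, `|f n w| <= g w) -> (forall w, (fun n => f n w) @ \oo --> h w) ->
  (fun n => Ex P (f n)) @ \oo --> Ex P h.
Proof.
move=> mf ig fg fh.
have mh : measurable_fun setT h by apply: measurable_fun_cvg => // w _; exact: fh.
have hc w : (fun n => (f n w)%:E) @ \oo --> (h w)%:E.
  by apply: cvg_EFin; [near=> n|exact: fh].
have [ih _] := @dominated_convergence _ _ _ P setT measurableT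
  (fun n => EFin \o f n) (EFin \o h) (EFin \o g)
  (fun n => (measurable_EFinP _ _).2 (mf n)) ((measurable_EFinP _ _).2 mh)
  (aeW _ (fun w _ => hc w)) ig
  (aeW _ (fun w n _ => fg n w)).
rewrite /Ex /Rintegral => c; apply: fine_cvg.
by rewrite fineK//; exact: integrable_fin_num.
Unshelve. all: by end_near. Qed.

Definition orthp (W : Omega -> R) := sqint P W /\
  forall s, Ex P (fun w => W w * mono s (seqX X w)) = 0.

(** These multipliers form an algebra closed under bounded pointwise limits. Boundedness keeps the
    product with [W] square integrable, but it excludes nonconstant monomials, so the algebra is
    entered through sines and cosines. *)
Definition mulp (h : Omega -> R) := [/\ measurable_fun setT h,
  (exists C, forall w, `|h w| <= C) &
  forall W, orthp W -> orthp (fun w => h w * W w)].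

Lemma allmom_mono s : allmom P (fun w => mono s (seqX X w)).
Proof. exact: (allmom_tame gX (tame_mono s)). Qed.

Lemma intg_mulmono W s : sqint P W -> intg P (fun w => W w * mono s (seqX X w)).
Proof. by move=> hW; apply: sqint_mul => //; exact/allmom_sqint/allmom_mono. Qed.

Lemma sqint_bdd (h W : Omega -> R) C : measurable_fun setT h ->
  (forall w, `|h w| <= C) -> sqint P W -> sqint P (fun w => h w * W w).
Proof.
move=> mh hC hW; apply: (sqint_le _ (sqintZ C hW)) => [|w].
  by apply: measurable_funM => //; exact: hW.1.
by rewrite !normrM ler_wpM2r// (le_trans (hC w))// ler_norm.
Qed.

Lemma orthpZ r W : orthp W -> orthp (fun w => r * W w).
Proof.
move=> [hW W0]; split; first exact: sqintZ.
move=> s; under eq_Ex do rewrite -mulrA.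
by rewrite ExZ ?W0 ?mulr0//; exact: intg_mulmono.
Qed.

Lemma orthpD V W : orthp V -> orthp W -> orthp (fun w => V w + W w).
Proof.
move=> [hV V0] [hW W0]; split; first exact: sqintD.
move=> s; under eq_Ex do rewrite mulrDl.
by rewrite ExD ?W0 ?V0 ?addr0//; exact: intg_mulmono.
Qed.

Lemma mulp_cst r : mulp (fun=> r).
Proof. by split => //; [exists `|r| |move=> W; exact: orthpZ]. Qed.

Lemma mulpM g h : mulp g -> mulp h -> mulp (fun w => g w * h w).
Proof.
move=> [mg [C gC] hg] [mh [D hD] hh]; split; first exact: measurable_funM.
  by exists (C * D) => w; rewrite normrM ler_pM.
move=> W /hh /hg; congr orthp.
by apply/funext => w; rewrite mulrA.
Qed.

Lemma mulpD g h : mulp g -> mulp h -> mulp (fun w => g w + h w).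
Proof.
move=> [mg [C gC] hg] [mh [D hD] hh]; split; first exact: measurable_funD.
  by exists (C + D) => w; rewrite (le_trans (ler_normD _ _))// lerD.
move=> W oW; under eq_fun do rewrite mulrDl.
by apply: orthpD; [exact: hg|exact: hh].
Qed.

Lemma mulpZ r h : mulp h -> mulp (fun w => r * h w).
Proof. by apply: mulpM; exact: mulp_cst. Qed.

Lemma mulpB g h : mulp g -> mulp h -> mulp (fun w => g w - h w).
Proof.
by move=> hg /(mulpZ (-1)); under eq_fun do rewrite mulN1r; exact: mulpD.
Qed.

Lemma mulp_lim (h : nat -> Omega -> R) f C : (forall n, mulp (h n)) ->
  (forall n w, `|h n w| <= C) -> (forall w, (fun n => h n w) @ \oo --> f w) ->
  mulp f.
Proof.
move=> hh hC hf.
have mh n : measurable_fun setT (h n) by have [] := hh n.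
have mf : measurable_fun setT f by apply: measurable_fun_cvg => // w _; exact: hf.
have fC w : `|f w| <= C.
  have c : (fun n => `|h n w|) @ \oo --> `|f w| by exact: cvg_norm (hf w).
  rewrite -(cvg_lim _ c)//; apply: limr_le; last exact: nearW.
  by apply/cvg_ex; eexists; exact: c.
split => //; first by exists C.
move=> W oW; have hW := oW.1; split; first exact: sqint_bdd fC hW.
move=> s; have hm := allmom_sqint (allmom_mono s).
have c : (fun n => Ex P (fun w => h n w * W w * mono s (seqX X w))) @ \oo -->
    Ex P (fun w => f w * W w * mono s (seqX X w)).
  apply: (@Ex_dominated _ _ (fun w => C * `|W w * mono s (seqX X w)|)).
  - by move=> n; apply: measurable_funM; [apply: measurable_funM => //; exact: hW.1|exact: hm.1].
  - by apply: intgZ; apply: intg_norm; exact: intg_mulmono.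
  - by move=> n w; rewrite -mulrA normrM ler_wpM2r.
  - by move=> w; apply: cvgM; [apply: cvgM => //; exact: cvg_cst|exact: cvg_cst].
apply: cvg_unique c _ => //.
rewrite (_ : (fun n => _) = fun=> 0); first exact: cvg_cst.
by apply/funext => n; have [_ _ /(_ W oW)[_ ->]] := hh n.
Qed.

(** The partial sums are polynomials and need not be bounded, so [mulp_lim] does not apply. The
    bound on the coefficients dominates them by exp(|t| |X_i|), which has all moments, and the limit
    is taken under the expectation. *)
Lemma mulp_power_series (a : nat -> R) (phi : R -> R) i t :
  (forall k, `|a k| <= (k`!%:R)^-1) ->
  (forall x, series (fun k => a k * x ^+ k) @ \oo --> phi x) ->
  (forall x, `|phi x| <= 1) -> measurable_fun setT phi ->
  mulp (fun w => phi (t * X i w)).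
Proof.
move=> ak aphi phi1 mphi.
have mtX : measurable_fun setT (fun w => t * X i w).
  by apply: measurable_funM => //; exact: measurable_funPT.
have mp : measurable_fun setT (fun w => phi (t * X i w)) by exact: measurableT_comp.
split => //; first by exists 1 => w; exact: phi1.
move=> W oW; have hW := oW.1; split; first exact: sqint_bdd hW.
move=> s; have am := allmom_mono s.
pose T n w := series (fun k => a k * (t * X i w) ^+ k) n * (W w * mono s (seqX X w)).
have ET n : Ex P (T n) = 0.
  rewrite /T /series/=; under eq_Ex do rewrite mulr_suml.
  rewrite Ex_sum => [|k].
    rewrite big1// => k _.
    rewrite (_ : Ex _ _ = Ex P (fun w => a k * t ^+ k * (W w * mono (nseq k i ++ s) (seqX X w)))).
      by rewrite ExZ ?oW.2 ?mulr0//; exact: intg_mulmono.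
    by apply: eq_Ex => w; rewrite mono_nseq_cat exprMn /seqX; ring.
  rewrite (_ : (fun w => _) = (fun w => a k * t ^+ k * (W w * mono (nseq k i ++ s) (seqX X w)))).
    by apply: intgZ; exact: intg_mulmono.
  by apply/funext => w; rewrite mono_nseq_cat exprMn /seqX; ring.
have c : (fun n => Ex P (T n)) @ \oo --> Ex P (fun w => phi (t * X i w) * W w * mono s (seqX X w)).
  apply: (@Ex_dominated _ _ (fun w => `|expR (`|t| * `|X i w|) * mono s (seqX X w) * W w|)).
  - move=> n; apply: measurable_funM; last by apply: measurable_funM; [exact: hW.1|exact: am.1].
    rewrite /series/=; apply: measurable_sum => k.
    by apply: measurable_funM => //; exact: measurable_funX.
  - apply: intg_norm; apply: sqint_mul => //; apply: allmom_sqint; apply: allmomM => //.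
    exact: (allmom_exp_X gX).
  - move=> n w; rewrite /T !normrM -mulrA [ `|mono _ _| * _]mulrC ler_wpM2r ?mulr_ge0//.
    rewrite [leRHS]ger0_norm ?expR_ge0// -normrM.
    apply: (@le_trans _ _ (series (exp_coeff `|t * X i w|) n)).
      rewrite /series/= (le_trans (ler_norm_sum _ _ _))// ler_sum// => k _.
      by rewrite normrM normrX /exp_coeff/= mulrC ler_wpM2l ?exprn_ge0.
    apply: nondecreasing_cvgn_le; last exact: is_cvg_series_exp_coeff.
    apply: nondecreasing_series => k _ _.
    by rewrite /exp_coeff/= divr_ge0// exprn_ge0.
  - by move=> w; rewrite -mulrA; apply: cvgM; [exact: aphi|exact: cvg_cst].
apply: cvg_unique c _ => //.
by rewrite (_ : (fun n => _) = fun=> 0); [exact: cvg_cst|apply/funext].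
Qed.

Lemma mulp_sin i t : mulp (fun w => sin (t * X i w)).
Proof.
apply: (@mulp_power_series (fun k => (odd k)%:R * (-1) ^+ k.-1./2 * (k`!%:R)^-1)).
- move=> k; rewrite !normrM normrX normrN1 expr1n mulr1.
  rewrite [X in _ * X]ger0_norm ?invr_ge0// ler_piMl ?invr_ge0//.
  by case: (odd k); rewrite ?normr1 ?normr0.
- move=> x; rewrite (_ : (fun k => _) = sin_coeff x).
    by rewrite sin.unlock; exact: is_cvg_series_sin_coeff.
  by apply/funext => k; rewrite /sin_coeff/=; ring.
- by move=> x; rewrite ler_norml sin_geN1 sin_le1.
- by apply: continuous_measurable_fun; exact: continuous_sin.
Qed.

Lemma mulp_cos i t : mulp (fun w => cos (t * X i w)).
Proof.
apply: (@mulp_power_series (fun k => (~~ odd k)%:R * (-1) ^+ k./2 * (k`!%:R)^-1)).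
- move=> k; rewrite !normrM normrX normrN1 expr1n mulr1.
  rewrite [X in _ * X]ger0_norm ?invr_ge0// ler_piMl ?invr_ge0//.
  by case: (odd k); rewrite ?normr1 ?normr0.
- move=> x; rewrite (_ : (fun k => _) = cos_coeff x).
    by rewrite cos.unlock; exact: is_cvg_series_cos_coeff.
  by apply/funext => k; rewrite /cos_coeff/= mulrAC.
- by move=> x; rewrite ler_norml cos_geN1 cos_le1.
- by apply: continuous_measurable_fun; exact: continuous_cos.
Qed.

Lemma mulp_sg h : mulp h -> (forall w, `|h w| <= 1) -> mulp (fun w => Num.sg (h w)).
Proof.
move=> mh h1; apply: (@mulp_lim (fun n w => iter n sgn_step (h w)) _ 1).
- elim=> [|n ih] //=; rewrite /sgn_step.
  under eq_fun do rewrite mulrC.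
  apply: mulpZ; apply: mulpB; first exact: mulpZ.
  by apply: mulpM => //; exact: mulpM.
- by move=> n w; have [] := iter_sgn_step (h1 w).
- by move=> w; have [] := iter_sgn_step (h1 w).
Qed.

Lemma mulp_sg_coord i c : mulp (fun w => Num.sg (X i w - c)).
Proof.
(* For t |y| < pi, the number sin(t y) has the sign of y; as t tends to 0 this reaches every y. *)
pose t n : R := n.+1%:R^-1.
apply: (@mulp_lim (fun n w => Num.sg (sin (t n * (X i w - c)))) _ 1).
- move=> n; apply: mulp_sg => [|w]; last by rewrite ler_norml sin_geN1 sin_le1.
  under eq_fun do rewrite mulrBr sinB mulrC [cos _ * _]mulrC.
  by apply: mulpB; apply: mulpZ; [exact: mulp_sin|exact: mulp_cos].
- by move=> n w; rewrite normr_sg; case: eqP.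
move=> w; set y := X i w - c.
apply: cvg_near_cst; near=> n.
have tn0 : 0 < t n by rewrite invr_gt0.
have small : `|y| * t n < pi.
  apply: (@lt_le_trans _ _ 2); last exact: pi_ge2.
  rewrite ltr_pdivrMr//.
  apply: (@lt_le_trans _ _ (n.+1%:R)); last by rewrite ler_peMl// ler1n.
  apply: (@le_lt_trans _ _ n%:R); last by rewrite ltr_nat.
  near: n; exact: nbhs_infty_ger.
have [y0|y0|->] := ltgtP y 0.
- rewrite (_ : t n * y = - (t n * - y)); last by rewrite mulrN opprK.
  rewrite [RHS]ltr0_sg// sinN sgrN gtr0_sg//.
  apply: sin_gt0_pi; rewrite mulr_gt0 ?oppr_gt0//=.
  by move: small; rewrite ltr0_norm// mulrC.
- rewrite !gtr0_sg//; apply: sin_gt0_pi; rewrite mulr_gt0//=.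
  by move: small; rewrite gtr0_norm// mulrC.
- by rewrite mulr0 sin0.
Unshelve. all: by end_near. Qed.

Definition setp (A : set Omega) := measurable A /\ mulp (\1_A : Omega -> R).

Lemma setp_halfline i c : setp (X i @^-1` `]c, +oo[).
Proof.
split; first by rewrite -[X in measurable X]setTI; exact: measurable_funPT.
(* For s in {-1, 0, 1}, (s^2 + s)/2 is 1 if s = 1 and 0 otherwise. *)
rewrite (_ : \1__ = (fun w => 2^-1 * (Num.sg (X i w - c) * Num.sg (X i w - c) + Num.sg (X i w - c)))).
  by apply: mulpZ; apply: mulpD; [apply: mulpM|]; exact: mulp_sg_coord.
apply/funext => w; rewrite indicE.
have [h|h|h] := ltgtP (X i w) c.
- rewrite memNset/= ?in_itv/= ?andbT ?ltNge ?ltW// ltr0_sg ?subr_lt0//.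
  by rewrite mulrNN mul1r subrr mulr0.
- rewrite mem_set/= ?in_itv/= ?andbT// gtr0_sg ?subr_gt0//.
  by field.
- by rewrite memNset/= ?in_itv/= ?andbT h ?ltxx// subrr sgr0 mulr0 addr0 mulr0.
Qed.

(** Complements and intersections are differences and products of multipliers; a countable union is
    the bounded pointwise limit of its finite parts. *)
Lemma sigma_algebra_setp : sigma_algebra setT setp.
Proof.
have setC A : setp A -> setp (~` A).
  move=> [mA pA]; split; first exact: measurableC.
  rewrite (_ : \1__ = (fun w => 1 - \1_A w)); first by apply: mulpB => //; exact: mulp_cst.
  by apply/funext => w; rewrite !indicE in_setC; case: (w \in A); rewrite ?subrr ?subr0.
have setI A B : setp A -> setp B -> setp (A `&` B).
  move=> [mA pA] [mB pB]; split; first exact: measurableI.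
  by rewrite indicI; exact: mulpM.
have set0 : setp set0.
  by split => //; rewrite indic0; exact: mulp_cst.
split => //; first by move=> A pA; rewrite setTD; exact: setC.
move=> F pF.
have fin n : setp (\bigcup_(i < n) F i).
  elim: n => [|n ih]; first by rewrite bigcup_mkord big_ord0.
  rewrite bigcup_mkord big_ord_recr/= -bigcup_mkord.
  by rewrite -[_ `|` _]setCK setCU; apply: (setC); apply: setI; exact: setC.
split; first by apply: bigcupT_measurable => n; have [] := pF n.
apply: (@mulp_lim (fun n => \1_(\bigcup_(i < n) F i)) _ 1).
- by move=> n; have [] := fin n.
- by move=> n w; rewrite indicE; case: (_ \in _); rewrite ?normr1 ?normr0.
move=> w; apply: cvg_near_cst; rewrite !indicE.
have [[k _ Fk]|nF] := pselect ((\bigcup_n F n) w).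
  near=> n.
  have kn : (k < n)%N by near: n; exact: nbhs_infty_gt.
  rewrite indicE mem_set; last by exists k.
  by rewrite mem_set//; exists k.
apply: nearW => n; rewrite indicE memNset; last by move=> [k _ Fk]; apply: nF; exists k.
by rewrite memNset.
Unshelve. all: by end_near. Qed.

Hypothesis genX : generates_measurable X.

Lemma measurable_setp A : measurable A -> setp A.
Proof.
rewrite genX; apply: smallest_sub; first exact: sigma_algebra_setp.
move=> _ [i [B [mB ->]]].
have : (@RGenOInfty.G R).-sigma.-measurable B by rewrite -RGenOInfty.measurableE.
have [s0 sC sU] := sigma_algebra_setp.
apply: (@smallest_sub _ _ _ [set B | setp (X i @^-1` B)]).
- split => /=; first by rewrite preimage_set0.
    by move=> C /sC; rewrite !setTD preimage_setC.
  by move=> C /sU; rewrite preimage_bigcup.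
- by move=> _ [c ->] /=; exact: setp_halfline.
Qed.

(* No nonzero square integrable variable is orthogonal to all monomials: by the
   above, orthogonality to monomials is preserved by multiplication by [\1_A]
   for every event [A]. *)
Lemma orthp_ae0 W : orthp W -> {ae P, forall w, W w = 0}.
Proof.
move=> oW; have [[mW _] _] := oW.
have mA : measurable [set w | 0 <= W w].
  have := measurable_fun_ler (measurable_cst (0 : R)) mW.
  by move=> /(_ measurableT [set true]); rewrite setTI preimage_true; exact.
have [_ pA] := measurable_setp mA; set A := [set w | _] in mA pA.
(* This multiplier takes [W] to |W|; orthogonality to the empty monomial then gives E|W| = 0. *)
have p2 : mulp (fun w => 2 * \1_A w - 1) by apply: mulpB; [exact: mulpZ|exact: mulp_cst].
have [_ _ /(_ W oW)[_ /(_ [::])]] := p2.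
under eq_Ex => w do rewrite /mono big_nil mulr1.
rewrite (_ : (fun w => _) = (fun w => `|W w|)); last first.
  apply/funext => w; rewrite indicE.
  have [h|h] := boolP (w \in A).
    by move: h; rewrite inE /A/= => h; rewrite ger0_norm//; ring.
  have {}h : ~~ (0 <= W w) by apply/negP => h'; move/negP: h; apply; rewrite inE.
  by rewrite (_ : false%:R = 0 :> R)// mulr0 sub0r mulN1r ltr0_norm ?ltNge.
move=> E0.
have iW := sqint_intg oW.1.
have [h _] := @ae_eq_integral_abs _ _ _ P _ measurableT (EFin \o W)
  ((measurable_EFinP _ _).2 mW).
have {h} : ae_eq P setT (EFin \o W) (cst 0%E).
  by apply: h; rewrite (ExE (intg_norm iW)) E0.
by apply: filterS => w /(_ I) /= [].
Qed.

End density.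

(** * Derivatives and Laplacians of monomials *)

Section monomial_derivatives.
Context {R : realType}.
Implicit Types (s : seq nat) (c : nat -> R).

(** Each occurrence of [i] is deleted in turn; repetitions in the resulting list stand for the
    integer coefficient of the derivative. *)
Fixpoint dmono (i : nat) s : seq (seq nat) :=
  if s is j :: s' then
    (if j == i then [:: s'] else [::]) ++ [seq j :: t | t <- dmono i s']
  else [::].

Definition poly (ps : seq (seq nat)) c : R := \sum_(s <- ps) mono s c.

Lemma poly_dmono_cons i j s c :
  poly (dmono i (j :: s)) c = (j == i)%:R * mono s c + c j * poly (dmono i s) c.
Proof.
rewrite /poly /= big_cat big_map/=; congr (_ + _).
  by case: eqP => _; rewrite ?big_seq1 ?mul1r// big_nil mul0r.
by rewrite mulr_sumr; apply: eq_bigr => t _; rewrite mono_cons.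
Qed.

Lemma tame_poly ps : tame (poly ps).
Proof. by apply: tame_sum => s; exact: tame_mono. Qed.

Lemma der_mono i s : der i (@mono R s) (poly (dmono i s)).
Proof.
elim: s => [|j s ih].
  apply: (eq_der _ _ (der_cst i 1)) => c; first by rewrite /mono big_nil.
  by rewrite /poly big_nil.
apply: (eq_der _ _ (derM (der_coord i j) ih)) => c; first by rewrite mono_cons.
by rewrite poly_dmono_cons.
Qed.

(** Euler's identity for homogeneous polynomials. *)
Lemma euler_mono N s c : all (fun i => (i < N)%N) s ->
  \sum_(i < N) c i * poly (dmono i s) c = (size s)%:R * mono s c.
Proof.
elim: s => [_|j s ih /= /andP[jN sN]].
  by rewrite mul0r big1// => i _; rewrite /poly big_nil mulr0.
under eq_bigr do rewrite poly_dmono_cons mulrDr.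
rewrite big_split/= (bigD1 (Ordinal jN))//= eqxx mul1r big1 ?addr0; last first.
  move=> i ij; rewrite (_ : (j == i) = false) ?mul0r ?mulr0//.
  by apply/negbTE; rewrite eq_sym -(inj_eq val_inj) in ij *.
under eq_bigr do rewrite mulrCA.
by rewrite -mulr_sumr ih// mono_cons -[(size s).+1%:R]natr1; ring.
Qed.

Lemma dmono_mem i s t : t \in dmono i s ->
  size s = (size t).+1 /\ forall N, all (fun i => (i < N)%N) s -> all (fun i => (i < N)%N) t.
Proof.
elim: s t => [|j s ih] t //=; rewrite mem_cat => /orP[|/mapP[u /ih[e h] ->]].
  case: eqP => // _; rewrite inE => /eqP ->; split => // N /andP[] //.
by split => [|N /andP[jN /h uN]] /=; rewrite ?e ?jN.
Qed.

Lemma dmono_nil i s N : all (fun i => (i < N)%N) s -> (N <= i)%N -> dmono i s = [::].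
Proof.
elim: s => //= j s ih /andP[jN sN] Ni; rewrite ih// ltn_eqF//.
exact: leq_trans Ni.
Qed.

(** The Laplacian of the monomial in the first [N] variables. Its terms have degree two less, which
    makes the moment identities below a recursion. *)
Definition lap N s c : R :=
  \sum_(i < N) \sum_(t <- dmono i s) poly (dmono i t) c.

Lemma tame_lap N s : tame (lap N s).
Proof. by apply: tame_sum => i; apply: tame_sum => t; exact: tame_poly. Qed.

Lemma lap_widen N M s c : all (fun i => (i < N)%N) s -> (N <= M)%N ->
  lap N s c = lap M s c.
Proof.
move=> sN NM; rewrite /lap (big_ord_widen M (fun i => \sum_(t <- dmono i s) poly (dmono i t) c))//.
rewrite big_mkcond/=; apply: eq_bigr => i _; case: ltnP => // Ni.
by rewrite (dmono_nil sN)// big_nil.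
Qed.

End monomial_derivatives.

(** * Moments of a chaos element against monomials *)

Section chaos.
Context {d : measure_display} {Omega : measurableType d} {R : realType}.
Variables (P : probability Omega R) (X : nat -> {RV P >-> R}).
Hypothesis gX : iid_standard_gaussian X.

Local Notation EX g := (Ex P (fun w => g (seqX X w))).
Local Notation tameP g := (allmom_sqint (allmom_tame gX g)).

Lemma intg_tame g : tame g -> intg P (fun w => g (seqX X w)).
Proof. by move=> tg; exact: (allmom_intg (allmom_tame gX tg)). Qed.

Lemma gaussian_ibp2 i g g' h h' : tame g -> tame g' -> tame h -> tame h' ->
  der i g g' -> der i h h' ->
  EX (fun c => g' c * h c) =
  EX (fun c => g c * (c i * h c)) - EX (fun c => g c * h' c).
Proof.
move=> tg tg' th th' dg dh.
have := gaussian_ibp gX (tameM tg th) (tameD (tameM tg' th) (tameM tg th')) (derM dg dh).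
rewrite ExD; [|exact: (intg_tame (tameM tg' th))|exact: (intg_tame (tameM tg th'))].
move=> e; apply/eqP; rewrite -subr_eq opprK; apply/eqP; rewrite e.
by apply: eq_Ex => w; rewrite /seqX; ring.
Qed.

(** Two integrations by parts move the Ornstein-Uhlenbeck operator from [f] to the monomial, where
    by Euler's identity it is the Laplacian minus the degree. The derivatives are arguments, so that
    the same lemma serves cylinder functions and quadratic forms. *)
Lemma ou_mono N (f : (nat -> R) -> R) (f1 f2 : nat -> (nat -> R) -> R) s :
  tame f -> (forall i, tame (f1 i)) -> (forall i, tame (f2 i)) ->
  (forall i, (i < N)%N -> der i f (f1 i)) ->
  (forall i, (i < N)%N -> der i (f1 i) (f2 i)) ->
  all (fun i => (i < N)%N) s ->
  EX (fun c => (\sum_(i < N) (f2 i c - c i * f1 i c)) * mono s c) =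
  - (size s)%:R * EX (fun c => f c * mono s c) + EX (fun c => f c * lap N s c).
Proof.
move=> tf t1 t2 d1 d2 sN.
have tm := @tame_mono R.
transitivity (\sum_(i < N) EX (fun c => (f2 i c - c i * f1 i c) * mono s c)).
  under eq_Ex do rewrite mulr_suml.
  rewrite Ex_sum// => i; apply: intg_tame (tameM (tameB (t2 i) (tameM (tame_coord i) (t1 i))) (tm s)).
have step (i : 'I_N) : EX (fun c => (f2 i c - c i * f1 i c) * mono s c) =
    EX (fun c => f c * \sum_(t <- dmono i s) poly (dmono i t) c) -
    EX (fun c => f c * (c i * poly (dmono i s) c)).
  (* First integration by parts, from [f2] to [f1]; the term in c_i [f1] cancels. *)
  transitivity (- EX (fun c => f1 i c * poly (dmono i s) c)).
    have := gaussian_ibp2 (t1 i) (t2 i) (tm s) (tame_poly _) (d2 i (ltn_ord i)) (der_mono i s).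
    have -> : EX (fun c => (f2 i c - c i * f1 i c) * mono s c) =
        EX (fun c => f2 i c * mono s c) - EX (fun c => f1 i c * (c i * mono s c)).
      rewrite -ExB.
      - by apply: eq_Ex => w; ring.
      - exact: (intg_tame (tameM (t2 i) (tm s))).
      - exact: (intg_tame (tameM (t1 i) (tameM (tame_coord i) (tm s)))).
    by move=> ->; ring.
  transitivity (- \sum_(t <- dmono i s) EX (fun c => f1 i c * mono t c)).
    congr (- _); rewrite /poly; under eq_Ex do rewrite mulr_sumr.
    by rewrite Ex_sum// => t; exact: (intg_tame (tameM (t1 i) (tm t))).
  (* Second integration by parts, from [f1] to [f], for each term of the derivative of the
     monomial. *)
  transitivity (\sum_(t <- dmono i s) (EX (fun c => f c * poly (dmono i t) c) -
      EX (fun c => f c * (c i * mono t c)))).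
    rewrite -sumrN; apply: eq_bigr => t _.
    rewrite (gaussian_ibp2 tf (t1 i) (tm t) (tame_poly _) (d1 i (ltn_ord i)) (der_mono i t)).
    by ring.
  rewrite sumrB; congr (_ - _).
    under [RHS]eq_Ex do rewrite mulr_sumr.
    by rewrite Ex_sum// => t; exact: (intg_tame (tameM tf (tame_poly _))).
  rewrite /poly; under [RHS]eq_Ex do rewrite !mulr_sumr.
  by rewrite Ex_sum// => t; exact: (intg_tame (tameM tf (tameM (tame_coord i) (tm t)))).
under eq_bigr do rewrite step.
rewrite sumrB addrC; congr (_ + _).
  rewrite -Ex_sum => [|i]; last exact: (intg_tame (tameM tf (tameM (tame_coord i) (tame_poly _)))).
  rewrite mulNr -ExZ; last exact: (intg_tame (tameM tf (tm s))).
  congr (- _); apply: eq_Ex => w; rewrite -mulr_sumr euler_mono//; ring.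
rewrite -Ex_sum => [|i]; last first.
  apply: intg_tame (tameM tf (tame_sum _ _ (fun t => tame_poly (dmono i t)))).
by apply: eq_Ex => w; rewrite -mulr_sumr.
Qed.

Section smooth.
Variables (n : nat) (f : 'rV[R]_n -> R).
Hypothesis sf : smooth_pg f.

Lemma smooth_pg_nat_partial i : smooth_pg (nat_partial i f).
Proof.
move=> s; rewrite /nat_partial; case: insubP => [j _ _|_].
  have := sf (rcons s j); rewrite /iter_partial -cats1 foldr_cat.
  exact.
have -> : iter_partial s (fun=> 0) = (fun=> 0) :> ('rV[R]_n -> R).
  elim: s => //= j s ->; apply/funext => x; rewrite /partial.
  exact: derive_cst.
split; first by move=> x; exact: differentiable_cst.
by exists 0, 0%N => x; rewrite normr0 mul0r.
Qed.

Lemma smooth_pg_differentiable x : differentiable f x.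
Proof. by have [+ _] := sf [::]; exact. Qed.

Lemma tame_smooth : tame (cylf f).
Proof.
apply: tame_cylf; first exact: smooth_pg_differentiable.
by have [_] := sf [::].
Qed.

Lemma der_smooth i : der i (cylf f) (cylf (nat_partial i f)).
Proof. by apply: der_cyl; exact: smooth_pg_differentiable. Qed.

Lemma cylf_ou_op N c : (n <= N)%N -> cylf (ou_op f) c =
  \sum_(i < N) (cylf (nat_partial i (nat_partial i f)) c - c i * cylf (nat_partial i f) c).
Proof.
move=> nN; rewrite /cylf /ou_op.
set x := \row_(j < n) c j.
rewrite -sumrB.
pose G i := nat_partial i (nat_partial i f) x - c i * nat_partial i f x.
rewrite -/(\sum_(i < N) G i).
transitivity (\sum_(i < n) G i).
  apply: eq_bigr => i _; rewrite /G /nat_partial.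
  by rewrite (valK i : insub (i : nat) = Some i) /x mxE.
rewrite (big_ord_widen N G)// big_mkcond/=; apply: eq_bigr => i _.
case: ltnP => // ni; rewrite /G /nat_partial.
by rewrite insubF ?mulr0 ?subr0// ltnNge ni.
Qed.

End smooth.

Lemma ou_smooth n (f : 'rV[R]_n -> R) N s : smooth_pg f ->
  all (fun i => (i < N)%N) s ->
  Ex P (fun w => cylinder X (ou_op f) w * mono s (seqX X w)) =
  - (size s)%:R * Ex P (fun w => cylinder X f w * mono s (seqX X w)) +
  Ex P (fun w => cylinder X f w * lap N s (seqX X w)).
Proof.
move=> sf sN; pose M := maxn n N.
have sM : all (fun i => (i < M)%N) s.
  by apply: sub_all sN => i /leq_trans; apply; exact: leq_maxr.
have s1 i := smooth_pg_nat_partial sf i.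
have s2 i := smooth_pg_nat_partial (s1 i) i.
have := @ou_mono M (cylf f) _ _ s (tame_smooth sf) (fun i => tame_smooth (s1 i))
  (fun i => tame_smooth (s2 i)) (fun i _ => @der_smooth n f sf i)
  (fun i _ => @der_smooth n _ (s1 i) i) sM.
rewrite (_ : Ex P _ = Ex P (fun w => cylinder X (ou_op f) w * mono s (seqX X w))); last first.
  by apply: eq_Ex => w; rewrite -(cylf_ou_op f _ (leq_maxl n N)).
move=> ->; congr (_ + _); apply: eq_Ex => w.
by rewrite -(lap_widen _ sN (leq_maxr n N)).
Qed.

Lemma sqint_smooth n (f : 'rV[R]_n -> R) : smooth_pg f -> sqint P (cylinder X f).
Proof. by move=> sf; exact: (tameP (tame_smooth sf)). Qed.

Lemma sqint_mono s : sqint P (fun w => mono s (seqX X w)).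
Proof. exact: (tameP (tame_mono s)). Qed.

(** The identity [ou_smooth] passes to the L2 limit along the sequence that defines the closure,
    where the operator becomes multiplication by -k. *)
Lemma chaos_mono k F N s : wiener_chaos X k F -> all (fun i => (i < N)%N) s ->
  ((size s)%:R - k%:R) * Ex P (fun w => F w * mono s (seqX X w)) =
  Ex P (fun w => F w * lap N s (seqX X w)).
Proof.
move=> [/sqint_Lfun hF /sqint_Lfun hG [u [v [uv uF vG]]]] sN.
have hu k' : sqint P (u k').
  by have [n [f [sf -> _]]] := uv k'; exact: sqint_smooth.
have hv k' : sqint P (v k').
  have [n [f [sf _ ->]]] := uv k'.
  rewrite (_ : cylinder X (ou_op f) = fun w => \sum_(i < n)
    (cylf (nat_partial i (nat_partial i f)) (seqX X w) -
     seqX X w i * cylf (nat_partial i f) (seqX X w))).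
    have tg : tame (fun c => \sum_(i < n) (cylf (nat_partial i (nat_partial i f)) c -
        c i * cylf (nat_partial i f) c)).
      apply: tame_sum => i; apply: tameB.
        exact: tame_smooth (smooth_pg_nat_partial (smooth_pg_nat_partial sf i) i).
      apply: tameM; first exact: tame_coord.
      exact: tame_smooth (smooth_pg_nat_partial sf i).
    exact: (tameP tg).
  by apply/funext => w; rewrite -(cylf_ou_op f _ (leqnn n)).
have hm := sqint_mono s.
have hL : sqint P (fun w => lap N s (seqX X w)) := tameP (tame_lap N s).
have c1 := cvgL2_mul hv hG hm ((cvg_L2E hv hG).1 vG).
have c2 := cvgL2_mul hu hF hm ((cvg_L2E hu hF).1 uF).
have c3 := cvgL2_mul hu hF hL ((cvg_L2E hu hF).1 uF).
have E : (fun n => Ex P (fun w => v n w * mono s (seqX X w))) =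
    (fun n => - (size s)%:R * Ex P (fun w => u n w * mono s (seqX X w)) +
      Ex P (fun w => u n w * lap N s (seqX X w))).
  apply/funext => j; have [n [f [sf -> ->]]] := uv j.
  exact: ou_smooth.
rewrite E in c1.
have e : Ex P (fun w => - (k%:R * F w) * mono s (seqX X w)) =
    - (size s)%:R * Ex P (fun w => F w * mono s (seqX X w)) +
    Ex P (fun w => F w * lap N s (seqX X w)).
  apply: cvg_unique c1 _ => //.
  by apply: cvgD => //; apply: cvgM => //; exact: cvg_cst.
have e2 : Ex P (fun w => - (k%:R * F w) * mono s (seqX X w)) =
    - k%:R * Ex P (fun w => F w * mono s (seqX X w)).
  rewrite -ExZ; last exact: sqint_mul.
  by apply: eq_Ex => w; ring.
by move: e; rewrite e2; lra.
Qed.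

End chaos.

(** * The second Wiener chaos *)

Section quadratic_forms.
Context {d : measure_display} {Omega : measurableType d} {R : realType}.
Variables (P : probability Omega R) (X : nat -> {RV P >-> R}).
Hypothesis gX : iid_standard_gaussian X.

Local Notation EX g := (Ex P (fun w => g (seqX X w))).

Variable n : nat.
Implicit Types A B : nat -> nat -> R.

Definition linf A i (c : nat -> R) : R := \sum_(j < n) A i j * c j.

(** Subtracting the diagonal turns the squares into Hermite polynomials of degree two. *)
Definition quad A (c : nat -> R) : R := \sum_(i < n) (c i * linf A i c - A i i).

(** The entries of the product of the transpose of A with B, both truncated; for symmetric A this is
    AB. *)
Definition mulT A B j k := \sum_(i < n) A i j * B i k.

Lemma tame_linf A i : tame (linf A i).
Proof. by apply: tame_sum => j; apply: tameZ; exact: tame_coord. Qed.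

Lemma tame_quad A : tame (quad A).
Proof.
apply: tame_sum => i; apply: tameB; last exact: tame_cst.
by apply: tameM; [exact: tame_coord|exact: tame_linf].
Qed.

Lemma der_linf A i j : (i < n)%N -> der i (linf A j) (fun=> A j i).
Proof.
move=> iN; apply: (eq_der _ _ (der_sum _ _ (fun k : 'I_n => derZ (A j k) (der_coord i k)))) => c //.
rewrite (bigD1 (Ordinal iN))//= eqxx mulr1 big1 ?addr0// => k ki.
rewrite (_ : (k == i :> nat) = false) ?mulr0//.
by apply/negbTE; rewrite -(inj_eq val_inj) in ki.
Qed.

Lemma der_quad A i : (forall i j, A i j = A j i) -> (i < n)%N ->
  der i (quad A) (fun c => 2 * linf A i c).
Proof.
move=> sA iN.
apply: (eq_der _ _ (der_sum _ _ (fun k : 'I_n =>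
  derB (derM (der_coord i k) (der_linf A k iN)) (der_cst i (A k k))))) => c //.
under eq_bigr do rewrite subr0.
rewrite big_split/= (bigD1 (Ordinal iN))//= eqxx mul1r big1 ?addr0; last first.
  move=> k ki; rewrite (_ : (k == i :> nat) = false) ?mul0r//.
  by apply/negbTE; rewrite -(inj_eq val_inj) in ki.
rewrite (_ : \sum_(k < n) c k * A k i = linf A i c); first by ring.
by apply: eq_bigr => k _; rewrite sA mulrC.
Qed.

(** Integrating c_i by parts against [linf A i] times [g] produces A_ii g, which the centring of
    [quad] cancels, and the term on the right. *)
Lemma Ex_quad A (g : (nat -> R) -> R) (g' : nat -> (nat -> R) -> R) :
  tame g -> (forall i, tame (g' i)) -> (forall i, (i < n)%N -> der i g (g' i)) ->
  EX (fun c => quad A c * g c) = \sum_(i < n) EX (fun c => linf A i c * g' i c).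
Proof.
move=> tg tg' dg.
transitivity (\sum_(i < n) EX (fun c : nat -> R => (c i * linf A i c - A i i) * g c)).
  under eq_Ex do rewrite mulr_suml.
  rewrite Ex_sum// => i.
  apply: (intg_tame gX (tameM (tameB (tameM (tame_coord i) (tame_linf A i)) (tame_cst (A i i))) tg)).
apply: eq_bigr => i _.
have tl := tame_linf A i.
have h := gaussian_ibp gX (tameM tl tg) (tameD (tameM (tame_cst (A i i)) tg) (tameM tl (tg' i)))
  (derM (der_linf A i (ltn_ord i)) (dg i (ltn_ord i))).
rewrite ExD in h; [|exact: (intg_tame gX (tameM (tame_cst (A i i)) tg))|exact: (intg_tame gX (tameM tl (tg' i)))].
transitivity (EX (fun c : nat -> R => c i * (linf A i c * g c)) - EX (fun c => A i i * g c)).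
  rewrite -ExB; [by apply: eq_Ex => w; ring| |exact: (intg_tame gX (tameM (tame_cst (A i i)) tg))].
  exact: (intg_tame gX (tameM (tame_coord i) (tameM tl tg))).
by rewrite -h; ring.
Qed.

(** For the operator restricted to the first [n] variables, [quad A] is an eigenfunction of
    eigenvalue -2, so it obeys the recursion of the second chaos. *)
Lemma quad_mono A s : (forall i j, A i j = A j i) -> all (fun i => (i < n)%N) s ->
  ((size s)%:R - 2) * EX (fun c => quad A c * mono s c) =
  EX (fun c => quad A c * lap n s c).
Proof.
move=> sA sN.
have := @ou_mono _ _ _ P X gX n (quad A) (fun i c => 2 * linf A i c) (fun i => fun=> 2 * A i i) s
  (tame_quad A) (fun i => tameZ 2 (tame_linf A i)) (fun i => tame_cst (2 * A i i))
  (fun i iN => der_quad sA iN) (fun i iN => derZ 2 (der_linf A i iN)) sN.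
have e2 : Ex P (fun w => (\sum_(i < n) (2 * A i i - seqX X w i * (2 * linf A i (seqX X w)))) *
    mono s (seqX X w)) = - 2 * EX (fun c => quad A c * mono s c).
  rewrite -ExZ; last exact: (intg_tame gX (tameM (tame_quad A) (tame_mono s))).
  apply: eq_Ex => w; rewrite mulrA; congr (_ * _).
  by rewrite /quad mulr_sumr; apply: eq_bigr => i _; ring.
by rewrite e2; lra.
Qed.

Lemma Ex_coord2 i j : EX (fun c : nat -> R => c i * c j) = (j == i)%:R.
Proof.
by rewrite -(gaussian_ibp gX (tame_coord j) (tame_cst _) (der_coord i j)) Ex_cst.
Qed.

Lemma intg_coord2 i j r : intg P (fun w => r * (seqX X w i * seqX X w j)).
Proof. exact: (intg_tame gX (tameZ r (tameM (tame_coord i) (tame_coord j)))). Qed.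

Lemma Ex_linf_coord A i j : (j < n)%N -> EX (fun c : nat -> R => linf A i c * c j) = A i j.
Proof.
move=> jN; under eq_Ex do rewrite mulr_suml.
under eq_Ex do under eq_bigr do rewrite -mulrA.
rewrite Ex_sum => [|k]; last exact: intg_coord2.
rewrite (bigD1 (Ordinal jN))//= big1 ?addr0 => [|k kj].
  rewrite ExZ ?Ex_coord2 ?eqxx ?mulr1//.
  exact: (intg_tame gX (tameM (tame_coord j) (tame_coord j))).
rewrite ExZ; last exact: (intg_tame gX (tameM (tame_coord k) (tame_coord j))).
rewrite Ex_coord2 (_ : (j == k :> nat) = false) ?mulr0//.
by apply/negbTE; rewrite eq_sym -(inj_eq val_inj) in kj *.
Qed.

Lemma Ex_linf2 A B i j :
  EX (fun c => linf A i c * linf B j c) = \sum_(k < n) A i k * B j k.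
Proof.
under eq_Ex do rewrite [X in _ * X]/linf mulr_sumr.
under eq_Ex do under eq_bigr do rewrite mulrCA.
rewrite Ex_sum => [|k].
  apply: eq_bigr => k _; rewrite ExZ ?Ex_linf_coord//; first by rewrite mulrC.
  exact: (intg_tame gX (tameM (tame_linf A i) (tame_coord k))).
exact: (intg_tame gX (tameZ _ (tameM (tame_linf A i) (tame_coord k)))).
Qed.

Lemma Ex_quad_coord2 A i j : (forall i j, A i j = A j i) -> (i < n)%N -> (j < n)%N ->
  EX (fun c => quad A c * mono [:: i; j] c) = 2 * A i j.
Proof.
move=> sA iN jN.
rewrite (Ex_quad A (tame_mono [:: i; j]) (fun k => tame_poly (dmono k [:: i; j]))
  (fun k _ => der_mono k [:: i; j])).
have E (k : 'I_n) : EX (fun c => linf A k c * poly (dmono k [:: i; j]) c) =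
   (i == k :> nat)%:R * A k j + (j == k :> nat)%:R * A k i.
  rewrite -(Ex_linf_coord A k jN) -(Ex_linf_coord A k iN) -!ExZ -?ExD;
    try exact: (intg_tame gX (tameZ _ (tameM (tame_linf A k) (tame_coord _)))).
  - apply: eq_Ex => w; rewrite !poly_dmono_cons /poly/= big_nil /mono big_seq1 big_nil.
    by ring.
  - exact: (intg_tame gX (tameM (tame_linf A k) (tame_coord i))).
  - exact: (intg_tame gX (tameM (tame_linf A k) (tame_coord j))).
under eq_bigr do rewrite E.
rewrite big_split/= (bigD1 (Ordinal iN))//= eqxx mul1r big1 ?addr0; last first.
  move=> k ki; rewrite (_ : (i == k :> nat) = false) ?mul0r//.
  by apply/negbTE; rewrite eq_sym -(inj_eq val_inj) in ki *.
rewrite (bigD1 (Ordinal jN))//= eqxx mul1r big1 ?addr0; last first.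
  move=> k ki; rewrite (_ : (j == k :> nat) = false) ?mul0r//.
  by apply/negbTE; rewrite eq_sym -(inj_eq val_inj) in ki *.
by rewrite (sA j i); ring.
Qed.

(** For A = B symmetric, the left side is a quarter of the square field of [quad A]; it is again a
    centred form plus a constant, which lets moments be computed by iteration. *)
Lemma sum_linf2 A B c : \sum_(i < n) linf A i c * linf B i c =
  quad (mulT A B) c + \sum_(i < n) mulT A B i i.
Proof.
rewrite /quad sumrB subrK.
under eq_bigr do rewrite /linf mulr_suml.
rewrite exchange_big/=; apply: eq_bigr => j _.
rewrite /linf mulr_sumr.
under eq_bigr do rewrite mulr_sumr.
rewrite exchange_big/=; apply: eq_bigr => k _.
rewrite /mulT mulr_suml mulr_sumr; apply: eq_bigr => i _; ring.
Qed.

Lemma Ex_quad0 A : EX (quad A) = 0.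
Proof.
have := Ex_quad A (tame_cst 1) (fun=> tame_cst 0) (fun i _ => der_cst i 1).
under eq_Ex do rewrite mulr1.
by move=> ->; apply: big1 => i _; under eq_Ex do rewrite mulr0; rewrite Ex_cst.
Qed.

Lemma Ex_quad2 B A : (forall i j, A i j = A j i) ->
  EX (fun c => quad B c * quad A c) = 2 * \sum_(i < n) \sum_(j < n) B i j * A i j.
Proof.
move=> sA; rewrite (Ex_quad B (tame_quad A) (fun i => tameZ 2 (tame_linf A i))
  (fun i iN => der_quad sA iN)) mulr_sumr.
apply: eq_bigr => i _; under eq_Ex do rewrite mulrCA.
by rewrite ExZ ?Ex_linf2//; exact: (intg_tame gX (tameM (tame_linf B i) (tame_linf A i))).
Qed.

(** Write Q for [quad A]. [Ex_quad] with g = Q^3 gives 6 E[Q^2 (quad B + tr B)] with B = A^2. The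
    trace part is 12 (tr A^2)^2; a second use turns E[Q^2 quad B] into 4 E[Q quad C] with C = A^3,
    that is, 8 tr A^4. *)
Lemma Ex_quad4 A : (forall i j, A i j = A j i) ->
  EX (fun c => quad A c ^+ 4) = 12 * (\sum_(i < n) \sum_(j < n) A i j ^+ 2) ^+ 2 +
    48 * \sum_(i < n) \sum_(j < n) mulT A A i j ^+ 2.
Proof.
move=> sA; pose B := mulT A A; pose C := mulT B A.
have tQ := tame_quad A; have tl := tame_linf A.
have dQ i (iN : (i < n)%N) := der_quad sA iN.
have d2 i (iN : (i < n)%N) : der i (fun c => quad A c * quad A c) (fun c => 4 * (quad A c * linf A i c)).
  by apply: (eq_der _ _ (derM (dQ i iN) (dQ i iN))) => c //; ring.
have d3 i (iN : (i < n)%N) : der i (fun c => quad A c * quad A c * quad A c)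
    (fun c => 6 * (quad A c * quad A c * linf A i c)).
  by apply: (eq_der _ _ (derM (d2 i iN) (dQ i iN))) => c //; ring.
have tQ2 := tameM tQ tQ; have tQ3 := tameM tQ2 tQ.
have tr : \sum_(i < n) B i i = \sum_(i < n) \sum_(j < n) A i j ^+ 2.
  by apply: eq_bigr => i _; apply: eq_bigr => j _; rewrite expr2 (sA j).
have EB : EX (fun c => quad B c * (quad A c * quad A c)) =
    8 * \sum_(i < n) \sum_(j < n) B i j ^+ 2.
  rewrite (Ex_quad B tQ2 (fun i => tameZ 4 (tameM tQ (tl i))) d2).
  rewrite -Ex_sum => [|i]; last first.
    exact: (intg_tame gX (tameM (tame_linf B i) (tameZ 4 (tameM tQ (tl i))))).
  transitivity (EX (fun c => 4 * (quad C c * quad A c) + 4 * (\sum_(i < n) C i i) * quad A c)).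
    apply: eq_Ex => w; set c := seqX X w.
    transitivity (4 * quad A c * \sum_(i < n) linf B i c * linf A i c).
      by rewrite mulr_sumr; apply: eq_bigr => i _; ring.
    by rewrite sum_linf2 -/C; ring.
  rewrite ExD; [|exact: (intg_tame gX (tameZ 4 (tameM (tame_quad C) tQ)))|exact: (intg_tame gX (tameZ _ tQ))].
  rewrite !ExZ; [|exact: (intg_tame gX tQ)|exact: (intg_tame gX (tameM (tame_quad C) tQ))].
  rewrite Ex_quad0 mulr0 addr0 Ex_quad2// mulrA -natrM; congr (_ * _).
  transitivity (\sum_(i < n) \sum_(j < n) \sum_(k < n) B k i * A k j * A i j).
    by apply: eq_bigr => i _; apply: eq_bigr => j _; rewrite /C /mulT mulr_suml.
  transitivity (\sum_(i < n) \sum_(k < n) B k i * B k i).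
    apply: eq_bigr => i _; rewrite exchange_big/=; apply: eq_bigr => k _.
    rewrite [in X in _ = _ * X]/B /mulT mulr_sumr; apply: eq_bigr => j _.
    by rewrite (sA j k) (sA j i); ring.
  by rewrite exchange_big/=.
transitivity (EX (fun c => quad A c * (quad A c * quad A c * quad A c))).
  by apply: eq_Ex => w; ring.
rewrite (Ex_quad A tQ3 (fun i => tameZ 6 (tameM tQ2 (tl i))) d3).
rewrite -Ex_sum => [|i]; last first.
  exact: (intg_tame gX (tameM (tl i) (tameZ 6 (tameM tQ2 (tl i))))).
transitivity (EX (fun c => 6 * (quad B c * (quad A c * quad A c)) +
   6 * (\sum_(i < n) B i i) * (quad A c * quad A c))).
  apply: eq_Ex => w; set c := seqX X w.
  transitivity (6 * (quad A c * quad A c) * \sum_(i < n) linf A i c * linf A i c).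
    move: (quad A c) => q.
    by rewrite mulr_sumr; apply: eq_bigr => i _; ring.
  by rewrite sum_linf2 -/B; ring.
rewrite ExD; [|exact: (intg_tame gX (tameZ 6 (tameM (tame_quad B) tQ2)))|exact: (intg_tame gX (tameZ _ tQ2))].
rewrite !ExZ; [|exact: (intg_tame gX tQ2)|exact: (intg_tame gX (tameM (tame_quad B) tQ2))].
rewrite EB Ex_quad2// tr.
under [X in 2 * X]eq_bigr do under eq_bigr do rewrite -expr2.
by ring.
Qed.

End quadratic_forms.

(** * Quadratic expansion of an element of the second chaos *)

Section second_chaos.
Context {d : measure_display} {Omega : measurableType d} {R : realType}.
Variables (P : probability Omega R) (X : nat -> {RV P >-> R}).
Hypothesis gX : iid_standard_gaussian X.
Hypothesis genX : generates_measurable X.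
Variable F : Omega -> R.
Hypothesis cF : wiener_chaos X 2 F.

Local Notation tameP g := (allmom_sqint (allmom_tame gX g)).

Let sqF : sqint P F.
Proof. by have [/sqint_Lfun] := cF. Qed.

(** The factor 1/2 inverts [Ex_quad_coord2]. *)
Definition coef i j : R := 2^-1 * Ex P (fun w => F w * mono [:: i; j] (seqX X w)).

Lemma coefC i j : coef i j = coef j i.
Proof. by congr (_ * _); apply: eq_Ex => w; rewrite /mono !big_cons big_nil; ring. Qed.

Definition trunc n w := quad n coef (seqX X w).

Lemma sqint_trunc n : sqint P (trunc n).
Proof. exact: (tameP (tame_quad n coef)). Qed.

Lemma intg_mul_tame H g : sqint P H -> tame g -> intg P (fun w => H w * g (seqX X w)).
Proof. by move=> hH tg; apply: sqint_mul => //; exact: (tameP tg). Qed.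

(** Strong induction on the degree: [F] and [trunc n] satisfy the same recursion, which lowers the
    degree by two. In degrees 0 and 1 the Laplacian vanishes and the recursion gives 0 at once. *)
Lemma trunc_orth n s : all (fun i => (i < n)%N) s ->
  Ex P (fun w => (F w - trunc n w) * mono s (seqX X w)) = 0.
Proof.
have [m] := ubnP (size s); elim: m s => // m ih s sm sN.
have split g : tame g -> Ex P (fun w => (F w - trunc n w) * g (seqX X w)) =
    Ex P (fun w => F w * g (seqX X w)) - Ex P (fun w => trunc n w * g (seqX X w)).
  move=> tg; under eq_Ex do rewrite mulrBl.
  by rewrite ExB//; apply: intg_mul_tame => //; exact: sqint_trunc.
(* Here the factor of the recursion is zero; the choice of [coef] gives the equality instead. *)
have [s2|s2] := eqVneq (size s) 2%N.
  case: s s2 sN {sm} => [|i [|j []]]//= _ /and3P[iN jN _].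
  rewrite split; last exact: tame_mono.
  rewrite /trunc (Ex_quad_coord2 gX coefC iN jN) /coef mulrA mulfV ?mul1r ?subrr//.
have e : ((size s)%:R - 2) * Ex P (fun w => (F w - trunc n w) * mono s (seqX X w)) =
    Ex P (fun w => (F w - trunc n w) * lap n s (seqX X w)).
  rewrite !split; [|exact: tame_lap|exact: tame_mono].
  by rewrite mulrBr (chaos_mono gX cF sN) (quad_mono gX coefC sN).
have s0 : (size s)%:R - 2 != 0 :> R by rewrite subr_eq0 eqr_nat.
apply: (mulfI s0); rewrite mulr0 e /lap.
have hH := sqintB sqF (sqint_trunc n).
under eq_Ex do rewrite mulr_sumr.
rewrite Ex_sum => [|i]; last first.
  exact: (intg_mul_tame hH (tame_sum _ _ (fun t => tame_poly (dmono i t)))).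
apply: big1 => i _; under eq_Ex do rewrite mulr_sumr.
rewrite Ex_sum => [|t]; last by apply: intg_mul_tame => //; exact: tame_poly.
rewrite big_seq; apply: big1 => t /dmono_mem[st tN].
under eq_Ex do rewrite /poly mulr_sumr.
rewrite Ex_sum => [|r]; last by apply: intg_mul_tame => //; exact: tame_mono.
rewrite big_seq; apply: big1 => r /dmono_mem[sr rN].
apply: ih; last by apply: rN; exact: tN.
by move: sm; rewrite st sr => /ltnW.
Qed.

(** Describes polynomials [g] in the first [n] variables by their action: orthogonality of [H] to
    [h] times all monomials passes to [h] times [g]. Products of quadratic forms then never have to
    be expanded into monomials. *)
Definition pmul n (H : Omega -> R) (g : (nat -> R) -> R) := tame g /\
  forall h, tame h ->
  (forall s, all (fun i => (i < n)%N) s ->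
     Ex P (fun w => H w * (h (seqX X w) * mono s (seqX X w))) = 0) ->
  (forall s, all (fun i => (i < n)%N) s ->
     Ex P (fun w => H w * (h (seqX X w) * g (seqX X w) * mono s (seqX X w))) = 0).

Section pmul.
Variables (n : nat) (H : Omega -> R).
Hypothesis hH : sqint P H.

Lemma pmul_cst r : pmul n H (fun=> r).
Proof.
split=> [|h th h0 s sN]; first exact: tame_cst.
rewrite (_ : Ex P _ = r * Ex P (fun w => H w * (h (seqX X w) * mono s (seqX X w)))).
  by rewrite h0// mulr0.
rewrite -ExZ; first by apply: eq_Ex => w; ring.
by apply: (intg_mul_tame hH (g := fun c => h c * mono s c)); apply: tameM => //; exact: tame_mono.
Qed.

Lemma pmul_coord i : (i < n)%N -> pmul n H (fun c => c i).
Proof.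
move=> iN; split=> [|h th h0 s sN]; first exact: tame_coord.
rewrite -(h0 (i :: s)) /= ?iN//.
by apply: eq_Ex => w; rewrite mono_cons; ring.
Qed.

Lemma pmulM f g : pmul n H f -> pmul n H g -> pmul n H (fun c => f c * g c).
Proof.
move=> [tf hf] [tg hg]; split=> [|h th h0 s sN]; first exact: tameM.
rewrite -(hg _ (tameM th tf) (hf h th h0) s sN).
by apply: eq_Ex => w; rewrite !mulrA.
Qed.

Lemma pmulD f g : pmul n H f -> pmul n H g -> pmul n H (fun c => f c + g c).
Proof.
move=> [tf hf] [tg hg]; split=> [|h th h0 s sN]; first exact: tameD.
under eq_Ex do rewrite mulrDr mulrDl mulrDr.
rewrite ExD ?hf ?hg ?addr0//.
- apply: (intg_mul_tame hH (g := fun c => h c * f c * mono s c)).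
  by apply: tameM; [exact: tameM|exact: tame_mono].
- apply: (intg_mul_tame hH (g := fun c => h c * g c * mono s c)).
  by apply: tameM; [exact: tameM|exact: tame_mono].
Qed.

Lemma pmul_sum (I : Type) (s : seq I) (G : I -> (nat -> R) -> R) :
  (forall i, pmul n H (G i)) -> pmul n H (fun c => \sum_(i <- s) G i c).
Proof.
move=> hG; elim: s => [|a s ih].
  by under eq_fun do rewrite big_nil; exact: pmul_cst.
by under eq_fun do rewrite big_cons; exact: pmulD.
Qed.

Lemma pmul_quad m A : (m <= n)%N -> pmul n H (quad m A).
Proof.
move=> mn; have lt (i : 'I_m) : (i < n)%N by exact: leq_trans mn.
apply: pmul_sum => i; apply: pmulD; last exact: pmul_cst.
apply: pmulM; first exact: pmul_coord.
by apply: pmul_sum => j; apply: pmulM; [exact: pmul_cst|exact: pmul_coord].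
Qed.

End pmul.

Lemma trunc_orth_pmul n g : pmul n (fun w => F w - trunc n w) g ->
  Ex P (fun w => (F w - trunc n w) * g (seqX X w)) = 0.
Proof.
move=> [tg h]; rewrite -(h (fun=> 1) (tame_cst 1) _ [::])//.
  by apply: eq_Ex => w; rewrite /mono big_nil mul1r mulr1.
move=> s sN; rewrite -[RHS](trunc_orth sN); apply: eq_Ex => w.
by rewrite mul1r.
Qed.

Lemma trunc_orth_trunc m n : (m <= n)%N ->
  Ex P (fun w => (F w - trunc n w) * trunc m w) = 0.
Proof.
move=> mn; apply: trunc_orth_pmul; apply: pmul_quad => //.
exact: sqintB sqF (sqint_trunc n).
Qed.

(** Convexity of the fourth power: x^4 >= y^4 + 4 (x - y) y^3, and the tangent term has zero
    expectation because y^3 is a polynomial in the first [n] variables. *)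
Lemma Ex_trunc4_le n : intg P (fun w => F w ^+ 4) ->
  Ex P (fun w => trunc n w ^+ 4) <= Ex P (fun w => F w ^+ 4).
Proof.
move=> iF4.
have hH := sqintB sqF (sqint_trunc n).
have tq3 := tameX 3 (tame_quad n coef).
have e0 : Ex P (fun w => (F w - trunc n w) * trunc n w ^+ 3) = 0.
  have q := pmul_quad hH coef (leqnn n).
  rewrite -[RHS](trunc_orth_pmul (pmulM (pmulM q q) q)).
  by apply: eq_Ex => w; rewrite /trunc; ring.
have i3 : intg P (fun w => (F w - trunc n w) * trunc n w ^+ 3) := intg_mul_tame hH tq3.
have i4 : intg P (fun w => trunc n w ^+ 4) := intg_tame gX (tameX 4 (tame_quad n coef)).
rewrite -[leLHS]addr0 -[X in _ + X](mulr0 4) -e0 -ExZ// -ExD//; last exact: intgZ.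
apply: le_Ex => //; first by apply: intgD => //; exact: intgZ.
move=> w; move: (F w) (trunc n w) => x y.
rewrite -subr_ge0 (_ : _ - _ = (x - y) ^+ 2 * ((x + y) ^+ 2 + 2 * y ^+ 2)); last by ring.
by rewrite mulr_ge0 ?sqr_ge0// addr_ge0 ?sqr_ge0// mulr_ge0 ?sqr_ge0.
Qed.

(** Pythagoras: [trunc n - trunc m] is the difference of two remainders, both orthogonal to
    [trunc m]. *)
Lemma Ex_truncB2 m n : (m <= n)%N -> Ex P (fun w => (trunc n w - trunc m w) ^+ 2) =
  Ex P (fun w => trunc n w ^+ 2) - Ex P (fun w => trunc m w ^+ 2).
Proof.
move=> mn; have hm := sqint_trunc m; have hn := sqint_trunc n.
have e1 := trunc_orth_trunc (leqnn m); have e2 := trunc_orth_trunc mn.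
have i1 := sqint_mul (sqintB sqF hm) hm; have i2 := sqint_mul (sqintB sqF hn) hm.
rewrite -ExB; [|exact: hn.2|exact: hm.2].
rewrite -[RHS]subr0 -[X in _ - X](mulr0 2) -[X in 2 * X](subrr 0) -{1}e1 -e2 -ExB// -ExZ; last exact: intgB.
rewrite -ExB; first by apply: eq_Ex => w; ring.
  by apply: intgB; [exact: hn.2|exact: hm.2].
by apply: intgZ; exact: intgB.
Qed.

Lemma Ex_trunc2_le n : Ex P (fun w => trunc n w ^+ 2) <= Ex P (fun w => F w ^+ 2).
Proof.
have hn := sqint_trunc n; have e := trunc_orth_trunc (leqnn n).
have i := sqint_mul (sqintB sqF hn) hn.
rewrite -[leLHS]addr0 -[X in _ + X](mulr0 2) -e -ExZ// -ExD//; [|exact: hn.2|exact: intgZ].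
apply: le_Ex; [by apply: intgD; [exact: hn.2|exact: intgZ]|exact: sqF.2|].
by move=> w; have := sqr_ge0 (F w - trunc n w); lra.
Qed.

(** The second moments increase and are bounded by E F^2, so by Pythagoras the truncations are
    Cauchy. Their limit has the same moments against monomials as [F], and totality identifies the
    two. *)
Lemma cvgL2_trunc : cvgL2 P trunc F.
Proof.
pose e n := Ex P (fun w => trunc n w ^+ 2).
have nd : nondecreasing_seq e.
  move=> m n mn; rewrite -subr_ge0 /e -Ex_truncB2//.
  by apply: Ex_ge0 => w; rewrite sqr_ge0.
have ce : cvgn e.
  apply: nondecreasing_is_cvgn => //.
  by exists (Ex P (fun w => F w ^+ 2)) => _ [n _ <-]; exact: Ex_trunc2_le.
have [S hS cS] : exists2 S, sqint P S & cvgL2 P trunc S.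
  apply: L2_complete; first exact: sqint_trunc.
  move=> eps eps0.
  have /cvgrPdist_le/(_ eps eps0) [N _ hN] := ce.
  exists N.
  have key m n : (N <= m)%N -> (m <= n)%N -> Ex P (fun w => (trunc n w - trunc m w) ^+ 2) <= eps.
    move=> Nm mn; rewrite Ex_truncB2// -/(e n) -/(e m).
    have := hN m Nm; rewrite ler_norml => /andP[_].
    apply: le_trans; rewrite lerD2r.
    exact: nondecreasing_cvgn_le.
  move=> m n Nm Nn; have [mn|/ltnW nm] := leqP m n; last exact: key.
  rewrite (_ : Ex P _ = Ex P (fun w => (trunc n w - trunc m w) ^+ 2)); first exact: key.
  by apply: eq_Ex => w; ring.
have hFS := sqintB sqF hS.
have o : orthp X (fun w => F w - S w).
  split => // s.
  (* The sum of the indices bounds each of them, so from [N] on the monomial only uses available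
     variables. *)
  pose N := (\sum_(i <- s) i).+1.
  have sN n : (N <= n)%N -> all (fun i => (i < n)%N) s.
    move=> Nn; apply/allP => i si; apply: leq_trans Nn.
    by rewrite ltnS (big_rem i si)/= leq_addr.
  have hm := sqint_mono gX s.
  have c := cvgL2_mul sqint_trunc hS hm cS.
  have E n : (N <= n)%N -> Ex P (fun w => trunc n w * mono s (seqX X w)) =
      Ex P (fun w => F w * mono s (seqX X w)).
    move=> Nn; have := trunc_orth (sN n Nn).
    under eq_Ex do rewrite mulrBl.
    rewrite ExB; [|exact: sqint_mul|apply: sqint_mul => //; exact: sqint_trunc].
    by move/eqP; rewrite subr_eq0 => /eqP.
  under eq_Ex do rewrite mulrBl.
  rewrite ExB; [|exact: sqint_mul..].
  apply/eqP; rewrite subr_eq0; apply/eqP.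
  apply: cvg_unique c => //.
  by apply: cvg_near_cst; exists N => // n /= /E.
have ae := orthp_ae0 gX genX o.
apply: (cvgL2_ae_eq sqint_trunc hS sqF _ cS).
by move: ae; apply: filterS => w /eqP; rewrite subr_eq0 => /eqP ->.
Qed.

End second_chaos.

(** * Rank and traces *)

Section linear_algebra.
Variable R : realType.

(** By Lagrange's identity. *)
Lemma sum_cauchy_schwarz (I : finType) (x y : I -> R) :
  (\sum_i x i * y i) ^+ 2 <= (\sum_i x i ^+ 2) * (\sum_i y i ^+ 2).
Proof.
have h : 0 <= \sum_i \sum_j (x i * y j - x j * y i) ^+ 2.
  by apply: sumr_ge0 => i _; apply: sumr_ge0 => j _; rewrite sqr_ge0.
suff e : \sum_i \sum_j (x i * y j - x j * y i) ^+ 2 =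
    2 * ((\sum_i x i ^+ 2) * (\sum_i y i ^+ 2) - (\sum_i x i * y i) ^+ 2).
  by move: h; rewrite e; lra.
transitivity (\sum_i \sum_j (x i ^+ 2 * y j ^+ 2 + y i ^+ 2 * x j ^+ 2 - 2 * ((x i * y i) * (x j * y j)))).
  by apply: eq_bigr => i _; apply: eq_bigr => j _; ring.
under eq_bigr do rewrite sumrB big_split/= -!mulr_sumr.
rewrite sumrB big_split/= -!mulr_suml -mulr_sumr -mulr_suml; ring.
Qed.

Lemma mxtrace_sqr m n (A : 'M[R]_(m, n)) : \tr (A *m A^T) = \sum_i \sum_j A i j ^+ 2.
Proof.
by apply: eq_bigr => i _; rewrite mxE; apply: eq_bigr => j _; rewrite mxE expr2.
Qed.

Lemma row_eq0_of_gram n (v : 'rV[R]_n) : v *m v^T = 0 -> v = 0.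
Proof.
move=> h; have : \tr (v *m v^T) = 0 by rewrite h mxtrace0.
rewrite mxtrace_sqr big_ord1 => /eqP; rewrite psumr_eq0 => [/allP h2|j _]; last exact: sqr_ge0.
apply/rowP => j; rewrite mxE; apply/eqP; rewrite -sqrf_eq0.
by have := h2 j; rewrite mem_index_enum => /(_ isT).
Qed.

(* Cauchy-Schwarz for the Frobenius product of [A ^ 2] with the orthogonal
   projection on the row space of [A], whose trace is the rank. *)
Lemma rank_trace_le n (A : 'M[R]_n) : A^T = A ->
  (\sum_i \sum_j A i j ^+ 2) ^+ 2 <=
  (\rank A)%:R * \sum_i \sum_j (A *m A) i j ^+ 2.
Proof.
move=> sA.
have [C [D [AE fD]]] : exists C : 'M[R]_(n, \rank A), exists D : 'M[R]_(\rank A, n),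
    A = C *m D /\ row_free D.
  by exists (col_base A), (row_base A); rewrite mulmx_base row_base_free.
pose G := D *m D^T.
have uG : G \in unitmx.
  rewrite -row_free_unit; apply: inj_row_free => v vG.
  have : v *m D *m (v *m D)^T = 0 by rewrite trmx_mul -mulmxA (mulmxA D) -/G mulmxA vG mul0mx.
  by move/row_eq0_of_gram/eqP; rewrite mulmx_free_eq0// => /eqP.
have sG : G^T = G by rewrite /G trmx_mul trmxK.
(* The projection on the row space, from a basis [D] with Gram matrix [G]. *)
pose Pi := D^T *m invmx G *m D.
have sPi : Pi^T = Pi by rewrite /Pi trmx_mul (trmx_mul D^T) trmxK trmx_inv sG mulmxA.
have PiPi : Pi *m Pi = Pi.
  rewrite /Pi -!mulmxA; congr (_ *m _).
  by rewrite (mulmxA D) -/G (mulmxA (invmx G)) mulVmx// mul1mx.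
have APi : A *m Pi = A.
  transitivity (C *m D *m Pi); first by rewrite -AE.
  rewrite [RHS]AE -mulmxA; congr (_ *m _).
  by rewrite /Pi !mulmxA -/G mulmxV// mul1mx.
have trPi : \tr Pi = (\rank A)%:R.
  by rewrite /Pi mxtrace_mulC mulmxA -/G mulmxV// mxtrace1.
have e1 : \sum_i \sum_j A i j ^+ 2 = \sum_i \sum_j (A *m A) i j * Pi i j.
  rewrite -mxtrace_sqr sA -{2}APi mulmxA; apply: eq_bigr => i _; rewrite mxE.
  by apply: eq_bigr => j _; rewrite -[in Pi j i]sPi [in X in _ * X]mxE.
have e2 : \sum_i \sum_j Pi i j ^+ 2 = (\rank A)%:R by rewrite -mxtrace_sqr sPi PiPi.
rewrite e1 -e2 mulrC !pair_big/=.
exact: (sum_cauchy_schwarz (fun p : 'I_n * 'I_n => (A *m A) p.1 p.2) (fun p => Pi p.1 p.2)).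
Qed.

(** Independent rows are selected first, then independent columns among them. Injectivity of [J] is
    recorded because the columns will index distinct Gaussian variables. *)
Lemma unit_minor m n (A : 'M[R]_(m, n)) p : (p <= \rank A)%N ->
  exists (I : 'I_p -> 'I_m) (J : 'I_p -> 'I_n),
    injective J /\ \matrix_(k, l) A (I k) (J l) \in unitmx.
Proof.
move=> pr.
pose f := maxrankfun A; pose B := rowsub f A.
have fB : row_free B by exact: maxrowsub_free.
pose C := rowsub (widen_ord pr) B.
have fC : row_free C.
  apply: inj_row_free => v vC.
  (* Extending [v] by zero turns a relation among the first [p] selected rows into one among all of
     them. *)
  pose v' := \row_(k < \rank A) (if insub (k : nat) is Some l then v 0 (l : 'I_p) else 0).
  have e : v' *m B = v *m C.
    apply/rowP => j; rewrite !mxE.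
    pose Fk (k : nat) : R := (if insub k is Some l then v 0 (l : 'I_p) else 0) *
      (if insub k is Some l then B (l : 'I_(\rank A)) j else 0).
    transitivity (\sum_(k < \rank A) Fk k).
      by apply: eq_bigr => k _; rewrite mxE /Fk valK.
    transitivity (\sum_(k < p) Fk k); last first.
      apply: eq_bigr => k _; rewrite /Fk valK !mxE; congr (_ * _).
      by rewrite (valK (widen_ord pr k) : insub (k : nat) = Some (widen_ord pr k)) mxE.
    rewrite [RHS](big_ord_widen _ Fk pr) [RHS]big_mkcond/=; apply: eq_bigr => k _.
    by case: ltnP => // pk; rewrite /Fk insubF ?mul0r// ltnNge pk.
  have : v' *m B = 0 by rewrite e.
  move/eqP; rewrite mulmx_free_eq0// => /eqP v'0.
  apply/rowP => l; have := congr1 (fun u : 'rV_(\rank A) => u 0 (widen_ord pr l)) v'0.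
  by rewrite !mxE (valK l : insub (l : nat) = Some l).
have rC : \rank C^T = p by rewrite mxrank_tr; exact/eqP.
pose g := maxrankfun C^T.
have fg : row_free (rowsub g C^T) by exact: maxrowsub_free.
pose h := cast_ord (esym rC).
exists (f \o widen_ord pr), (g \o h); split.
  move=> k l /= /maxrankfun_inj /cast_ord_inj; exact.
rewrite -unitmx_tr -row_free_unit.
have -> : (\matrix_(k, l) A ((f \o widen_ord pr) k) ((g \o h) l))^T =
   rowsub h (rowsub g C^T).
  by apply/matrixP => k l; rewrite !mxE.
rewrite /h {h}; move: (rowsub g C^T) fg; clear g.
(* The rank equals [p] only up to a proof, so it is generalised before the two index types can be
   identified. *)
move: (\rank C^T) rC => r rC; subst r => N fN.
rewrite (_ : rowsub _ N = N)//; apply/matrixP => k l; rewrite !mxE.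
by congr (N _ _); apply: val_inj.
Qed.

End linear_algebra.

(** * The Malliavin derivative *)

Section malliavin.
Context {d : measure_display} {Omega : measurableType d} {R : realType}.
Variables (P : probability Omega R) (X : nat -> {RV P >-> R}).
Hypothesis gX : iid_standard_gaussian X.

Local Notation EX g := (Ex P (fun w => g (seqX X w))).
Local Notation tameP g := (allmom_sqint (allmom_tame gX g)).

(** The Dirichlet form identity: the expectation of the square field of f is -E[f L f]. *)
Lemma energy N (f : (nat -> R) -> R) (f1 f2 : nat -> (nat -> R) -> R) :
  tame f -> (forall i, tame (f1 i)) -> (forall i, tame (f2 i)) ->
  (forall i, der i f (f1 i)) -> (forall i, der i (f1 i) (f2 i)) ->
  \sum_(i < N) EX (fun c => f1 i c ^+ 2) =
  - EX (fun c => f c * \sum_(i < N) (f2 i c - c i * f1 i c)).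
Proof.
move=> tf t1 t2 d1 d2.
have ti i : tame (fun c => f c * (f2 i c - c i * f1 i c)).
  by apply: (tameM tf); apply: tameB => //; apply: tameM => //; exact: tame_coord.
under [X in - X]eq_Ex do rewrite mulr_sumr.
rewrite Ex_sum => [|i]; last exact: (intg_tame gX (ti i)).
rewrite -sumrN; apply: eq_bigr => i _.
have h := gaussian_ibp2 gX (t1 i) (t2 i) tf (t1 i) (d2 i) (d1 i).
have t12 : tame (fun c => f1 i c * (c i * f c)).
  by apply: (tameM (t1 i)); apply: tameM => //; exact: tame_coord.
have t2f := tameM (t2 i) tf.
transitivity (EX (fun c => f1 i c * (c i * f c)) - EX (fun c => f2 i c * f c)).
  by rewrite h opprB addrC subrK; apply: eq_Ex => w; rewrite expr2.
rewrite -ExB; [|exact: (intg_tame gX t12)|exact: (intg_tame gX t2f)].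
rewrite -[RHS]mulN1r -ExZ; last exact: (intg_tame gX (ti i)).
by apply: eq_Ex => w; ring.
Qed.

(** By the energy identity and -ab <= a^2 + b^2, the graph norm of the Ornstein-Uhlenbeck operator
    controls each partial derivative. *)
Lemma energy_smooth i n n' (f : 'rV[R]_n -> R) (g : 'rV[R]_n' -> R) :
  smooth_pg f -> smooth_pg g ->
  Ex P (fun w => (cylinder X (nat_partial i f) w - cylinder X (nat_partial i g) w) ^+ 2) <=
  Ex P (fun w => (cylinder X f w - cylinder X g w) ^+ 2) +
  Ex P (fun w => (cylinder X (ou_op f) w - cylinder X (ou_op g) w) ^+ 2).
Proof.
move=> sf sg; pose N := maxn i.+1 (maxn n n').
have nN : (n <= N)%N by rewrite !leq_max leqnn orbT.
have nN' : (n' <= N)%N by rewrite !leq_max leqnn !orbT.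
have iN : (i < N)%N by rewrite leq_max leqnn.
have f1 j := smooth_pg_nat_partial sf j; have f2 j := smooth_pg_nat_partial (f1 j) j.
have g1 j := smooth_pg_nat_partial sg j; have g2 j := smooth_pg_nat_partial (g1 j) j.
have tfg := tameB (tame_smooth sf) (tame_smooth sg).
have t1 j := tameB (tame_smooth (f1 j)) (tame_smooth (g1 j)).
have t2 j := tameB (tame_smooth (f2 j)) (tame_smooth (g2 j)).
have e := @energy N _ (fun j c => cylf (nat_partial j f) c - cylf (nat_partial j g) c)
  (fun j c => cylf (nat_partial j (nat_partial j f)) c - cylf (nat_partial j (nat_partial j g)) c)
  tfg t1 t2 (fun j => derB (@der_smooth _ _ _ sf j) (@der_smooth _ _ _ sg j))
  (fun j => derB (@der_smooth _ _ _ (f1 j) j) (@der_smooth _ _ _ (g1 j) j)).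
pose D c := \sum_(j < N) (cylf (nat_partial j (nat_partial j f)) c -
  cylf (nat_partial j (nat_partial j g)) c -
  c j * (cylf (nat_partial j f) c - cylf (nat_partial j g) c)) : R.
have tD : tame D.
  by apply: tame_sum => j; apply: tameB => //; apply: tameM => //; exact: tame_coord.
have DE w : cylinder X (ou_op f) w - cylinder X (ou_op g) w = D (seqX X w).
  rewrite (_ : cylinder X (ou_op f) w = cylf (ou_op f) (seqX X w))//.
  rewrite (_ : cylinder X (ou_op g) w = cylf (ou_op g) (seqX X w))//.
  rewrite (cylf_ou_op f _ nN) (cylf_ou_op g _ nN') -sumrB.
  by apply: eq_bigr => j _; ring.
apply: (@le_trans _ _ (\sum_(j < N) EX (fun c => (cylf (nat_partial j f) c - cylf (nat_partial j g) c) ^+ 2))).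
  rewrite (bigD1 (Ordinal iN))//= lerDl sumr_ge0// => j _.
  by apply: Ex_ge0 => w; rewrite sqr_ge0.
rewrite e -/D.
under [X in _ <= _ + X]eq_Ex do rewrite DE.
have i1 : intg P (fun w => (cylinder X f w - cylinder X g w) ^+ 2) := intg_tame gX (tameX 2 tfg).
have i2 := intg_tame gX (tameX 2 tD).
rewrite -ExD// -[leLHS]mulN1r -ExZ; last exact: (intg_tame gX (tameM tfg tD)).
apply: le_Ex; [exact: (intg_tame gX (tameZ (-1) (tameM tfg tD)))|exact: intgD|].
move=> w; rewrite -/(D _) -[cylf f (seqX X w)]/(cylinder X f w) -[cylf g (seqX X w)]/(cylinder X g w).
move: (cylinder X f w - cylinder X g w) (D (seqX X w)) => a b.
have := sqr_ge0 (a + b); have := sqr_ge0 a; have := sqr_ge0 b; lra.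
Qed.

(** Integration by parts survives the closure, so [F] determines the moments of its derivative
    against all monomials. *)
Lemma closure_ibp i F G s : L2_closure P (partial_core X i) F G ->
  Ex P (fun w => G w * mono s (seqX X w)) =
  Ex P (fun w => F w * (X i w * mono s (seqX X w))) -
  Ex P (fun w => F w * poly (dmono i s) (seqX X w)).
Proof.
move=> [/sqint_Lfun hF /sqint_Lfun hG [u [v [uv uF vG]]]].
have hu k : sqint P (u k).
  by have [n [f [sf -> _]]] := uv k; exact: sqint_smooth.
have hv k : sqint P (v k).
  by have [n [f [sf _ ->]]] := uv k; exact: (sqint_smooth gX (smooth_pg_nat_partial sf i)).
have h1 : sqint P (fun w => X i w * mono s (seqX X w)) :=
  tameP (tameM (tame_coord i) (tame_mono s)).
have h2 : sqint P (fun w => poly (dmono i s) (seqX X w)) := tameP (tame_poly _).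
have c1 := cvgL2_mul hv hG (sqint_mono gX s) ((cvg_L2E hv hG).1 vG).
have c2 := cvgL2_mul hu hF h1 ((cvg_L2E hu hF).1 uF).
have c3 := cvgL2_mul hu hF h2 ((cvg_L2E hu hF).1 uF).
apply: cvg_unique c1 _ => //.
rewrite (_ : (fun n => _) = (fun n => Ex P (fun w => u n w * (X i w * mono s (seqX X w))) -
  Ex P (fun w => u n w * poly (dmono i s) (seqX X w)))); first exact: cvgB.
apply/funext => k; have [n [f [sf -> ->]]] := uv k.
exact: (gaussian_ibp2 gX (tame_smooth sf) (tame_smooth (smooth_pg_nat_partial sf i))
  (tame_mono s) (tame_poly _) (@der_smooth _ _ _ sf i) (der_mono i s)).
Qed.

Lemma cvgL2_cauchy (u : nat -> Omega -> R) F (e : R) : (forall n, sqint P (u n)) -> sqint P F ->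
  cvgL2 P u F -> 0 < e -> exists N, forall m n, (N <= m)%N -> (N <= n)%N ->
  Ex P (fun w => (u m w - u n w) ^+ 2) <= e.
Proof.
move=> hu hF uF e0.
have e4 : 0 < e / 4 by rewrite divr_gt0.
move/cvgrPdist_le : uF => /(_ _ e4) [N _ hN]; exists N => m n Nm Nn.
have b k : (N <= k)%N -> Ex P (fun w => (u k w - F w) ^+ 2) <= e / 4.
  move=> Nk; apply: le_trans (hN k Nk); rewrite sub0r normrN; exact: ler_norm.
have := Ex_sqrB_le (hu m) hF (hu n).
rewrite [X in 2 * (_ + X)](_ : _ = Ex P (fun w => (u n w - F w) ^+ 2)).
  by have := b m Nm; have := b n Nn; lra.
by apply: eq_Ex => w; ring.
Qed.

(** A sequence along which both u and Lu converge has Cauchy partial derivatives, by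
    [energy_smooth]. Hence a chaos element lies in the domain of every closed derivative. *)
Lemma partial_closure_exists k i F : wiener_chaos X k F ->
  exists G, L2_closure P (partial_core X i) F G.
Proof.
move=> [hF hG [u [v [uv uF vG]]]].
have sF := (sqint_Lfun P F).1 hF; have sG := (sqint_Lfun P _).1 hG.
have hu j : sqint P (u j) by have [n [f [sf -> _]]] := uv j; exact: sqint_smooth.
have hv j : sqint P (v j).
  have [n [f [sf _ ->]]] := uv j.
  rewrite (_ : cylinder X (ou_op f) = (fun w => (\sum_(i < n)
    (cylf (nat_partial i (nat_partial i f)) (seqX X w) -
     seqX X w i * cylf (nat_partial i f) (seqX X w))))).
    have tg : tame (fun c => \sum_(i < n) (cylf (nat_partial i (nat_partial i f)) c -
        c i * cylf (nat_partial i f) c)).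
      apply: tame_sum => j'; apply: tameB.
        exact: tame_smooth (smooth_pg_nat_partial (smooth_pg_nat_partial sf j') j').
      apply: tameM; first exact: tame_coord.
      exact: tame_smooth (smooth_pg_nat_partial sf j').
    exact: (tameP tg).
  by apply/funext => w; rewrite -(cylf_ou_op f _ (leqnn n)).
have /choice[w hw] j : exists w, exists n (f : 'rV[R]_n -> R),
    [/\ smooth_pg f, u j = cylinder X f, v j = cylinder X (ou_op f) &
        w = cylinder X (nat_partial i f)].
  by have [n [f [sf uf vf]]] := uv j; exists (cylinder X (nat_partial i f)), n, f.
have sw j : sqint P (w j).
  by have [n [f [sf _ _ ->]]] := hw j; exact: (sqint_smooth gX (smooth_pg_nat_partial sf i)).
have [G sG' cG] : exists2 G, sqint P G & cvgL2 P w G.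
  apply: L2_complete => // e e0.
  have e2 : 0 < e / 2 by rewrite divr_gt0.
  have [N1 h1] := cvgL2_cauchy hu sF ((cvg_L2E hu sF).1 uF) e2.
  have [N2 h2] := cvgL2_cauchy hv sG ((cvg_L2E hv sG).1 vG) e2.
  exists (maxn N1 N2) => m n; rewrite !geq_max => /andP[m1 m2] /andP[n1 n2].
  have := h1 m n m1 n1; have := h2 m n m2 n2.
  have [nf [f [sf -> -> ->]]] := hw m.
  have [ng [g [sg -> -> ->]]] := hw n.
  by have := energy_smooth i sf sg; lra.
exists G; split => //; first exact/sqint_Lfun.
exists u, w; split => //; last exact/(cvg_L2E sw sG').
by move=> j; have [n [f [sf -> _ ->]]] := hw j; exists n, f.
Qed.

Hypothesis genX : generates_measurable X.
Variable F : Omega -> R.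
Hypothesis cF : wiener_chaos X 2 F.

Let sqF : sqint P F.
Proof. by have [/sqint_Lfun] := cF. Qed.

Definition trunc_partial i n w := 2 * linf n (coef X F) i (seqX X w).

Lemma sqint_trunc_partial i n : sqint P (trunc_partial i n).
Proof. exact: (tameP (tameZ 2 (tame_linf n _ i))). Qed.

Lemma sum_coef_sqr_le i n : (i < n)%N ->
  \sum_(j < n) coef X F i j ^+ 2 <= Ex P (fun w => F w ^+ 2).
Proof.
move=> iN; apply: le_trans (Ex_trunc2_le gX cF n).
under eq_Ex do rewrite expr2.
rewrite (Ex_quad2 gX n (coef X F) (@coefC _ _ _ P X F)) [X in _ <= 2 * X](bigD1 (Ordinal iN))//=.
under eq_bigr do rewrite expr2.
have : 0 <= \sum_(j < n) coef X F i j * coef X F i j.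
  by apply: sumr_ge0 => j _; rewrite -expr2 sqr_ge0.
have : 0 <= \sum_(i0 < n | i0 != Ordinal iN) \sum_(j < n) coef X F i0 j * coef X F i0 j.
  by apply: sumr_ge0 => k _; apply: sumr_ge0 => j _; rewrite -expr2 sqr_ge0.
lra.
Qed.

Lemma Ex_trunc_partialB i m n : (m <= n)%N ->
  Ex P (fun w => (trunc_partial i n w - trunc_partial i m w) ^+ 2) =
  4 * (\sum_(j < n) coef X F i j ^+ 2 - \sum_(j < m) coef X F i j ^+ 2).
Proof.
move=> mn; pose a := coef X F; pose L k c := linf k a i c.
have tL k : tame (L k) by exact: tame_linf.
have e k : (k <= n)%N -> EX (fun c => L n c * L k c) = \sum_(j < k) a i j ^+ 2.
  move=> kn; under eq_Ex do rewrite [X in _ * X]/L /linf mulr_sumr.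
  under eq_Ex do under eq_bigr do rewrite mulrCA.
  rewrite Ex_sum => [|j].
    apply: eq_bigr => j _; rewrite ExZ ?(Ex_linf_coord gX)// ?expr2//.
      exact: leq_trans kn.
    exact: (intg_tame gX (tameM (tL n) (tame_coord j))).
  exact: (intg_tame gX (tameZ _ (tameM (tL n) (tame_coord j)))).
have e2 : EX (fun c => L m c * L m c) = \sum_(j < m) a i j ^+ 2.
  by rewrite (Ex_linf2 gX m a a i i); apply: eq_bigr => j _; rewrite expr2.
have inn := intg_tame gX (tameM (tL n) (tL n)); have inm := intg_tame gX (tameM (tL n) (tL m)).
have imm := intg_tame gX (tameM (tL m) (tL m)).
transitivity (4 * (EX (fun c => L n c * L n c) - 2 * EX (fun c => L n c * L m c) + EX (fun c => L m c * L m c))).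
  rewrite -ExZ// -ExB//; last exact: intgZ.
  rewrite -ExD//; last by apply: intgB => //; exact: intgZ.
  rewrite -ExZ; last by apply: intgD => //; apply: intgB => //; exact: intgZ.
  by apply: eq_Ex => w; rewrite /trunc_partial -/a -/(L n _) -/(L m _); ring.
by rewrite !e// e2; ring.
Qed.

(** Square summability of row [i] gives a limit of the truncated derivatives. Integration by parts
    for [trunc n] and for [F] shows that it has the moments of the Malliavin derivative, so totality
    identifies them. *)
Lemma malliavin_partial_lim i :
  sqint P (malliavin_partial X i F) /\
  cvgL2 P (trunc_partial i) (malliavin_partial X i F).
Proof.
set G := malliavin_partial X i F.
have clG : L2_closure P (partial_core X i) F G.
  (* Existence in the closure excludes the default value 0. *)
  rewrite /G /malliavin_partial; case: xgetP => [y _ //|/(_ _) h].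
  by have [y hy] := partial_closure_exists i cF; case: (h y).
have sG : sqint P G by have [_ /sqint_Lfun] := clG.
split => //.
pose e n := \sum_(j < n) coef X F i j ^+ 2.
have nd : nondecreasing_seq e.
  by apply/nondecreasing_seqP => n; rewrite /e big_ord_recr/= lerDl sqr_ge0.
have ce : cvgn e.
  apply: nondecreasing_is_cvgn => //.
  exists (Ex P (fun w => F w ^+ 2)) => _ [n _ <-].
  (* The bound on row [i] comes from a truncation that contains this row, hence the passage to an
     order above [i]. *)
  apply: (le_trans (nd n (maxn n i.+1) (leq_maxl _ _))).
  by apply: sum_coef_sqr_le; exact: leq_maxr.
have [S hS cS] : exists2 S, sqint P S & cvgL2 P (trunc_partial i) S.
  apply: L2_complete; first exact: sqint_trunc_partial.
  move=> eps eps0; have eps4 : 0 < eps / 4 by rewrite divr_gt0.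
  have /cvgrPdist_le/(_ _ eps4) [N _ hN] := ce.
  exists N.
  have key m n : (N <= m)%N -> (m <= n)%N ->
      Ex P (fun w => (trunc_partial i n w - trunc_partial i m w) ^+ 2) <= eps.
    move=> Nm mn; rewrite Ex_trunc_partialB// -/(e n) -/(e m).
    have := hN m Nm; rewrite ler_norml => /andP[_ h].
    have : e n <= limn e by exact: nondecreasing_cvgn_le.
    by move: h => /=; lra.
  move=> m n Nm Nn; have [mn|/ltnW nm] := leqP m n; last exact: key.
  rewrite (_ : Ex P _ = Ex P (fun w => (trunc_partial i n w - trunc_partial i m w) ^+ 2)); first exact: key.
  by apply: eq_Ex => w; ring.
have ae : {ae P, forall w, S w - G w = 0}.
  apply: (orthp_ae0 gX genX); split; first exact: sqintB.
  move=> s; have hm := sqint_mono gX s.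
  under eq_Ex do rewrite mulrBl.
  rewrite ExB; [|exact: sqint_mul..].
  rewrite (closure_ibp s clG).
  apply/eqP; rewrite subr_eq0; apply/eqP.
  have h1 : sqint P (fun w => X i w * mono s (seqX X w)) :=
    tameP (tameM (tame_coord i) (tame_mono s)).
  have h2 : sqint P (fun w => poly (dmono i s) (seqX X w)) := tameP (tame_poly _).
  have cT := cvgL2_trunc gX genX cF.
  have c1 := cvgL2_mul (sqint_trunc_partial i) hS hm cS.
  have c2 := cvgL2_mul (sqint_trunc gX F) sqF h1 cT.
  have c3 := cvgL2_mul (sqint_trunc gX F) sqF h2 cT.
  apply: cvg_unique c1 _ => //.
  have c4 : (fun n => Ex P (fun w => trunc X F n w * (X i w * mono s (seqX X w))) -
    Ex P (fun w => trunc X F n w * poly (dmono i s) (seqX X w))) @ \oo -->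
    (Ex P (fun w => F w * (X i w * mono s (seqX X w))) -
     Ex P (fun w => F w * poly (dmono i s) (seqX X w))) by exact: cvgB.
  (* [der_quad] applies as soon as n > i, which is enough in the limit. *)
  apply: cvg_trans c4; apply: near_eq_cvg; exists i.+1 => // n /= iN.
  apply/esym; exact: (gaussian_ibp2 gX (tame_quad n (coef X F)) (tameZ 2 (tame_linf n (coef X F) i))
    (tame_mono s) (tame_poly _) (der_quad (@coefC _ _ _ P X F) iN) (der_mono i s)).
apply: (cvgL2_ae_eq (sqint_trunc_partial i) hS sG _ cS).
by move: ae; apply: filterS => w /eqP; rewrite subr_eq0 => /eqP ->.
Qed.

End malliavin.

(** * Small balls and negative moments *)

Lemma measurable_norm_le d (T : measurableType d) (R : realType) (Q : T -> R) (e : R) :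
  measurable_fun setT Q -> measurable [set w | (`|Q w| <= e)%R].
Proof.
move=> mQ; have := measurable_fun_ler (measurableT_comp (@normr_measurable R setT) mQ) (measurable_cst e).
by move=> /(_ measurableT [set true]); rewrite setTI; apply.
Qed.

Lemma measurable_forall_norm_le d (T : measurableType d) (R : realType) (I : countType)
    (Q : I -> T -> R) (e : R) : (forall k, measurable_fun setT (Q k)) ->
  measurable [set w | forall k, (`|Q k w| <= e)%R].
Proof.
move=> mQ; rewrite (_ : [set w | _] = \bigcap_k [set w | (`|Q k w| <= e)%R]); last first.
  by apply/seteqP; split => w h; [move=> k _; exact: h|move=> k; exact: (h k)].
rewrite -[X in measurable X]setCK setC_bigcap; apply: measurableC.
apply: countable_bigcupT_measurable => [|k]; first exact: countableP.
by apply: measurableC; exact: measurable_norm_le.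
Qed.

Section small_ball.
Context {d : measure_display} {Omega : measurableType d} {R : realType}.
Variables (P : probability Omega R) (X : nat -> {RV P >-> R}).
Hypothesis gX : iid_standard_gaussian X.

Definition ballb (Z : nat -> (nat -> R) -> R) (e : R) (L : seq nat) (c : nat -> R) : bool :=
  all (fun j => `|c j + Z j c| <= e) L.

Lemma measurable_ballb Z e L : (forall j, measurable_fun setT (Z j : config -> R)) ->
  measurable_fun setT (ballb Z e L : config -> bool).
Proof.
move=> mZ; elim: L => [|k L ih]; first exact: measurable_cst.
rewrite (_ : ballb Z e (k :: L) = fun c => (`|c k + Z k c| <= e) && ballb Z e L c)//.
apply: measurable_and => //; apply: measurable_fun_ler; last exact: measurable_cst.
by apply: measurableT_comp => //; apply: measurable_funD => //; exact: measurable_coord.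
Qed.

Lemma prob_ballb Z e L : (forall j, measurable_fun setT (Z j : config -> R)) ->
  P [set w | ballb Z e L (seqX X w)] =
  (\int[P]_w (((ballb Z e L (seqX X w))%:R : R)%:E))%E.
Proof.
move=> mZ.
have mB : measurable [set w | ballb Z e L (seqX X w)].
  have := measurableT_comp (measurable_ballb e L mZ) (measurable_seqX X).
  by move=> /(_ measurableT [set true]); rewrite setTI; apply.
rewrite -[X in P X]setIT -integral_indic//.
apply: eq_integral => w _; rewrite indicE; congr (_%:R%:E).
by congr nat_of_bool; apply/idP/idP; rewrite inE.
Qed.

(** Coordinates are integrated out one by one. With the others fixed, each constraint confines one
    Gaussian to an interval of length 2e, whose centre does not move since the shifts ignore the
    coordinates in [L]. *)
Lemma small_ball (L : seq nat) (Z : nat -> (nat -> R) -> R) (e : R) : 0 <= e -> uniq L ->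
  (forall j, measurable_fun setT (Z j : config -> R)) ->
  (forall j k x c, j \in L -> k \in L -> Z j (upd x k c) = Z j c) ->
  (P [set w | ballb Z e L (seqX X w)] <= ((2 * e) ^+ size L)%:E)%E.
Proof.
move=> e0 uL mZ; elim: L uL => [_ _|k L ih /= /andP[kL uL] ZL].
  by rewrite expr0; apply: probability_le1; rewrite (_ : [set w | _] = setT)//; apply/seteqP; split.
pose g (L : seq nat) (c : config) : \bar R := ((ballb Z e L c)%:R : R)%:E.
have mg L' : measurable_fun setT (g L').
  apply/measurable_EFinP.
  rewrite (_ : (fun c : config => _) = fun c : config => if ballb Z e L' c then 1 else 0 : R).
    by apply: measurable_fun_ifT => //; exact: measurable_ballb.
  by apply/funext => c; case: ballb.
have g0 L' c : (0 <= g L' c)%E by rewrite lee_fin.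
rewrite [X in (X <= _)%E](prob_ballb e (k :: L) mZ).
rewrite -[X in (X <= _)%E]/(\int[P]_w g (k :: L) (seqX X w))%E.
rewrite (ge0_integral_resample gX k (mg _) (g0 _)).
apply: (@le_trans _ _ (\int[P]_w ((2 * e)%:E * g L (seqX X w)))%E); last first.
  rewrite ge0_integralZl ?lee_fin ?mulr_ge0//; last first.
    exact: (measurableT_comp (mg L) (measurable_seqX X)).
  rewrite exprS (EFinM (2 * e)) lee_wpmul2l ?lee_fin ?mulr_ge0//.
  rewrite -[X in (X <= _)%E]/(\int[P]_w (((ballb Z e L (seqX X w))%:R : R)%:E))%E.
  rewrite -prob_ballb//; apply: ih => // j k' x c jL k'L.
  by apply: ZL; rewrite inE ?jL ?k'L orbT.
apply: ge0_le_integral => //.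
- by move=> w _; apply: integral_ge0.
- have := @measurable_fun_fubini_tonelli_G _ _ _ _ R gauss (g (k :: L) \o resample X k).
  apply; first exact: (measurableT_comp (mg _) (measurable_resample X k)).
  by move=> z; exact: g0.
- apply: measurable_funeM; exact: (measurableT_comp (mg L) (measurable_seqX X)).
move=> w _; set c := seqX X w.
(* Resampling [k] touches only its own constraint: no shift depends on it, and [L] has no
   repetition. *)
have E x : g (k :: L) (upd x k c) = (g L c * (\1_[set x | (`|x + Z k c| <= e)%R] x)%:E)%E.
  rewrite /g -EFinM; congr EFin; rewrite indicE.
  have -> : ballb Z e (k :: L) (upd x k c) = (`|x + Z k c| <= e) && ballb Z e L c.
    rewrite /ballb /= upd_same ZL ?inE ?eqxx//; congr (_ && _).
    apply: eq_in_all => j jL; rewrite ZL ?inE ?eqxx ?jL ?orbT// /upd.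
    by case: eqP => // jk; move: kL; rewrite -jk jL.
  have -> : (x \in [set x | (`|x + Z k c| <= e)%R]) = (`|x + Z k c| <= e).
    by apply/idP/idP; rewrite inE.
  by case: (_ <= _); case: (ballb _ _ _ _); rewrite ?mulr1 ?mulr0.
have mS : measurable [set x | (`|x + Z k c| <= e)%R].
  by apply: measurable_norm_le; exact: measurable_funD.
under eq_integral do rewrite E.
rewrite ge0_integralZl//; last first.
  by apply/measurable_EFinP; exact: measurable_indic.
rewrite integral_indic// setIT muleC lee_wpmul2r//.
exact: gauss_itv_le.
Qed.

(** Applying the inverse minor to the linear forms isolates each X_(J l) up to a shift in the
    remaining variables. [K] is fixed before [n], so it is uniform in the truncation. *)
Lemma linf_small_ball p (a : nat -> nat -> R) (I J : 'I_p -> nat) : injective J ->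
  \matrix_(k, l) a (I k) (J l) \in unitmx ->
  exists2 K : R, 0 <= K & forall n e, (forall l, (J l < n)%N) -> 0 <= e ->
  (P [set w | forall k, (`|2 * linf n a (I k) (seqX X w)| <= e)%R] <= ((K * e) ^+ p)%:E)%E.
Proof.
move=> injJ uM; set M := \matrix_(k, l) _ in uM; pose Mi := invmx M.
(* Dominates every absolute row sum of the inverse minor. *)
pose K : R := \sum_l \sum_k `|Mi l k|.
have K0 : 0 <= K by apply: sumr_ge0 => l _; apply: sumr_ge0.
exists K => // n e Jn e0.
pose L := [seq J l | l <- enum 'I_p].
have uL : uniq L by rewrite map_inj_uniq ?enum_uniq.
have sL : size L = p by rewrite size_map size_enum_ord.
have JL l : J l \in L by apply: map_f; rewrite mem_enum.
pose rest k (c : nat -> R) := \sum_(j < n | (j : nat) \notin L) a (I k) j * c j.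
have lE k c : linf n a (I k) c = rest k c + \sum_l M k l * c (J l).
  rewrite /linf (bigID (fun j : 'I_n => (j : nat) \notin L))/=; congr (_ + _).
  under eq_bigl do rewrite negbK.
  rewrite -(big_mkord (fun j => j \in L) (fun j => a (I k) j * c j)) -big_filter.
  rewrite (perm_big L)/=.
    by rewrite big_map big_enum/=; apply: eq_bigr => l _; rewrite mxE.
  apply: uniq_perm => //; first by rewrite filter_uniq// iota_uniq.
  move=> j; rewrite mem_filter mem_index_iota; case jL: (j \in L) => //=.
  by move/mapP: jL => [l _ ->]; rewrite Jn.
(* The shift belongs to the column [l] with [J l = j], unique by injectivity; 0 is a default off the
   range of [J]. *)
pose Z j (c : nat -> R) : R := if [pick l | J l == j] is Some l then \sum_k Mi l k * rest k c else 0.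
have tr k : tame (rest k).
  by apply: tame_sum => j; apply: tameZ; exact: tame_coord.
have mZ j : measurable_fun setT (Z j : config -> R).
  rewrite /Z; case: pickP => [l _|_]; last exact: measurable_cst.
  have t : tame (fun c => \sum_k Mi l k * rest k c).
    by apply: tame_sum => k; exact: tameZ.
  by case: t.
have ZL j k x c : j \in L -> k \in L -> Z j (upd x k c) = Z j c.
  move=> _ kL; rewrite /Z; case: pickP => // l _.
  apply: eq_bigr => k' _; congr (_ * _); apply: eq_bigr => j' j'L.
  by rewrite /upd; case: eqP => // j'k; move: j'L; rewrite j'k kL.
have ZJ l c : c (J l) + Z (J l) c = \sum_k Mi l k * linf n a (I k) c.
  have -> : Z (J l) c = \sum_k Mi l k * rest k c.
    rewrite /Z; case: pickP => [l' /eqP/injJ -> //|/(_ l)]; by rewrite eqxx.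
  under [RHS]eq_bigr do rewrite lE mulrDr.
  rewrite big_split/= addrC; congr (_ + _).
  under eq_bigr do rewrite mulr_sumr.
  rewrite exchange_big/=.
  transitivity (\sum_l' (Mi *m M) l l' * c (J l')).
    rewrite mulVmx// (bigD1 l)//= mxE eqxx mul1r big1 ?addr0// => l' ll'.
    by rewrite mxE eq_sym (negbTE ll') mul0r.
  apply: eq_bigr => l' _; rewrite mxE mulr_suml.
  by apply: eq_bigr => k _; rewrite mulrA.
have e2 : 0 <= K * e / 2 by rewrite divr_ge0// mulr_ge0.
have -> : (K * e) ^+ p = (2 * (K * e / 2)) ^+ size L.
  by rewrite sL; congr (_ ^+ _); field.
apply: le_trans (small_ball e2 uL mZ ZL).
have mA : measurable [set w | forall k, (`|2 * linf n a (I k) (seqX X w)| <= e)%R].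
  apply: measurable_forall_norm_le => k.
  by have [] := allmom_tame gX (tameZ 2 (tame_linf n a (I k))).
have mB : measurable [set w | ballb Z (K * e / 2) L (seqX X w)].
  have := measurableT_comp (measurable_ballb (K * e / 2) L mZ) (measurable_seqX X).
  by move=> /(_ measurableT [set true]); rewrite setTI; apply.
apply: le_measure; rewrite ?inE//.
move=> w /= h; apply/allP => j /mapP[l _ ->]; rewrite ZJ.
apply: (le_trans (ler_norm_sum _ _ _)).
apply: (@le_trans _ _ (\sum_k `|Mi l k| * (e / 2))).
  apply: ler_sum => k _; rewrite normrM ler_wpM2l//.
  have := h k; rewrite normrM ger0_norm// => hk; lra.
rewrite -mulr_suml -mulrA ler_wpM2r ?divr_ge0//.
by rewrite /K [leRHS](bigD1 l)//= lerDl sumr_ge0// => l' _; exact: sumr_ge0.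
Qed.

Lemma prob_le_lim (A : set Omega) (b : R) (u : nat -> R) : measurable A ->
  (\forall n \near \oo, (P A <= (b + u n)%:E)%E) -> u @ \oo --> (0 : R) ->
  (P A <= b%:E)%E.
Proof.
move=> mA h u0.
have fA : P A \is a fin_num by exact: fin_num_measure.
rewrite -(fineK fA) lee_fin.
have c : (fun n => b + u n) @ \oo --> b.
  by rewrite -[X in _ --> X]addr0; apply: cvgD => //; exact: cvg_cst.
rewrite -(cvg_lim _ c)//; apply: limr_ge; first by apply/cvg_ex; eexists; exact: c.
by move: h; apply: filterS => n; rewrite -{1}(fineK fA) lee_fin.
Qed.

(** If all |D_i F| are at most e, then either the truncated derivatives are all at most 2e, or the
    total error is at least e. The second event has vanishing probability by Chebyshev, and the
    first accounts for the doubled constant. *)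
Lemma malliavin_small_ball (genX : generates_measurable X) F p (I J : 'I_p -> nat) :
  wiener_chaos X 2 F -> injective J ->
  \matrix_(k, l) coef X F (I k) (J l) \in unitmx ->
  exists2 K : R, 0 <= K & forall e, 0 < e ->
  (P [set w | forall k, (`|malliavin_partial X (I k) F w| <= e)%R] <= ((K * e) ^+ p)%:E)%E.
Proof.
move=> cF injJ uM; have [K K0 hK] := linf_small_ball injJ uM.
exists (2 * K) => [|e e0]; first by rewrite mulr_ge0.
pose G k := malliavin_partial X (I k) F.
pose Y n k := trunc_partial X F (I k) n.
have sG k : sqint P (G k) := (malliavin_partial_lim gX genX cF (I k)).1.
have sY n k : sqint P (Y n k) by exact: sqint_trunc_partial.
pose D n w := \sum_k `|Y n k w - G k w|.
have sD1 n k : sqint P (fun w => `|Y n k w - G k w|).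
  have h := sqintB (sY n k) (sG k).
  apply: (sqint_le _ h) => [|w]; last by rewrite normr_id.
  by apply: measurableT_comp => //; exact: h.1.
have sD n : sqint P (D n).
  rewrite /D; elim: (index_enum _) => [|k s ih].
    by under eq_fun do rewrite big_nil; exact: sqint_cst.
  by under eq_fun do rewrite big_cons; exact: sqintD.
have mA : measurable [set w | forall k, (`|G k w| <= e)%R].
  by apply: measurable_forall_norm_le => k; exact: (sG k).1.
apply: (@prob_le_lim _ _ (fun n => Ex P (fun w => D n w ^+ 2) / e ^+ 2)) => //; last first.
  rewrite -[X in _ --> X](mul0r (e ^+ 2)^-1); apply: cvgM; last exact: cvg_cst.
  (* By Cauchy-Schwarz the square of a sum of p errors is at most p times the sum of their
     squares. *)
  have c : (fun n => p%:R * \sum_k Ex P (fun w => (Y n k w - G k w) ^+ 2)) @ \oo --> (0 : R).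
    rewrite -[X in _ --> X](mulr0 p%:R); apply: cvgM; first exact: cvg_cst.
    have z : \sum_(k < p) (0 : R) = 0 by rewrite big1.
    rewrite -[X in _ --> X]z.
    apply: cvg_big => // [|k _]; first exact: add_continuous.
    exact: (malliavin_partial_lim gX genX cF (I k)).2.
  apply: (squeeze_cvgr _ _ c); last exact: cvg_cst.
  apply: nearW => n; apply/andP; split; first by apply: Ex_ge0 => w; rewrite sqr_ge0.
  rewrite -Ex_sum => [|k]; last by have [] := sqintB (sY n k) (sG k).
  rewrite -ExZ; last by apply: intg_sum => k; have [] := sqintB (sY n k) (sG k).
  apply: le_Ex.
  - by have [] := sD n.
  - by apply: intgZ; apply: intg_sum => k; have [] := sqintB (sY n k) (sG k).
  move=> w; have := sum_cauchy_schwarz (fun=> 1) (fun k : 'I_p => `|Y n k w - G k w|).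
  under eq_bigr do rewrite mul1r.
  rewrite expr1n sumr_const card_ord => h; apply: (le_trans h).
  by rewrite ler_wpM2l//; apply: ler_sum => k _; rewrite real_normK ?num_real.
have [N JN] : exists N, forall l, (J l < N)%N.
  exists (\max_l J l).+1 => l; rewrite ltnS; exact: (leq_bigmax l).
exists N => // n /= Nn.
pose B := [set w | forall k, (`|2 * linf n (coef X F) (I k) (seqX X w)| <= 2 * e)%R].
pose C := [set w | (e <= `|D n w|)%R].
have mB : measurable B by apply: measurable_forall_norm_le => k; exact: (sY n k).1.
have mC : measurable C.
  have := measurable_fun_ler (measurable_cst e) (measurableT_comp (@normr_measurable R setT) (sD n).1).
  by move=> /(_ measurableT [set true]); rewrite setTI; apply.
apply: (@le_trans _ _ (P (B `|` C))).
  apply: le_measure; rewrite ?inE//; first exact: measurableU.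
  move=> w /= h; have [eD|De] := leP e `|D n w|; [by right|left] => k.
  have kD : `|Y n k w - G k w| <= D n w by rewrite /D (bigD1 k)//= lerDl sumr_ge0.
  have Dn : D n w < e by apply: le_lt_trans De; exact: ler_norm.
  have -> : 2 * linf n (coef X F) (I k) (seqX X w) = (Y n k w - G k w) + G k w by rewrite subrK.
  apply: (le_trans (ler_normD _ _)).
  by have := h k; rewrite -/(G k w); lra.
apply: (le_trans (measureU2 _ mB mC)); rewrite EFinD leeD//; last exact: chebyshev_sqint.
rewrite (_ : 2 * K * e = K * (2 * e)); last by ring.
by apply: hK; [move=> l; exact: leq_trans (JN l) Nn|rewrite mulr_ge0// ltW].
Qed.

End small_ball.

(** * From small balls to negative moments *)

Section negative_moment.
Context {d : measure_display} {Omega : measurableType d} {R : realType}.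
Variable P : probability Omega R.

Lemma measurable_inve (U : Omega -> \bar R) : measurable_fun setT U ->
  (forall w, (0 <= U w)%E) -> measurable_fun setT (fun w => (U w)^-1)%E.
Proof.
move=> mU U0.
(* At +oo, [fine] returns 0 and 0 to the power -1 is 0, the inverse of +oo; only the value 0 needs a
   separate case. *)
have -> : (fun w => (U w)^-1)%E =
    fun w => if (U w <= 0)%E then +oo%E else ((fine (U w)) `^ (-1))%:E.
  apply/funext => w; have := U0 w; case: (U w) => [u| |] // u0.
  - rewrite inver eq_le; move: u0; rewrite !lee_fin => u0; rewrite u0 andbT.
    by case: leP => // _; rewrite powR_inv1.
  - by rewrite invey leNgt ltry /= powR0// oppr_eq0 oner_eq0.
apply: measurable_fun_ifT => //; first exact: measurable_fun_lee.
apply/measurable_EFinP; apply: (measurableT_comp (measurable_powR _)).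
exact: measurableT_comp.
Qed.

(* Dyadic decomposition according to the size of [U]. *)
Lemma negative_moment (U : Omega -> \bar R) (K q : R) p : 0 <= K -> 0 < q ->
  q < p%:R / 2 -> measurable_fun setT U -> (forall w, (0 <= U w)%E) ->
  (forall e : R, 0 < e -> (P [set w | (U w <= (e ^+ 2)%:E)%E] <= ((K * e) ^+ p)%:E)%E) ->
  (\int[P]_w (`|(U w)^-1| `^ q) < +oo)%E.
Proof.
move=> K0 q0 qp mU U0 hU.
(* Where U >= 4^-(k+1), the power U^-q is at most b^(k+1). *)
pose b : R := 4 `^ q.
have b1 : 1 <= b by rewrite /b -[leLHS](powRr0 4) ler_powR ?ler1n// ltW.
have b0 : 0 <= b := le_trans ler01 b1.
pose h k : R := 2^-1 ^+ k.
have h0 k : 0 < h k by rewrite exprn_gt0.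
pose A k := [set w | (U w <= (h k ^+ 2)%:E)%E].
have mA k : measurable (A k).
  by rewrite -[A k]setTI; exact: emeasurable_fun_infty_c.
pose T k w := ((b ^+ k.+1)%:E * (\1_(A k) w)%:E)%E.
have T0 k w : (0 <= T k w)%E by rewrite mule_ge0// lee_fin exprn_ge0.
have mT k : measurable_fun setT (T k).
  by apply/measurable_EFinP; apply: measurable_funM => //; exact: measurable_indic.
have S0 w : (0 <= \sum_(0 <= k <oo) T k w)%E by apply: nneseries_ge0.
have leT k w : (T k w <= \sum_(0 <= k <oo) T k w)%E.
  apply: le_trans (nneseries_lim_ge k.+1 _) => [|n _ _]; last exact: T0.
  by rewrite big_nat_recr//= leeDr// sume_ge0.
have pt w : (`|(U w)^-1| `^ q <= 1 + \sum_(0 <= k <oo) T k w)%E.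
  have := U0 w; case Uw: (U w) => [u| |] //; last first.
    by move=> _; rewrite invey abse0 poweR0r ?gt_eqF// adde_ge0.
  rewrite lee_fin le_eqVlt => /predU1P[u0|u0].
    (* At U = 0 every indicator is 1 and b >= 1, so the series diverges, in accordance with the
       inverse of 0 being +oo. *)
    have -> : (\sum_(0 <= k <oo) T k w = +oo)%E.
      apply/eqyP => r r0; have [n rn] : exists n : nat, r <= n%:R.
        by exists (Num.trunc r).+1; rewrite ltW// truncnS_gt.
      apply: le_trans (nneseries_lim_ge n _) => [|k _ _]; last exact: T0.
      apply: (@le_trans _ _ (\sum_(0 <= k < n) 1%:E)%E).
        by rewrite sumEFin lee_fin big_const_nat subn0 iter_addr_0 (le_trans rn).
      apply: lee_sum => k _; rewrite /T indicE mem_set ?mule1 ?lee_fin ?exprn_ege1//.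
      by rewrite /A/= Uw -u0 lee_fin sqr_ge0.
    by rewrite addey// leey.
  have -> : (`|u%:E^-1| = (u^-1)%:E)%E.
    by rewrite inver gt_eqF// abse_EFin ger0_norm// invr_ge0 ltW.
  rewrite poweR_EFin.
  have [u1|u1] := leP 1 u.
    rewrite (@le_trans _ _ 1%E)// ?leeDl// lee_fin.
    rewrite [leRHS](_ : _ = 1 `^ q); last by rewrite powR1.
    rewrite ge0_ler_powR ?nnegrE ?invr_ge0 ?(ltW u0) ?(ltW q0)//.
    by rewrite invf_le1.
  have ex : exists n, h n ^+ 2 <= u.
    have c : (fun n => (4^-1 : R) ^+ n) @ \oo --> (0 : R).
      by apply: cvg_expr; rewrite ger0_norm// invf_lt1// ltr1n.
    have /cvgrPdist_le/(_ u u0)[n _ hn] := c.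
    exists n; have := hn n (leqnn n); rewrite sub0r normrN ger0_norm ?exprn_ge0//.
    by rewrite /h -exprM mulnC exprM expr2 -invfM -natrM.
  (* The least such [n] is positive and places u between [h n ^+ 2] and the square of the preceding
     level. *)
  have [n hn min_n] := ex_minnP ex.
  case: n hn min_n => [|k hk min_k].
    by rewrite /h expr0 expr1n leNgt u1.
  have uk : u <= h k ^+ 2.
    by rewrite leNgt; apply/negP => /ltW /min_k; rewrite ltnn.
  apply: (le_trans _ (leeDr _ _)) => //; apply: (le_trans _ (leT k w)).
  rewrite /T indicE mem_set ?mule1 ?lee_fin; last by rewrite /A/= Uw lee_fin.
  have -> : b ^+ k.+1 = ((h k.+1 ^+ 2)^-1) `^ q.
    have -> : (h k.+1 ^+ 2)^-1 = 4 `^ k.+1%:R.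
      rewrite powR_mulrn// /h exprVn exprVn invrK -exprM mulnC exprM; congr (_ ^+ _).
      by rewrite expr2 -natrM.
    by rewrite -powRrM mulrC powRrM powR_mulrn.
  rewrite ge0_ler_powR ?nnegrE ?invr_ge0 ?sqr_ge0 ?(ltW u0) ?(ltW q0)//.
  by rewrite lef_pV2 ?posrE// exprn_gt0.
(* The ratio is 4^q / 2^p, which is below 1 precisely when q < p/2. *)
pose r := b / 2 ^+ p.
have r0 : 0 <= r by rewrite divr_ge0// exprn_ge0.
have r1 : `|r| < 1.
  rewrite ger0_norm// /r ltr_pdivrMr ?exprn_gt0// mul1r.
  rewrite -powR_mulrn// /b (_ : 4 = 2 `^ 2); last by rewrite powR_mulrn// expr2 -natrM.
  rewrite -powRrM /powR pnatr_eq0/= ltr_expR ltr_pM2r; last by rewrite ln_gt0 ?ltr1n.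
  by move: qp; rewrite ltr_pdivlMr// mulrC.
apply: (@le_lt_trans _ _ (\int[P]_w (1 + \sum_(0 <= k <oo) T k w)))%E.
  apply: ge0_le_integral => //.
  - by move=> w _; exact: poweR_ge0.
  - apply: (measurableT_comp (measurable_poweR q)); apply: measurableT_comp => //.
    exact: measurable_inve.
  - by apply: emeasurable_funD => //; apply: ge0_emeasurable_sum.
rewrite ge0_integralD//; last by apply: ge0_emeasurable_sum.
rewrite integral_cst// mul1e [X in (X + _)%E](probability_setT P).
rewrite integral_nneseries//.
apply: lte_add_pinfty; first exact: ltry.
apply: (@le_lt_trans _ _ (\sum_(0 <= k <oo) (b * K ^+ p * r ^+ k)%:E)%E).
  apply: lee_nneseries => [k _ _|k _]; first by apply: integral_ge0.
  rewrite /T integralZl//; last exact: integrable_indic.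
  rewrite integral_indic// setIT.
  apply: (@le_trans _ _ ((b ^+ k.+1)%:E * ((K * h k) ^+ p)%:E)%E).
    by rewrite lee_wpmul2l ?lee_fin ?exprn_ge0//; exact: hU.
  rewrite -EFinM lee_fin /r exprS !exprMn -!mulrA ler_wpM2l//.
  rewrite le_eqVlt; apply/orP; left; apply/eqP.
  rewrite /h -exprM mulnC exprM !exprVn -exprM mulnC exprM; ring.
have /cvg_lim lim : (fun n => (\sum_(0 <= k < n) (b * K ^+ p * r ^+ k)%:E)%E) @ \oo -->
    (b * K ^+ p / (1 - r))%:E.
  under eq_fun do rewrite sumEFin.
  apply: cvg_EFin; first by near=> n.
  exact: (@cvg_geometric_series R (b * K ^+ p) r r1).
by rewrite lim// ltry.
Unshelve. all: by end_near. Qed.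

End negative_moment.

(** * Fourth moment and rank of the truncations *)

Section rank.
Context {d : measure_display} {Omega : measurableType d} {R : realType}.
Variables (P : probability Omega R) (X : nat -> {RV P >-> R}).
Hypothesis gX : iid_standard_gaussian X.
Hypothesis genX : generates_measurable X.
Variable F : Omega -> R.
Hypothesis cF : wiener_chaos X 2 F.
Hypothesis F2 : Ex P (fun w => F w ^+ 2) = 1.

Definition coef_mx n : 'M[R]_n := \matrix_(i, j) coef X F i j.

(** By orthogonality E[T_n^2] = E[T_n F] for the truncation T_n, and the right side passes to the L2
    limit. *)
Lemma cvg_Ex_trunc2 : (fun n => Ex P (fun w => trunc X F n w ^+ 2)) @ \oo --> (1 : R).
Proof.
have sF : sqint P F.
  by apply/sqint_Lfun; have [] := cF.
have sT := sqint_trunc gX F.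
have e n : Ex P (fun w => trunc X F n w ^+ 2) = Ex P (fun w => trunc X F n w * F w).
  have := trunc_orth_trunc gX cF (leqnn n).
  under eq_Ex do rewrite mulrBl mulrC -expr2.
  rewrite ExB; [|exact: sqint_mul|by case: (sT n)].
  by move/eqP; rewrite subr_eq0 => /eqP.
under eq_fun do rewrite e.
have F2E : Ex P (fun w => F w * F w) = 1.
  by rewrite -F2; apply: eq_Ex => w; rewrite expr2.
rewrite -F2E.
exact: (cvgL2_mul sT sF sF (cvgL2_trunc gX genX cF)).
Qed.

(** If all ranks were at most p - 1, then with t = E[T_n^2] and y = tr A_n^4 one would have t^2 <= 4
    (p - 1) y and 3 t^2 + 48 y <= E F^4. Eliminating y and letting t tend to 1 contradicts the
    hypothesis. The factor p - 1 is kept as a multiplier to include p = 1 without division. *)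
Lemma rank_coef_mx_ge p : intg P (fun w => F w ^+ 4) ->
  p.-1%:R * (Ex P (fun w => F w ^+ 4) - 3) < 12 -> exists n, (p <= \rank (coef_mx n))%N.
Proof.
move=> F4 hp; apply: contrapT => no.
have rk n : (\rank (coef_mx n) <= p.-1)%N.
  by rewrite leqNgt; apply/negP => h; apply: no; exists n; move: h; clear; case: p.
have sC i j : coef X F i j = coef X F j i by exact: coefC.
pose t n := Ex P (fun w => trunc X F n w ^+ 2).
pose y n := \sum_(i < n) \sum_(j < n) mulT n (coef X F) (coef X F) i j ^+ 2.
have tE n : t n = 2 * \sum_(i < n) \sum_(j < n) coef X F i j ^+ 2.
  rewrite /t; under eq_Ex do rewrite expr2.
  by rewrite (Ex_quad2 gX n (coef X F) sC); under eq_bigr do under eq_bigr do rewrite -expr2.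
have k1 n : t n ^+ 2 <= 4 * p.-1%:R * y n.
  have sA : (coef_mx n)^T = coef_mx n by apply/matrixP => i j; rewrite !mxE.
  have := rank_trace_le sA.
  have -> : \sum_i \sum_j coef_mx n i j ^+ 2 = t n / 2.
    rewrite tE mulrC mulKf//; apply: eq_bigr => i _; apply: eq_bigr => j _; by rewrite mxE.
  have -> : \sum_i \sum_j (coef_mx n *m coef_mx n) i j ^+ 2 = y n.
    apply: eq_bigr => i _; apply: eq_bigr => j _; rewrite mxE /mulT; congr (_ ^+ 2).
    by apply: eq_bigr => k _; rewrite !mxE sC.
  have y0 : 0 <= y n by apply: sumr_ge0 => i _; apply: sumr_ge0 => j _; exact: sqr_ge0.
  have : (\rank (coef_mx n))%:R * y n <= p.-1%:R * y n by rewrite ler_wpM2r// ler_nat.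
  rewrite expr_div_n; lra.
have k2 n : 3 * t n ^+ 2 + 48 * y n <= Ex P (fun w => F w ^+ 4).
  have := Ex_trunc4_le gX cF n F4; rewrite (Ex_quad4 gX n sC) -/(y n).
  have := tE n; set s := \sum_(i < n) _ => ->; lra.
have k3 n : (3 * p.-1%:R + 12) * t n ^+ 2 <= p.-1%:R * Ex P (fun w => F w ^+ 4).
  have := k1 n; have := k2 n.
  have : 0 <= p.-1%:R :> R by []; nra.
have c : (fun n => (3 * p.-1%:R + 12) * t n ^+ 2) @ \oo --> (3 * p.-1%:R + 12 : R).
  rewrite -[X in _ --> X]mulr1; apply: cvgM; first exact: cvg_cst.
  rewrite -[X in _ --> X](expr1n R 2).
  by under eq_fun do rewrite expr2; rewrite expr2; apply: cvgM; exact: cvg_Ex_trunc2.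
have : 3 * p.-1%:R + 12 <= p.-1%:R * Ex P (fun w => F w ^+ 4).
  rewrite -(cvg_lim _ c)//; apply: limr_le; first by apply/cvg_ex; eexists; exact: c.
  exact: nearW.
lra.
Qed.

End rank.

(** After simplification by 24 this is p - 1 < 2^(p-1) (p+1)!, which follows from p - 1 <
    2^(p-1). *)
Lemma chaos_rank_bound (R : realFieldType) p : (1 <= p)%N ->
  p.-1%:R * (24%:R / (2%:R ^+ p * (p.+1)`!%:R)) < 12 :> R.
Proof.
move=> p1; rewrite mulrA ltr_pdivrMr; last by rewrite mulr_gt0 ?exprn_gt0 ?ltr0n ?fact_gt0.
rewrite -natrX -!natrM ltr_nat.
have h1 : (p.-1 < 2 ^ p.-1)%N by exact: ltn_expl.
have h2 := fact_gt0 p.+1.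
case: p p1 h1 h2 => // p _ /= h1 h2.
rewrite expnS -mulnA mulnA mulnC -[24%N]/(12 * 2)%N ltn_pmul2l//.
exact: leq_trans h1 (leq_pmulr _ h2).
Qed.

Theorem theorem1 (R : realType) (d : measure_display)
    (Omega : measurableType d) (P : probability Omega R)
    (X : nat -> {RV P >-> R}) (F : Omega -> R) :
  iid_standard_gaussian X ->
  generates_measurable X ->
  wiener_chaos X 2 F ->
  ('E_P[fun w => (F w ^+ 2)%R] = 1)%E ->
  forall p : nat, (1 <= p)%N ->
  (kappa4 P F < (24%:R / (2%:R ^+ p * (p.+1)`!%:R) : R)%:E)%E ->
  forall q : R, 0 < q < p%:R / 2%:R ->
  in_Lq P q (fun w => (square_field X F w)^-1)%E.
Proof.
move=> gX genX cF F2 p p1 k4 q /andP[q0 qp].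
have sF : sqint P F by apply/sqint_Lfun; have [] := cF.
have F2' : Ex P (fun w => F w ^+ 2) = 1.
  by move: F2; rewrite unlock ExE; [case|exact: sF.2].
have mF4 : measurable_fun setT (fun w => F w ^+ 4) by apply: measurable_funX; exact: sF.1.
have F4 : intg P (fun w => F w ^+ 4).
  apply/integrableP; split; first exact/measurable_EFinP.
  have -> : (\int[P]_w `|(F w ^+ 4)%:E| = 'E_P[fun w => (F w ^+ 4)%R])%E.
    rewrite unlock; apply: eq_integral => w _.
    by rewrite abse_EFin ger0_norm// exprn_even_ge0.
  (* An infinite fourth moment would make [kappa4] equal to +oo, against the bound. *)
  move: k4; rewrite /kappa4; case: ('E_P[_])%E => [r| |] //= _; exact: ltry.
have k4' : Ex P (fun w => F w ^+ 4) - 3 < 24%:R / (2%:R ^+ p * (p.+1)`!%:R).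
  by move: k4; rewrite /kappa4 unlock ExE// -EFinB lte_fin.
have [n rn] : exists n, (p <= \rank (coef_mx X F n))%N.
  apply: rank_coef_mx_ge => //; apply: le_lt_trans (chaos_rank_bound R p1).
  by rewrite ler_wpM2l// ltW.
have [I [J [injJ uM]]] := unit_minor rn.
have injJ' : injective (fun l => J l : nat) by move=> k l /val_inj /injJ.
have uM' : \matrix_(k, l) coef X F (I k) (J l) \in unitmx.
  by move: uM; congr (_ \in unitmx); apply/matrixP => k l; rewrite !mxE.
have [K K0 hK] := malliavin_small_ball gX genX cF injJ' uM'.
pose U := square_field X F.
have mG i : measurable_fun setT (malliavin_partial X i F) := (malliavin_partial_lim gX genX cF i).1.1.
have mU : measurable_fun setT U.
  apply: ge0_emeasurable_sum => [i w _ _|i _]; first by rewrite lee_fin sqr_ge0.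
  by apply/measurable_EFinP; exact: measurable_funX.
have U0 w : (0 <= U w)%E by apply: nneseries_ge0 => i _ _; rewrite lee_fin sqr_ge0.
split; first exact: measurable_inve.
apply: (negative_moment K0 q0 qp mU U0) => e e0.
apply: le_trans (hK e e0); apply: le_measure; rewrite ?inE.
- by rewrite -[X in measurable X]setTI; exact: emeasurable_fun_infty_c.
- by apply: measurable_forall_norm_le => k; exact: mG.
move=> w /= Ue k.
(* Each squared derivative is one term of the nonnegative series [U], so U <= e^2 bounds it by
   e^2. *)
have : (((malliavin_partial X (I k) F w) ^+ 2)%:E <= U w)%E.
  apply: le_trans (nneseries_lim_ge (I k).+1 _) => [|i _ _]; last by rewrite lee_fin sqr_ge0.
  by rewrite big_nat_recr//= leeDr// sume_ge0// => i _; rewrite lee_fin sqr_ge0.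
move=> /le_trans/(_ Ue); rewrite lee_fin -real_normK ?num_real//.
by rewrite ler_sqr ?nnegrE ?(ltW e0).
Qed.
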